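(* Consider the full dynamic model of a quadrotor with an $n$-link cable and payload, $$M_{00}\ddot x+\sum_{i=1}^nM_{0i}\ddot q_i=-fRe_3+M_{00}ge_3+\Delta_x,$$ $$M_{ii}\ddot q_i-\hat q_i^2\Big(M_{i0}\ddot x+\sum_{j=1,\,j\ne i}^nM_{ij}\ddot q_j\Big)=-M_{ii}\|\dot q_i\|^2q_i-\sum_{a=i}^nm_agl_i\,\hat q_i^2e_3,\quad i=1,\dots,n,$$ $$J\dot\Omega+\hat\Omega J\Omega=M+\Delta_R,\qquad\dot R=R\hat\Omega,\qquad\dot q_i=\omega_i\times q_i,$$ with the control inputs $$f=-A\cdot Re_3,$$ $$M=-k_Re_R-k_\Omega e_\Omega-k_Ie_I+\Omega\times J\Omega-J\big(\hat\Omega R^TR_c\Omega_c-R^TR_c\dot\Omega_c\big),$$ where $A$, $R_c$, $\Omega_c$, $e_R$, $e_\Omega$, $e_I$, $\mathbf{x}$, $e_{\mathbf{x}}$ are as defined in the context. There exist controller parameters and gains such that: (i) the zero equilibrium of the tracking errors is stable in the sense of Lyapunov; (ii) the tracking errors $e_R,e_\Omega,\mathbf{x},\dot{\mathbf{x}}$ asymptotically converge to zero as $t\to\infty$; (iii) the integral terms $e_I$ and $e_{\mathbf{x}}$ are uniformly bounded.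
   Context: **System.** $e_1,e_2,e_3$ is the standard basis of $\mathbb{R}^3$, $e_3$ the direction of gravity, $g$ the gravitational acceleration. $x\in\mathbb{R}^3$, $R\in\mathsf{SO(3)}$, $\Omega\in\mathbb{R}^3$ are the position, attitude and body-frame angular velocity of the quadrotor, with mass $m$ and inertia matrix $J$. Link $i$ ($1\le i\le n$) has mass $m_i$ at its outboard end, length $l_i$, direction $q_i\in\mathsf{S}^2=\{q\in\mathbb{R}^3:\|q\|=1\}$ and angular velocity $\omega_i$ with $\omega_i\cdot q_i=0$. The hat map is $\hat xy=x\times y$, with inverse the vee map $\vee:\mathfrak{so}(3)\to\mathbb{R}^3$. For $1\le i,j\le n$, $M_{00}=m+\sum_{i=1}^nm_i$, $M_{0i}=M_{i0}=\sum_{a=i}^nm_al_i$, $M_{ij}=(\sum_{a=\max\{i,j\}}^nm_a)l_il_j$. The control inputs are the thrust magnitude $f\in\mathbb{R}$ and the moment $M\in\mathbb{R}^3$. $\Delta_x,\Delta_R\in\mathbb{R}^3$ are fixed (constant) disturbances, and a constant $\delta>0$ with $\|\Delta_x\|_\infty\le\delta$ is known. **Linearized coordinates.** $x_d\in\mathbb{R}^3$ is a fixed desired position. Let $\delta x=x-x_d$, $C=[e_1,e_2]\in\mathbb{R}^{3\times2}$, and let $\xi_i\in\mathbb{R}^3$ with $\xi_i\cdot e_3=0$ represent $q_i$ relative to $e_3$ ($\delta q_i=\xi_i\times e_3$, i.e. $q_i=\exp(\hat\xi_i)e_3$). Put $\mathbf{x}_q=[C^T\xi_1;\dots;C^T\xi_n]\in\mathbb{R}^{2n}$,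 $\mathbf{x}=[\delta x;\mathbf{x}_q]\in\mathbb{R}^{2n+3}$, $z_1=[\mathbf{x};\dot{\mathbf{x}}]\in\mathbb{R}^{4n+6}$. Define $$\mathbf{M}=\begin{bmatrix}M_{00}I_3&\mathbf{M}_{xq}\\\mathbf{M}_{xq}^T&\mathbf{M}_{qq}\end{bmatrix},\quad\mathbf{G}=\begin{bmatrix}0_3&0\\0&\mathbf{G}_{qq}\end{bmatrix},\quad\mathbf{B}=\begin{bmatrix}I_3\\0_{2n\times3}\end{bmatrix},$$ with $\mathbf{M}_{xq}=[-M_{01}\hat e_3C,\dots,-M_{0n}\hat e_3C]$, $\mathbf{M}_{qq}$ the $2n\times2n$ matrix with $(i,j)$ block $M_{ij}I_2$, and $\mathbf{G}_{qq}$ block diagonal with $i$-th block $\sum_{a=i}^nm_agl_iI_2$. **Gains.** $K_x=[k_xI_3,k_{q_1}I_{3\times2},\dots,k_{q_n}I_{3\times2}]$, $K_{\dot x}=[k_{\dot x}I_3,k_{\omega_1}I_{3\times2},\dots,k_{\omega_n}I_{3\times2}]$ and $K_z=[k_zI_3,k_{z_1}I_{3\times2},\dots,k_{z_n}I_{3\times2}]$ in $\mathbb{R}^{3\times(3+2n)}$, where $I_{3\times2}=[e_1,e_2]$. The gains $K_x,K_{\dot x}$ are chosen such that $$\mathbb{A}=\begin{bmatrix}0&I\\-\mathbf{M}^{-1}(\mathbf{G}+\mathbf{B}K_x)&-\mathbf{M}^{-1}\mathbf{B}K_{\dot x}\end{bmatrix}$$ is Hurwitz (the paper takes the linearized system $\mathbf{M}\ddot{\mathbf{x}}+\mathbf{G}\mathbf{x}=\mathbf{B}\delta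 u$ to be controllable so that such gains can be chosen). Let $\mathbb{B}=\begin{bmatrix}0\\\mathbf{M}^{-1}\end{bmatrix}\in\mathbb{R}^{(4n+6)\times(2n+3)}$. For a positive definite $Q\in\mathbb{R}^{(4n+6)\times(4n+6)}$, $P$ is the symmetric positive definite matrix with $\mathbb{A}^TP+P\mathbb{A}=-Q$. The other controller parameters are positive constants $k_R,k_\Omega,k_I,c_2,\sigma$ and the gain $K_z$. **Ideal thrust.** $\mathrm{sat}_\sigma:\mathbb{R}\to[-\sigma,\sigma]$ is $\mathrm{sat}_\sigma(y)=\sigma$ if $y>\sigma$, $y$ if $-\sigma\le y\le\sigma$, $-\sigma$ if $y<-\sigma$, applied elementwise to vectors. Define $$e_{\mathbf{x}}(t)=\int_0^t(P\mathbb{B})^Tz_1(\tau)\,d\tau\in\mathbb{R}^{2n+3},\qquad A=-K_x\mathbf{x}-K_{\dot x}\dot{\mathbf{x}}-K_z\,\mathrm{sat}_\sigma(e_{\mathbf{x}})-M_{00}ge_3\in\mathbb{R}^3.$$ **Attitude command and errors.** $b_{3_c}=-A/\|A\|\in\mathsf{S}^2$; $b_{1_d}\in\mathsf{S}^2$ is a desired direction of the first body-fixed axis, assumed not parallel to $b_{3_c}$; and $$R_c=\Big[-\frac{\hat b_{3_c}^2b_{1_d}}{\|\hat b_{3_c}^2b_{1_d}\|},\ \frac{\hat b_{3_c}b_{1_d}}{\|\hat b_{3_c}b_{1_d}\|},\ b_{3_c}\Big]\in\mathsf{SO(3)},\qquad\Omega_c=(R_c^T\dot R_c)^\vee,$$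 $$e_R=\tfrac12(R_c^TR-R^TR_c)^\vee,\quad e_\Omega=\Omega-R^TR_c\Omega_c,\quad e_I(t)=\int_0^t\big(e_\Omega(\tau)+c_2e_R(\tau)\big)\,d\tau.$$ The tracking errors are $e_R,e_\Omega,\mathbf{x},\dot{\mathbf{x}}$.
   Formalization: With nonzero disturbances and e_I, e_x starting at 0, zero error is no equilibrium, so (i) is proved with both integrals as states starting near values balancing Δ_x, Δ_R. All claims are local: small initial errors, attitude error under 90° (e_R also vanishes at 180°). Gains may depend on Δ_R. *)

(* Defs.v *)
(* MathComp / MathComp-Analysis, over an arbitrary R : realType. *)
From HB Require Import structures.
From mathcomp Require Import all_boot all_order all_algebra.
From mathcomp Require Import all_classical all_reals all_analysis.
From mathcomp Require Import complex.

Set Implicit Arguments.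
Unset Strict Implicit.
Unset Printing Implicit Defensive.
Import Order.TTheory GRing.Theory Num.Theory numFieldNormedType.Exports.
Local Open Scope classical_set_scope.
Local Open Scope ring_scope.

(* Dimension 2n of [C^T xi_1; ...; C^T xi_n], in the form expected by the
   block constructors \mxcol, \mxrow, \mxblock; dimx n is 2n + 3. *)
Notation dimq n := (\sum_(i < n) 2)%N.
Notation dimx n := (3 + dimq n)%N.

(* ---- Linear algebra ---- *)

(* Euclidean norm: the library norm `|v| of a column vector is the sup norm. *)
Definition norm2 (R : realType) k (v : 'cV[R]_k) : R :=
  Num.sqrt (\sum_i v i 0 ^+ 2).

Definition dotv (R : realType) k (u v : 'cV[R]_k) : R := \sum_i u i 0 * v i 0.

Definition vec3 (R : realType) (a b c : R) : 'cV[R]_3 :=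
  \col_i nth 0 [:: a; b; c] i.

Definition e1 (R : realType) : 'cV[R]_3 := vec3 1 0 0.
Definition e2 (R : realType) : 'cV[R]_3 := vec3 0 1 0.
Definition e3 (R : realType) : 'cV[R]_3 := vec3 0 0 1.

Definition cross (R : realType) (u v : 'cV[R]_3) : 'cV[R]_3 :=
  vec3 (u 1 0 * v 2%:R 0 - u 2%:R 0 * v 1 0)
       (u 2%:R 0 * v 0 0 - u 0 0 * v 2%:R 0)
       (u 0 0 * v 1 0 - u 1 0 * v 0 0).

(* The matrix of y |-> x * y. *)
Definition hat (R : realType) (u : 'cV[R]_3) : 'M[R]_3 :=
  \matrix_(i, j) cross u (delta_mx j 0) i 0.

(* Inverse of hat on so(3). *)
Definition vee (R : realType) (S : 'M[R]_3) : 'cV[R]_3 :=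
  vec3 (S 2%:R 1) (S 0 2%:R) (S 1 0).

Definition expmx (R : realType) (A : 'M[R]_3) : 'M[R]_3 :=
  limn (series (fun k => k`!%:R^-1 *: A ^+ k)).

Definition SO3 (R : realType) (A : 'M[R]_3) : Prop :=
  A^T *m A = 1%:M /\ \det A = 1.

Definition posdef (R : realType) k (A : 'M[R]_k) : Prop :=
  A^T = A /\ forall v : 'cV[R]_k, v != 0 -> 0 < (v^T *m A *m v) 0 0.

Definition hurwitz (R : realType) k (A : 'M[R]_k) : Prop :=
  forall l : R[i], eigenvalue (map_mx (real_complex R) A) l ->
    complex.Re l < 0.

(* Both the matrix C and the matrix I_{3x2}. *)
Definition C32 (R : realType) : 'M[R]_(3, 2) := row_mx (e1 R) (e2 R).

Definition sat (R : realType) (sigma y : R) : R :=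
  if sigma < y then sigma else if y < - sigma then - sigma else y.

Definition satv (R : realType) k (sigma : R) (v : 'cV[R]_k) : 'cV[R]_k :=
  map_mx (sat sigma) v.

(* Entrywise integral over [0, t]. *)
Definition vint (R : realType) k (f : R -> 'cV[R]_k) (t : R) : 'cV[R]_k :=
  \col_i \int[lebesgue_measure]_(s in `[0, t]) f s i 0.

(* ---- Quadrotor with an n-link cable ---- *)

(* Links are numbered from 0 to n - 1. *)
Record plant (R : realType) (n : nat) := Plant {
  mass : R;
  inertia : 'M[R]_3;
  lmass : 'I_n -> R;
  llen : 'I_n -> R;
  grav : R }.

Definition plant_ok (R : realType) n (pl : plant R n) : Prop :=
  [/\ 0 < mass pl, posdef (inertia pl), (forall i, 0 < lmass pl i),
      (forall i, 0 < llen pl i) & 0 < grav pl].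

Definition M00 (R : realType) n (pl : plant R n) : R :=
  mass pl + \sum_(i < n) lmass pl i.

Definition M0 (R : realType) n (pl : plant R n) (i : 'I_n) : R :=
  \sum_(a < n | (i <= a)%N) lmass pl a * llen pl i.

Definition Mq (R : realType) n (pl : plant R n) (i j : 'I_n) : R :=
  (\sum_(a < n | (maxn i j <= a)%N) lmass pl a) * llen pl i * llen pl j.

Definition Gq (R : realType) n (pl : plant R n) (i : 'I_n) : R :=
  \sum_(a < n | (i <= a)%N) lmass pl a * grav pl * llen pl i.

(* ---- Linearized equations  Mlin x'' + Glin x = Blin u ---- *)

Definition Mxq (R : realType) n (pl : plant R n) : 'M[R]_(3, dimq n) :=
  \mxrow_(i < n) (- (M0 pl i *: (hat (e3 R) *m C32 R))).

Definition Mlin (R : realType) n (pl : plant R n) : 'M[R]_(dimx n) :=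
  block_mx (M00 pl)%:M (Mxq pl)
           (Mxq pl)^T (\mxblock_(i < n, j < n) ((Mq pl i j)%:M : 'M[R]_2)).

Definition Glin (R : realType) n (pl : plant R n) : 'M[R]_(dimx n) :=
  block_mx 0 0 0 (\mxdiag_(i < n) ((Gq pl i)%:M : 'M[R]_2)).

Definition Blin (R : realType) n : 'M[R]_(dimx n, 3) := col_mx 1%:M 0.

(* Any state can be steered to any other state in finite time. *)
Definition controllable (R : realType) n (pl : plant R n) : Prop :=
  forall x0 v0 x1 v1 : 'cV[R]_(dimx n),
  exists (T : R) (u : R -> 'cV[R]_3) (x : R -> 'cV[R]_(dimx n)),
    [/\ 0 < T, continuous u,
        (forall t, derivable x t 1 /\ derivable (derive1 x) t 1),
        (forall t,
           Mlin pl *m derive1 (derive1 x) t + Glin pl *m x t = Blin R n *m u t)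
      & [/\ x 0 = x0, derive1 x 0 = v0, x T = x1 & derive1 x T = v1] ].

(* ---- Controller parameters and gains ---- *)

Record gains (R : realType) (n : nat) := Gains {
  k_x : R;  k_q : 'I_n -> R;
  k_xdot : R;  k_w : 'I_n -> R;
  k_z : R;  k_zi : 'I_n -> R;
  k_R : R;  k_Om : R;  k_I : R;  c_2 : R;  sigma : R;
  Qmx : 'M[R]_(dimx n + dimx n);
  Pmx : 'M[R]_(dimx n + dimx n) }.

Definition gain_mx (R : realType) n (k : R) (kq : 'I_n -> R) :
    'M[R]_(3, dimx n) :=
  row_mx k%:M (\mxrow_(i < n) (kq i *: C32 R)).

Definition Kx (R : realType) n (gn : gains R n) := gain_mx (k_x gn) (k_q gn).
Definition Kxdot (R : realType) n (gn : gains R n) :=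
  gain_mx (k_xdot gn) (k_w gn).
Definition Kz (R : realType) n (gn : gains R n) := gain_mx (k_z gn) (k_zi gn).

Definition AA (R : realType) n (pl : plant R n) (gn : gains R n) :
    'M[R]_(dimx n + dimx n) :=
  block_mx 0 1%:M
    (- (invmx (Mlin pl) *m (Glin pl + Blin R n *m Kx gn)))
    (- (invmx (Mlin pl) *m Blin R n *m Kxdot gn)).

Definition BB (R : realType) n (pl : plant R n) :
    'M[R]_(dimx n + dimx n, dimx n) :=
  col_mx 0 (invmx (Mlin pl)).

Definition gains_ok (R : realType) n (pl : plant R n) (gn : gains R n) : Prop :=
  [/\ [/\ 0 < k_R gn, 0 < k_Om gn, 0 < k_I gn, 0 < c_2 gn & 0 < sigma gn],
      hurwitz (AA pl gn), posdef (Qmx gn), posdef (Pmx gn)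
    & (AA pl gn)^T *m Pmx gn + Pmx gn *m AA pl gn = - Qmx gn].

(* ---- Trajectories and control law ---- *)

(* The components are functions on all of R, but they are only constrained at
   times t >= 0 (see [closed_loop]); a smooth solution on [0, +oo[ corresponds
   to any of its smooth extensions to negative times. *)
Record trajectory (R : realType) (n : nat) := Trajectory {
  pos : R -> 'cV[R]_3;
  att : R -> 'M[R]_3;
  angvel : R -> 'cV[R]_3;
  link : 'I_n -> R -> 'cV[R]_3;
  linkvel : 'I_n -> R -> 'cV[R]_3;
  xi : 'I_n -> R -> 'cV[R]_3;
  e_I : R -> 'cV[R]_3;
  e_x : R -> 'cV[R]_(dimx n) }.

Definition xx (R : realType) n (xd : 'cV[R]_3) (tr : trajectory R n) (t : R) :
    'cV[R]_(dimx n) :=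
  col_mx (pos tr t - xd) (\mxcol_(i < n) ((C32 R)^T *m xi tr i t)).

Definition z1 (R : realType) n (xd : 'cV[R]_3) (tr : trajectory R n) (t : R) :
    'cV[R]_(dimx n + dimx n) :=
  col_mx (xx xd tr t) (derive1 (xx xd tr) t).

(* The ideal thrust vector A. *)
Definition Athrust (R : realType) n (pl : plant R n) (gn : gains R n)
    (xd : 'cV[R]_3) (tr : trajectory R n) (t : R) : 'cV[R]_3 :=
  - (Kx gn *m xx xd tr t) - Kxdot gn *m derive1 (xx xd tr) t
  - Kz gn *m satv (sigma gn) (e_x tr t) - (M00 pl * grav pl) *: e3 R.

Definition b3c (R : realType) n (pl : plant R n) (gn : gains R n)
    (xd : 'cV[R]_3) (tr : trajectory R n) (t : R) : 'cV[R]_3 :=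
  let A := Athrust pl gn xd tr t in - ((norm2 A)^-1 *: A).

Definition Rc (R : realType) n (pl : plant R n) (gn : gains R n)
    (xd b1d : 'cV[R]_3) (tr : trajectory R n) (t : R) : 'M[R]_3 :=
  let b3 := b3c pl gn xd tr t in
  let h := hat b3 *m b1d in
  let hh := hat b3 *m hat b3 *m b1d in
  row_mx (- ((norm2 hh)^-1 *: hh)) (row_mx ((norm2 h)^-1 *: h) b3).

Definition Omc (R : realType) n (pl : plant R n) (gn : gains R n)
    (xd b1d : 'cV[R]_3) (tr : trajectory R n) (t : R) : 'cV[R]_3 :=
  vee ((Rc pl gn xd b1d tr t)^T *m derive1 (Rc pl gn xd b1d tr) t).

Definition e_R (R : realType) n (pl : plant R n) (gn : gains R n)
    (xd b1d : 'cV[R]_3) (tr : trajectory R n) (t : R) : 'cV[R]_3 :=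
  let Rd := Rc pl gn xd b1d tr t in
  2%:R^-1 *: vee (Rd^T *m att tr t - (att tr t)^T *m Rd).

Definition e_Om (R : realType) n (pl : plant R n) (gn : gains R n)
    (xd b1d : 'cV[R]_3) (tr : trajectory R n) (t : R) : 'cV[R]_3 :=
  angvel tr t -
  (att tr t)^T *m Rc pl gn xd b1d tr t *m Omc pl gn xd b1d tr t.

Definition thrust (R : realType) n (pl : plant R n) (gn : gains R n)
    (xd : 'cV[R]_3) (tr : trajectory R n) (t : R) : R :=
  - dotv (Athrust pl gn xd tr t) (att tr t *m e3 R).

Definition moment (R : realType) n (pl : plant R n) (gn : gains R n)
    (xd b1d : 'cV[R]_3) (tr : trajectory R n) (t : R) : 'cV[R]_3 :=
  let J := inertia pl in
  let Om := angvel tr t in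
  let RtRc := (att tr t)^T *m Rc pl gn xd b1d tr t in
  - (k_R gn *: e_R pl gn xd b1d tr t) - k_Om gn *: e_Om pl gn xd b1d tr t
  - k_I gn *: e_I tr t + cross Om (J *m Om)
  - J *m (hat Om *m RtRc *m Omc pl gn xd b1d tr t
          - RtRc *m derive1 (Omc pl gn xd b1d tr) t).

(* ---- Equations of motion under the control law ---- *)

Definition eq_translation (R : realType) n (pl : plant R n) (gn : gains R n)
    (Dx xd : 'cV[R]_3) (tr : trajectory R n) (t : R) : Prop :=
  M00 pl *: derive1 (derive1 (pos tr)) t
    + \sum_(i < n) M0 pl i *: derive1 (derive1 (link tr i)) t
  = - (thrust pl gn xd tr t *: (att tr t *m e3 R))
    + (M00 pl * grav pl) *: e3 R + Dx.

Definition eq_link (R : realType) n (pl : plant R n)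
    (tr : trajectory R n) (t : R) (i : 'I_n) : Prop :=
  let hq2 := hat (link tr i t) *m hat (link tr i t) in
  Mq pl i i *: derive1 (derive1 (link tr i)) t
    - hq2 *m (M0 pl i *: derive1 (derive1 (pos tr)) t
              + \sum_(j < n | j != i)
                  Mq pl i j *: derive1 (derive1 (link tr j)) t)
  = - ((Mq pl i i * norm2 (derive1 (link tr i) t) ^+ 2) *: link tr i t)
    - Gq pl i *: (hq2 *m e3 R).

Definition eq_attitude (R : realType) n (pl : plant R n) (gn : gains R n)
    (DR xd b1d : 'cV[R]_3) (tr : trajectory R n) (t : R) : Prop :=
  inertia pl *m derive1 (angvel tr) t
    + hat (angvel tr t) *m inertia pl *m angvel tr t
  = moment pl gn xd b1d tr t + DR.

Definition link_coord (R : realType) n (tr : trajectory R n) (t : R)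
    (i : 'I_n) : Prop :=
  dotv (xi tr i t) (e3 R) = 0 /\
  link tr i t = expmx (hat (xi tr i t)) *m e3 R.

(* Enough differentiability for every derivative occurring in the equations
   and in the control law to be a genuine one. *)
Definition regular (R : realType) n (pl : plant R n) (gn : gains R n)
    (xd b1d : 'cV[R]_3) (tr : trajectory R n) (t : R) : Prop :=
  [/\ derivable (pos tr) t 1 /\ derivable (derive1 (pos tr)) t 1,
      (forall i, derivable (link tr i) t 1 /\
                 derivable (derive1 (link tr i)) t 1),
      (forall i, derivable (xi tr i) t 1 /\ derivable (derive1 (xi tr i)) t 1),
      derivable (att tr) t 1 /\ derivable (angvel tr) t 1
    & derivable (Rc pl gn xd b1d tr) t 1 /\
      derivable (Omc pl gn xd b1d tr) t 1].

(* [tr] is a solution on [0, +oo[ of the controlled system whose integral terms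
   start from the values eI0 and ex0; the control law proper has
   eI0 = 0 and ex0 = 0. The two conditions with != state that b_{3_c} is well defined
   and is not parallel to b_{1_d}. *)
Definition closed_loop (R : realType) n (pl : plant R n) (gn : gains R n)
    (Dx DR xd b1d eI0 : 'cV[R]_3) (ex0 : 'cV[R]_(dimx n))
    (tr : trajectory R n) : Prop :=
  forall t, 0 <= t ->
  [/\ [/\ regular pl gn xd b1d tr t,
          Athrust pl gn xd tr t != 0 & cross (b3c pl gn xd tr t) b1d != 0],
      [/\ SO3 (att tr t),
          (forall i, norm2 (link tr i t) = 1),
          (forall i, dotv (linkvel tr i t) (link tr i t) = 0)
        & (forall i, link_coord tr t i)],
      [/\ eq_translation pl gn Dx xd tr t,
          (forall i, eq_link pl tr t i)
        & eq_attitude pl gn DR xd b1d tr t],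
      derive1 (att tr) t = att tr t *m hat (angvel tr t) /\
      (forall i, derive1 (link tr i) t = cross (linkvel tr i t) (link tr i t))
    & e_I tr t = eI0 + vint (fun s => e_Om pl gn xd b1d tr s
                                      + c_2 gn *: e_R pl gn xd b1d tr s) t /\
      e_x tr t = ex0 + vint (fun s => (Pmx gn *m BB pl)^T *m z1 xd tr s) t].

Definition tracking_error (R : realType) n (pl : plant R n) (gn : gains R n)
    (xd b1d : 'cV[R]_3) (tr : trajectory R n) (t : R) :
    'cV[R]_((3 + 3) + (dimx n + dimx n)) :=
  col_mx (col_mx (e_R pl gn xd b1d tr t) (e_Om pl gn xd b1d tr t))
         (z1 xd tr t).

(* Initial tracking errors of size less than eta. The vector e_R also vanishes
   when att differs from Rc by a half turn, so smallness of e_R means that att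
   is close to Rc only within a rotation angle less than pi/2, that is when
   tr (I - Rc^T att) / 2 < 1. *)
Definition starts_near (R : realType) n (pl : plant R n) (gn : gains R n)
    (xd b1d : 'cV[R]_3) (eta : R) (tr : trajectory R n) : Prop :=
  2%:R^-1 * \tr (1%:M - (Rc pl gn xd b1d tr 0)^T *m att tr 0) < 1 /\
  norm2 (tracking_error pl gn xd b1d tr 0) < eta.

(* Lyapunov stability of the zero tracking error. The state of the closed loop
   comprises the integral terms; on the zero-error equilibrium they compensate
   the disturbances: k_I e_I = DR and Kz sat (e_x) = Dx. Stability is that of
   every such equilibrium, with respect to perturbations of the whole initial
   state, and at least one such equilibrium exists. *)
Definition lyapunov_stable (R : realType) n (pl : plant R n) (gn : gains R n)
    (Dx DR xd b1d : 'cV[R]_3) : Prop :=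
  (exists ex_eq, Kz gn *m satv (sigma gn) ex_eq = Dx) /\
  forall ex_eq, Kz gn *m satv (sigma gn) ex_eq = Dx ->
  forall eps, 0 < eps -> exists2 eta, 0 < eta &
    forall eI0 ex0 tr, closed_loop pl gn Dx DR xd b1d eI0 ex0 tr ->
    norm2 (eI0 - (k_I gn)^-1 *: DR) < eta -> norm2 (ex0 - ex_eq) < eta ->
    starts_near pl gn xd b1d eta tr ->
    forall t, 0 <= t -> norm2 (tracking_error pl gn xd b1d tr t) < eps.

(* Main.v *)
Require Import Defs.
From HB Require Import structures.
From mathcomp Require Import all_boot all_order all_algebra.
From mathcomp Require Import all_classical all_reals all_analysis.
From mathcomp Require Import complex ring lra.
Set Implicit Arguments.
Unset Strict Implicit.
Unset Printing Implicit Defensive.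
Import Order.TTheory GRing.Theory Num.Theory numFieldNormedType.Exports.
Local Open Scope classical_set_scope.
Local Open Scope ring_scope.

(** The gains are chosen so that a Lyapunov function of the full nonlinear closed
    loop decays exponentially on a region that trajectories cannot leave.

    Position. All gains on the links are 0, and K_x, K_xdot act as a unit PD
    feedback on the quadrotor. This damps the whole linearized chain: as long as
    the quadrotor does not move, the first link exerts no horizontal force, so it
    hangs still, and so on down the chain. Lemma chain_dominated is a quantitative
    form of this argument, and strict_energy turns it into a strict quadratic
    Lyapunov function, the energy plus a small cross term; linear_design reads off
    P and Q. The velocity block of P is exactly the mass matrix, and this matters:
    the quantity (P BB)^T z1 that e_x integrates then has the component
    v + topv (W s) along the quadrotor, which is also the factor with which an
    external force on the quadrotor enters the derivative of mech_fun, the same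
    Lyapunov function written with the exact energy and momentum of the nonlinear
    chain (mech_rate_upper). Let e be the deviation of the quadrotor component of
    e_x from Dx / kz. Disturbance and integral action amount to the force - kz e,
    whose work is cancelled exactly by the derivative of kz |e|^2, for every kz.
    A small multiple of base_mom.e makes e dissipate as well (position_design).
    What is left are cubic terms and the thrust that the attitude error misdirects.

    Attitude. The error rotation Rc^T R, the error e_Om and the deviation of e_I
    from DR / kI obey a closed system of equations that does not involve the cable.
    A Lyapunov function decays along it as long as the rotation angle stays below a
    right angle (attitude_design, attitude_decay). The square of the misdirected
    thrust is at most 4 |A|^2 rot_err (thrust_err_sqr), so that a multiple of the
    attitude function pays for it where A is bounded (cascade_rate).

    Region. The position estimates need small errors and an unsaturated integral
    term. Both hold in a region in which the sum of the two Lyapunov functions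
    decays, and a small value of the sum confines the errors to the interior of the
    region, so that it is never left (barrier, position_decay). If the integral
    terms start at 0, their deviations start at - Dx / kz and - DR / kI, which
    contribute |Dx|^2 / kz and |DR|^2 / kI. Since the constants are uniform in kz
    and in kI, large gains make these contributions as small as the region requires
    (closed_loop_decay). Exponential decay of the sum gives stability, convergence
    and, by integration, bounded integral terms. *)

(** * Dot products, Euclidean norms and definite matrices *)

Lemma amgm (R : realFieldType) (a b : R) : 2 * (a * b) <= a ^+ 2 + b ^+ 2.
Proof. by have := sqr_ge0 (a - b); rewrite sqrrB; lra. Qed.

Lemma amgm4 (R : realFieldType) (a b : R) : a * b <= 4^-1 * a ^+ 2 + b ^+ 2.
Proof. by have := sqr_ge0 (2^-1 * a - b); rewrite sqrrB exprMn; lra. Qed.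

Section Dot.
Context {R : realType}.
Implicit Types k l : nat.

Lemma dotvE k (u v : 'cV[R]_k) : dotv u v = (u^T *m v) 0 0.
Proof. by rewrite mxE; apply: eq_bigr => i _; rewrite mxE. Qed.

Lemma dotvC k (u v : 'cV[R]_k) : dotv u v = dotv v u.
Proof. by apply: eq_bigr => i _; rewrite mulrC. Qed.

Lemma dotvDr k (u v w : 'cV[R]_k) : dotv u (v + w) = dotv u v + dotv u w.
Proof. by rewrite !dotvE mulmxDr mxE. Qed.

Lemma dotvZr k a (u v : 'cV[R]_k) : dotv u (a *: v) = a * dotv u v.
Proof. by rewrite !dotvE -scalemxAr mxE. Qed.

Lemma dotvNr k (u v : 'cV[R]_k) : dotv u (- v) = - dotv u v.
Proof. by rewrite -scaleN1r dotvZr mulN1r. Qed.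

Lemma dotvBr k (u v w : 'cV[R]_k) : dotv u (v - w) = dotv u v - dotv u w.
Proof. by rewrite dotvDr dotvNr. Qed.

Lemma dotvDl k (u v w : 'cV[R]_k) : dotv (v + w) u = dotv v u + dotv w u.
Proof. by rewrite dotvC dotvDr ![dotv u _]dotvC. Qed.

Lemma dotvZl k a (u v : 'cV[R]_k) : dotv (a *: u) v = a * dotv u v.
Proof. by rewrite dotvC dotvZr dotvC. Qed.

Lemma dotvNl k (u v : 'cV[R]_k) : dotv (- u) v = - dotv u v.
Proof. by rewrite dotvC dotvNr dotvC. Qed.

Lemma dotvBl k (u v w : 'cV[R]_k) : dotv (v - w) u = dotv v u - dotv w u.
Proof. by rewrite dotvDl dotvNl. Qed.

Lemma dotv0r k (u : 'cV[R]_k) : dotv u 0 = 0.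
Proof. by rewrite -[0](scale0r 0) dotvZr mul0r. Qed.

Lemma dotv0l k (u : 'cV[R]_k) : dotv 0 u = 0.
Proof. by rewrite dotvC dotv0r. Qed.

Lemma dotv_sumr k (I : Type) (s : seq I) (P : pred I) (u : 'cV[R]_k)
    (F : I -> 'cV[R]_k) :
  dotv u (\sum_(i <- s | P i) F i) = \sum_(i <- s | P i) dotv u (F i).
Proof.
elim/big_rec2: _ => [|i y1 y2 _ <-]; first exact: dotv0r.
exact: dotvDr.
Qed.

Lemma dotv_suml k (I : Type) (s : seq I) (P : pred I) (u : 'cV[R]_k)
    (F : I -> 'cV[R]_k) :
  dotv (\sum_(i <- s | P i) F i) u = \sum_(i <- s | P i) dotv (F i) u.
Proof. by rewrite dotvC dotv_sumr; apply: eq_bigr => i _; exact: dotvC. Qed.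

Lemma dotv_mulmx k l (A : 'M[R]_(k, l)) (u : 'cV[R]_k) (v : 'cV[R]_l) :
  dotv u (A *m v) = dotv (A^T *m u) v.
Proof. by rewrite !dotvE trmx_mul trmxK mulmxA. Qed.

Lemma dotv_col_mx k l (a c : 'cV[R]_k) (b d : 'cV[R]_l) :
  dotv (col_mx a b) (col_mx c d) = dotv a c + dotv b d.
Proof. by rewrite !dotvE tr_col_mx mul_row_col mxE. Qed.

Lemma dotv_mxcol m (p : 'I_m -> nat) (f g : forall i, 'cV[R]_(p i)) :
  dotv (\mxcol_i f i) (\mxcol_i g i) = \sum_i dotv (f i) (g i).
Proof.
rewrite dotvE tr_mxcol mul_mxrow_mxcol summxE.
by apply: eq_bigr => i _; rewrite dotvE.
Qed.

Lemma dotvv_ge0 k (u : 'cV[R]_k) : 0 <= dotv u u.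
Proof. by apply: sumr_ge0 => i _; rewrite -expr2 sqr_ge0. Qed.

Lemma entry_le_dotvv k (u : 'cV[R]_k) i : u i 0 ^+ 2 <= dotv u u.
Proof.
rewrite /dotv (bigD1 i) //= -expr2 lerDl.
by apply: sumr_ge0 => j _; rewrite -expr2 sqr_ge0.
Qed.

Lemma dotvv_eq0 k (u : 'cV[R]_k) : (dotv u u == 0) = (u == 0).
Proof.
apply/idP/eqP => [/eqP u0|->]; last by rewrite dotv0r.
apply/matrixP => i j; rewrite ord1 mxE; apply/eqP; rewrite -sqrf_eq0 eq_le.
by rewrite sqr_ge0 andbT -u0 entry_le_dotvv.
Qed.

Lemma norm2E k (u : 'cV[R]_k) : norm2 u = Num.sqrt (dotv u u).
Proof. by rewrite /norm2; congr Num.sqrt; apply: eq_bigr => i _; rewrite expr2. Qed.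

Lemma norm2_ge0 k (u : 'cV[R]_k) : 0 <= norm2 u.
Proof. exact: sqrtr_ge0. Qed.

Lemma norm2_sqr k (u : 'cV[R]_k) : norm2 u ^+ 2 = dotv u u.
Proof. by rewrite norm2E sqr_sqrtr // dotvv_ge0. Qed.

Lemma norm2_eq0 k (u : 'cV[R]_k) : (norm2 u == 0) = (u == 0).
Proof. by rewrite -sqrf_eq0 norm2_sqr dotvv_eq0. Qed.

Lemma norm2_0 k : norm2 (0 : 'cV[R]_k) = 0.
Proof. by apply/eqP; rewrite norm2_eq0. Qed.

Lemma norm2_le_sqr k (u : 'cV[R]_k) a : 0 <= a ->
  (norm2 u <= a) = (dotv u u <= a ^+ 2).
Proof.
by move=> a0; rewrite -norm2_sqr ler_pXn2r // nnegrE ?norm2_ge0.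
Qed.

Lemma dotv_young k (u v : 'cV[R]_k) e : 0 < e ->
  2 * dotv u v <= e * dotv u u + e^-1 * dotv v v.
Proof.
move=> e0; have := dotvv_ge0 (e *: u - v).
rewrite dotvBl !dotvBr !dotvZl !dotvZr (dotvC v u) => h.
rewrite -(ler_pM2l e0) mulrDr [e * (_^-1 * _)]mulrA divff ?gt_eqF // mul1r.
by rewrite -subr_ge0; move: h; congr (0 <= _); ring.
Qed.

(** The quadratic form is semidefinite along the line through u and v, so its
    discriminant is nonpositive; the form need not be an inner product. *)
Lemma psd_cauchy_schwarz k (A : 'M[R]_k) (u v : 'cV[R]_k) :
  A^T = A -> (forall w, 0 <= dotv w (A *m w)) ->
  dotv u (A *m v) ^+ 2 <= dotv u (A *m u) * dotv v (A *m v).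
Proof.
move=> sA pA; set a := dotv u (A *m u); set b := dotv u (A *m v).
set c := dotv v (A *m v).
have q s t : 0 <= s ^+ 2 * a + 2 * s * t * b + t ^+ 2 * c.
  have := pA (s *: u + t *: v); rewrite mulmxDr -!scalemxAr.
  rewrite dotvDl !dotvDr !dotvZl !dotvZr -/a -/b -/c.
  have -> : dotv v (A *m u) = b by rewrite dotv_mulmx sA dotvC.
  by congr (0 <= _); ring.
have a0 : 0 <= a := pA u; have c0 : 0 <= c := pA v.
have [c00|cn0] := eqVneq c 0; last first.
  have cp : 0 < c by rewrite lt_def cn0.
  have h := q c (- b).
  rewrite -subr_ge0 -(pmulr_rge0 _ cp); move: h.
  by congr (0 <= _); ring.
rewrite c00 mulr0; have [->|bn0] := eqVneq b 0; first by rewrite expr0n.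
have := q 1 (- ((a + 1) / b)); rewrite c00.
have -> : 2 * 1 * - ((a + 1) / b) * b = - 2 * (a + 1) by field.
by rewrite expr1n mulr0; lra.
Qed.

Lemma dotv_cauchy_schwarz k (u v : 'cV[R]_k) :
  dotv u v ^+ 2 <= dotv u u * dotv v v.
Proof.
have /= := @psd_cauchy_schwarz k 1%:M u v (trmx1 _ _).
by rewrite !mul1mx; apply => w; rewrite mul1mx dotvv_ge0.
Qed.

Lemma abs_dotv_le k (u v : 'cV[R]_k) : `|dotv u v| <= norm2 u * norm2 v.
Proof.
rewrite -ler_sqr ?nnegrE ?mulr_ge0 ?norm2_ge0 //.
by rewrite real_normK ?num_real // exprMn !norm2_sqr dotv_cauchy_schwarz.
Qed.

Lemma norm2D k (u v : 'cV[R]_k) : norm2 (u + v) <= norm2 u + norm2 v.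
Proof.
rewrite norm2_le_sqr ?addr_ge0 ?norm2_ge0 // dotvDl !dotvDr (dotvC v u).
have h := le_trans (ler_norm _) (abs_dotv_le u v).
by rewrite sqrrD !norm2_sqr; lra.
Qed.

Lemma norm2Z k a (u : 'cV[R]_k) : norm2 (a *: u) = `|a| * norm2 u.
Proof.
apply/eqP; rewrite -(eqrXn2 (ltn0Sn 1)) ?mulr_ge0 ?norm2_ge0 //.
by rewrite exprMn !norm2_sqr dotvZl dotvZr real_normK ?num_real // expr2 mulrA.
Qed.

Lemma norm2N k (u : 'cV[R]_k) : norm2 (- u) = norm2 u.
Proof. by rewrite -scaleN1r norm2Z normrN1 mul1r. Qed.

Lemma norm2B k (u v : 'cV[R]_k) : norm2 (u - v) <= norm2 u + norm2 v.
Proof. by rewrite -(norm2N v) norm2D. Qed.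

Lemma norm2_sum k (I : Type) (s : seq I) (P : pred I) (F : I -> 'cV[R]_k) :
  norm2 (\sum_(i <- s | P i) F i) <= \sum_(i <- s | P i) norm2 (F i).
Proof.
elim/big_ind2: _ => [|a b c d h1 h2|//]; first by rewrite norm2_0.
by apply: le_trans (norm2D _ _) _; rewrite lerD.
Qed.

Lemma entry_le_norm2 k (u : 'cV[R]_k) i : `|u i 0| <= norm2 u.
Proof.
rewrite -ler_sqr ?nnegrE ?norm2_ge0 // norm2_sqr real_normK ?num_real //.
exact: entry_le_dotvv.
Qed.

Lemma norm2_le_sum k (u : 'cV[R]_k) : norm2 u <= \sum_i `|u i 0|.
Proof.
have -> : norm2 u = norm2 (\sum_i u i 0 *: delta_mx i 0 : 'cV[R]_k).
  congr norm2; apply/matrixP => i j; rewrite ord1 summxE (bigD1 i) //= big1.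
    by rewrite !mxE !eqxx mulr1 addr0.
  by move=> l li; rewrite !mxE eq_sym (negbTE li) mulr0.
apply: le_trans (norm2_sum _ _ _) _; apply: ler_sum => i _.
rewrite norm2Z ler_piMr // norm2_le_sqr // expr1n /dotv (bigD1 i) //= big1.
  by rewrite !mxE !eqxx mulr1 addr0.
by move=> l li; rewrite !mxE (negbTE li) mul0r.
Qed.

Lemma mulmx_norm2_bounded k l (A : 'M[R]_(k, l)) :
  exists2 C, 0 <= C & forall v : 'cV[R]_l, norm2 (A *m v) <= C * norm2 v.
Proof.
exists (\sum_i norm2 (row i A)^T).
  by apply: sumr_ge0 => i _; exact: norm2_ge0.
move=> v; apply: le_trans (norm2_le_sum _) _; rewrite mulr_suml.
apply: ler_sum => i _; apply: le_trans _ (abs_dotv_le _ _).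
rewrite le_eqVlt; apply/orP; left; apply/eqP; congr `|_|.
by rewrite mxE; apply: eq_bigr => j _; rewrite !mxE.
Qed.

Lemma mulmx_dotvv_bounded k l (A : 'M[R]_(k, l)) :
  exists2 C, 0 <= C & forall v : 'cV[R]_l, dotv (A *m v) (A *m v) <= C * dotv v v.
Proof.
have [C C0 h] := mulmx_norm2_bounded A; exists (C ^+ 2); first exact: sqr_ge0.
by move=> v; rewrite -!norm2_sqr -exprMn ler_sqr ?nnegrE ?mulr_ge0 ?norm2_ge0.
Qed.

Lemma norm2_col_mx_l k l (a : 'cV[R]_k) (b : 'cV[R]_l) :
  norm2 a <= norm2 (col_mx a b).
Proof.
by rewrite norm2_le_sqr ?norm2_ge0 // norm2_sqr dotv_col_mx lerDl dotvv_ge0.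
Qed.

Lemma norm2_col_mx_r k l (a : 'cV[R]_k) (b : 'cV[R]_l) :
  norm2 b <= norm2 (col_mx a b).
Proof.
by rewrite norm2_le_sqr ?norm2_ge0 // norm2_sqr dotv_col_mx lerDr dotvv_ge0.
Qed.

Lemma posdefE k (A : 'M[R]_k) :
  posdef A <-> A^T = A /\ forall v : 'cV[R]_k, v != 0 -> 0 < dotv v (A *m v).
Proof.
by rewrite /posdef; split=> -[sA h]; split=> // v /h; rewrite dotvE mulmxA.
Qed.

Lemma posdef_unitmx k (A : 'M[R]_k) : posdef A -> A \in unitmx.
Proof.
move=> /posdefE[sA pA]; rewrite -row_free_unit -kermx_eq0.
apply/eqP/row_matrixP => i; rewrite row0; set v := row i _.
apply/eqP; apply: contraT => vn0.
have : v *m A = 0 by rewrite /v -row_mul mulmx_ker row0.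
move/(congr1 trmx); rewrite trmx_mul sA trmx0 => Av0.
have := pA v^T; rewrite Av0 dotv0r ltxx => -> //.
by rewrite -trmx0 (inj_eq trmx_inj).
Qed.

(** By Cauchy-Schwarz for the form of A, an entry of v, being the value of the
    form of A at (A^-1 e_i, v), is controlled by the form at v. *)
Lemma posdef_coercive k (A : 'M[R]_k) : posdef A ->
  exists2 c, 0 < c & forall v : 'cV[R]_k, c * dotv v v <= dotv v (A *m v).
Proof.
move=> pA; have uA := posdef_unitmx pA; have /posdefE[sA qA] := pA.
have q0 w : 0 <= dotv w (A *m w).
  by have [->|/qA/ltW//] := eqVneq w 0; rewrite mulmx0 dotv0r.
pose b i : 'cV[R]_k := invmx A *m delta_mx i 0.
pose C := 1 + \sum_i dotv (b i) (A *m b i).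
have C0 : 0 < C by rewrite ltr_wpDr // sumr_ge0.
exists C^-1; first by rewrite invr_gt0.
move=> v; rewrite mulrC ler_pdivrMr // mulrDr mulr1.
apply: (@le_trans _ _ (\sum_i dotv v (A *m v) * dotv (b i) (A *m b i))); last first.
  by rewrite -mulr_sumr lerDr.
apply: ler_sum => i _; rewrite -expr2 mulrC.
apply: le_trans _ (psd_cauchy_schwarz _ _ sA q0).
rewrite dotv_mulmx sA /b mulKVmx // /dotv (bigD1 i) //= big1.
  by rewrite mxE !eqxx mul1r addr0.
by move=> l li; rewrite mxE (negbTE li) mul0r.
Qed.

End Dot.

(** * Strict Lyapunov functions of damped linear systems *)

Section Strictify.
Context {R : realType} (d p : nat) (M Kp : 'M[R]_d) (B : 'M[R]_(d, p)).

Let K := invmx M *m Kp.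
Let L := invmx M *m B *m B^T.

(** Along s' = v, M v' = - Kp s - B B^T v, this is c times |B^T v|^2 minus twice
    the derivative of v.(N s): the dissipation rate that a Lyapunov function gains
    from the damping and from the cross term N. *)
Definition dissip c (N : 'M[R]_d) (s v : 'cV[R]_d) : R :=
  c * dotv (B^T *m v) (B^T *m v) - 2 * dotv v (N *m v)
  + 2 * dotv (K *m s + L *m v) (N *m s).

(** A quantitative form of: phi vanishes along the motions on which B^T v
    vanishes. Unlike that statement it yields a strict Lyapunov function directly,
    and it propagates from one linear function of the state to the next. *)
Definition dominated (phi : 'cV[R]_d -> 'cV[R]_d -> R) : Prop :=
  forall eta, 0 < eta -> exists c N, forall s v,
    phi s v <= dissip c N s v + eta * (dotv s s + dotv v v).

Lemma dissipD c c' N N' s v :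
  dissip (c + c') (N + N') s v = dissip c N s v + dissip c' N' s v.
Proof. by rewrite /dissip !mulmxDl !dotvDr; ring. Qed.

Lemma dissipZ a c N s v : dissip (a * c) (a *: N) s v = a * dissip c N s v.
Proof. by rewrite /dissip -!scalemxAl !dotvZr; ring. Qed.

Lemma dominated_le C phi psi : 0 < C -> dominated psi ->
  (forall s v, phi s v <= C * psi s v) -> dominated phi.
Proof.
move=> C0 h le eta eta0; have [|c [N hN]] := h (eta / C); first exact: divr_gt0.
exists (C * c), (C *: N) => s v; apply: le_trans (le s v) _.
have := ler_wpM2l (ltW C0) (hN s v); rewrite dissipZ mulrDr.
by rewrite [C * (_ / _ * _)]mulrA [C * (_ / _)]mulrC divfK ?gt_eqF.
Qed.

Lemma dominatedD phi psi : dominated phi -> dominated psi ->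
  dominated (fun s v => phi s v + psi s v).
Proof.
move=> h1 h2 eta eta0; have e2 : 0 < eta / 2 by rewrite divr_gt0.
have [c [N hN]] := h1 _ e2; have [c' [N' hN']] := h2 _ e2.
exists (c + c'), (N + N') => s v; rewrite dissipD.
by have := lerD (hN s v) (hN' s v); lra.
Qed.

(** The admissible error may shrink with eta although psi enters with a constant
    that depends on it: psi is dominated for every positive error. *)
Lemma dominated_step phi psi c0 N0 : dominated psi ->
  (forall e, 0 < e -> exists2 C, 0 < C & forall s v, phi s v <=
     dissip c0 N0 s v + C * psi s v + e * (dotv s s + dotv v v)) ->
  dominated phi.
Proof.
move=> hpsi hs eta eta0; have e2 : 0 < eta / 2 by rewrite divr_gt0.
have [C C0 hC] := hs _ e2.
have : dominated (fun s v => C * psi s v) by exact: (dominated_le C0 hpsi).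
move=> /(_ _ e2)[c [N hN]]; exists (c0 + c), (N0 + N) => s v; rewrite dissipD.
by have := hC s v; have := hN s v; lra.
Qed.

(** A bilinear term, one factor of which is already dominated, is harmless: the
    other factor only costs an arbitrarily small part of the energy. *)
Lemma bilinear_absorb k (A : 'M[R]_(k, d)) (e : R) : 0 < e ->
  exists2 C, 0 < C & forall (a : 'cV[R]_k) (w : 'cV[R]_d),
    2 * dotv a (A *m w) <= C * dotv a a + e * dotv w w.
Proof.
move=> e0; have [c c0 hc] := mulmx_dotvv_bounded A.
have cp : 0 < c + 1 by rewrite ltr_wpDl.
exists ((c + 1) / e); first by rewrite divr_gt0.
move=> a w; apply: le_trans (dotv_young _ _ (divr_gt0 cp e0)) _.
rewrite lerD2l invf_div -(ler_pM2l (divr_gt0 cp e0)) mulrA.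
have -> : (c + 1) / e * (e / (c + 1)) = 1 by field; rewrite !gt_eqF.
have -> : (c + 1) / e * (e * dotv w w) = (c + 1) * dotv w w.
  by field; rewrite gt_eqF.
by rewrite mul1r; have := hc w; have := dotvv_ge0 w; lra.
Qed.

Definition dominatedv k (f : 'cV[R]_d -> 'cV[R]_d -> 'cV[R]_k) :=
  dominated (fun s v => dotv (f s v) (f s v)).

Lemma dominatedv_eq k (f g : 'cV[R]_d -> 'cV[R]_d -> 'cV[R]_k) :
  (forall s v, f s v = g s v) -> dominatedv f -> dominatedv g.
Proof.
by move=> fg; congr dominatedv; apply/funext => s; apply/funext => v.
Qed.

Lemma dominatedvD k (f g : 'cV[R]_d -> 'cV[R]_d -> 'cV[R]_k) :
  dominatedv f -> dominatedv g -> dominatedv (fun s v => f s v + g s v).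
Proof.
move=> hf hg; apply: (dominated_le (ltr0Sn _ 1) (dominatedD hf hg)) => s v.
have := dotvv_ge0 (f s v - g s v).
by rewrite dotvBl !dotvBr dotvDl !dotvDr (dotvC (g s v)); lra.
Qed.

Lemma dominatedv_mulmx k l (A : 'M[R]_(k, l))
    (f : 'cV[R]_d -> 'cV[R]_d -> 'cV[R]_l) :
  dominatedv f -> dominatedv (fun s v => A *m f s v).
Proof.
have [C C0 hC] := mulmx_dotvv_bounded A => hf.
apply: (dominated_le (ltr_wpDl C0 ltr01) hf) => s v.
by apply: le_trans (hC _) _; rewrite ler_wpM2r ?dotvv_ge0 // lerDl.
Qed.

Lemma dominatedvZ k a (f : 'cV[R]_d -> 'cV[R]_d -> 'cV[R]_k) :
  dominatedv f -> dominatedv (fun s v => a *: f s v).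
Proof.
move=> /(dominatedv_mulmx a%:M); apply: dominatedv_eq => s v.
by rewrite mul_scalar_mx.
Qed.

Lemma dominatedv0 k : dominatedv (fun _ _ => 0 : 'cV[R]_k).
Proof.
move=> eta eta0; exists 0, 0 => s v.
rewrite /dissip !mul0mx !dotv0r mul0r mulr0 subr0 !add0r.
by rewrite mulr_ge0 ?addr_ge0 ?dotvv_ge0 // ltW.
Qed.

Lemma dominatedv_sum k (I : Type) (r : seq I) (P : pred I)
    (f : I -> 'cV[R]_d -> 'cV[R]_d -> 'cV[R]_k) :
  (forall i, P i -> dominatedv (f i)) ->
  dominatedv (fun s v => \sum_(i <- r | P i) f i s v).
Proof.
move=> h; elim: r => [|i r IH].
  by apply: (dominatedv_eq _ (@dominatedv0 k)) => s v; rewrite big_nil.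
apply: (@dominatedv_eq _ (fun s v =>
    (if P i then f i s v else 0) + \sum_(j <- r | P j) f j s v)).
  by move=> s v; rewrite big_cons; case: ifP => // _; rewrite add0r.
apply: dominatedvD IH; have := h i; case: (P i) => [hi|_]; last exact: dominatedv0.
exact: hi.
Qed.

Lemma dominated_input : dominatedv (fun s v => B^T *m v).
Proof.
move=> eta eta0; exists 1, 0 => s v.
rewrite /dissip !mul0mx !dotv0r mul1r mulr0 subr0 addr0 lerDl.
by rewrite mulr_ge0 ?addr_ge0 ?dotvv_ge0 // ltW.
Qed.

(** The derivative of (U s).(U v) along s' = v is |U v|^2, up to a product
    with the factor U s. *)
Lemma dominated_velocity k (U : 'M[R]_(k, d)) :
  dominatedv (fun s v => U *m s) -> dominatedv (fun s v => U *m v).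
Proof.
(* minus twice the derivative of v.(N0 s) is |U v|^2 + (U v').(U s) *)
move=> h; pose N0 := - (2^-1 *: (U^T *m U)).
apply: (@dominated_step _ _ 0 N0 h) => e e0.
have e2 : 0 < e / 2 by rewrite divr_gt0.
have [C1 C10 h1] := bilinear_absorb (U *m K) e2.
have [C2 C20 h2] := bilinear_absorb (U *m L) e2.
exists (C1 + C2); first exact: addr_gt0.
move=> s v; rewrite /dissip mul0r sub0r /N0.
have E w z : dotv w (- (2^-1 *: (U^T *m U)) *m z)
             = - (2^-1 * dotv (U *m w) (U *m z)).
  rewrite mulNmx dotvNr -scalemxAl dotvZr -mulmxA; congr (- (_ * _)).
  by rewrite [LHS]dotv_mulmx trmxK.
rewrite !E mulmxDr (mulmxA U K) (mulmxA U L) dotvDl.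
rewrite ![dotv _ (U *m s)]dotvC.
have := h1 (U *m s) s; have := h2 (U *m s) v.
have := mulr_ge0 (ltW (addr_gt0 C10 C20)) (dotvv_ge0 (U *m s)).
have := mulr_ge0 (ltW e2) (dotvv_ge0 s).
have := mulr_ge0 (ltW e2) (dotvv_ge0 v); lra.
Qed.

(** The derivative of - (U K s).(U v), where v' = - K s up to the dominated
    input B^T v, is |U K s|^2, up to products with U v and with B^T v. *)
Lemma dominated_position k (U : 'M[R]_(k, d)) :
  dominatedv (fun s v => U *m v) -> dominatedv (fun s v => U *m K *m s).
Proof.
move=> h; have h' := dominatedD h dominated_input.
pose N0 := 2^-1 *: (U^T *m U *m K).
apply: (@dominated_step _ _ 0 N0 h') => e e0.
have [C1 C10 h1] := bilinear_absorb (U *m K) e0.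
have [C2 C20 h2] := bilinear_absorb
  (- ((U *m invmx M *m B)^T *m (U *m K))) e0.
exists (C1 + C2); first exact: addr_gt0.
move=> s v; rewrite /dissip mul0r sub0r /N0.
have E w z : dotv w ((2^-1 *: (U^T *m U *m K)) *m z)
             = 2^-1 * dotv (U *m w) (U *m K *m z).
  by rewrite -scalemxAl dotvZr -!mulmxA [in LHS]dotv_mulmx trmxK !mulmxA.
rewrite !E mulmxDr (mulmxA U K) (mulmxA U L) dotvDl.
have := h1 (U *m v) v; have := h2 (B^T *m v) s.
have -> : dotv (B^T *m v) (- ((U *m invmx M *m B)^T *m (U *m K)) *m s)
          = - dotv (U *m L *m v) (U *m K *m s).
  rewrite mulNmx dotvNr; congr (- _); rewrite -(mulmxA _^T) [LHS]dotv_mulmx trmxK.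
  by rewrite /L !mulmxA.
have := dotvv_ge0 (B^T *m v); have := dotvv_ge0 (U *m v).
have := dotvv_ge0 s; have := dotvv_ge0 v.
set x := dotv (U *m L *m v) _; set y := dotv (U *m v) _.
set a := dotv (U *m v) (U *m v); set b := dotv (B^T *m v) _.
set f := dotv (U *m K *m s) _.
move=> v0 s0 a0 b0 i2 i1.
have := mulr_ge0 (ltW C10) b0; have := mulr_ge0 (ltW C20) a0.
have := mulr_ge0 (ltW C10) a0; have := mulr_ge0 (ltW C20) b0.
have := mulr_ge0 (ltW e0) s0; have := mulr_ge0 (ltW e0) v0.
lra.
Qed.

(** Scaling N down keeps the dissipation strict, since part of the damping of
    B^T v is left over, and makes the cross term negligible against the
    energy. *)
Lemma strict_energy :
  posdef M -> posdef Kp -> dominated (fun s v => dotv s s + dotv v v) ->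
  exists N : 'M[R]_d,
    (exists2 q, 0 < q & forall s v,
       q * (dotv s s + dotv v v) <= dissip 2 N s v) /\
    (exists2 r, 0 < r & forall s v, r * (dotv s s + dotv v v) <=
       dotv s (Kp *m s) + 2 * dotv v (N *m s) + dotv v (M *m v)).
Proof.
move=> /posdef_coercive[m m0 hm] /posdef_coercive[k k0 hk] h.
have [|c [N hN]] := h 2^-1; first by rewrite invr_gt0.
have [C C0 hC] := mulmx_dotvv_bounded N.
(* D collects all the bounds that the factor of N has to respect *)
pose D := (`|c| + 1) + 2 / m + 2 * (C + 1) / k.
have D1 : 0 <= 2 / m by rewrite divr_ge0 // ltW.
have D2 : 0 <= 2 * (C + 1) / k by rewrite divr_ge0 ?(ltW k0) // mulr_ge0 // addr_ge0.
have c1 := normr_ge0 c.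
have D0 : 0 < D by rewrite /D; lra.
have t0 : 0 < D^-1 by rewrite invr_gt0.
have tD : D^-1 * D = 1 by rewrite mulVf ?gt_eqF.
exists (D^-1 *: N); split.
- exists (D^-1 / 2); first by rewrite divr_gt0.
  move=> s v.
  have -> : dissip 2 (D^-1 *: N) s v = D^-1 * dissip c N s v
            + (2 - D^-1 * c) * dotv (B^T *m v) (B^T *m v).
    by rewrite -dissipZ /dissip; ring.
  have g : D^-1 * c <= 2.
    have : D^-1 * c <= D^-1 * D; last by rewrite tD; lra.
    by rewrite ler_pM2l // /D; have := ler_norm c; lra.
  have : 0 <= (2 - D^-1 * c) * dotv (B^T *m v) (B^T *m v).
    by rewrite mulr_ge0 ?dotvv_ge0 ?subr_ge0.
  by have := ler_wpM2l (ltW t0) (hN s v); lra.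
- exists (Num.min (k / 2) (m / 2)); first by rewrite lt_min !divr_gt0.
  move=> s v; rewrite -scalemxAl dotvZr.
  have i1 := dotv_young (- v) (N *m s) (ltr01 : 0 < (1 : R)).
  rewrite invr1 !mul1r !dotvNl !dotvNr opprK in i1.
  have i2 := hC s; have i3 := hm v; have i4 := hk s.
  have s0 := dotvv_ge0 s; have v0 := dotvv_ge0 v.
  have tm : D^-1 <= m / 2.
    rewrite -(ler_pM2r D0) tD; apply: (@le_trans _ _ (m / 2 * (2 / m))).
      by rewrite le_eqVlt; apply/orP; left; apply/eqP; field; rewrite gt_eqF.
    by rewrite ler_pM2l ?divr_gt0 // /D; lra.
  have tk : D^-1 * C <= k / 2.
    rewrite -(ler_pM2r D0) mulrAC tD mul1r.
    apply: (@le_trans _ _ (k / 2 * (2 * (C + 1) / k))).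
      have -> : k / 2 * (2 * (C + 1) / k) = C + 1 by field; rewrite gt_eqF.
      by rewrite lerDl.
    by rewrite ler_pM2l ?divr_gt0 // /D; lra.
  have j1 := ler_wpM2l (ltW t0) i1.
  have j2 := ler_wpM2l (ltW t0) i2.
  have j3 := ler_wpM2r s0 tk; have j4 := ler_wpM2r v0 tm.
  have j5 : Num.min (k / 2) (m / 2) * dotv s s <= k / 2 * dotv s s.
    by rewrite ler_wpM2r // ge_min lexx.
  have j6 : Num.min (k / 2) (m / 2) * dotv v v <= m / 2 * dotv v v.
    by rewrite ler_wpM2r // ge_min lexx orbT.
  rewrite mulrDr; lra.
Qed.

End Strictify.

(** * Vectors of dimension 3 *)

Section Vec3.
Context {R : realType}.

Lemma sum3E (V : nmodType) (F : 'I_3 -> V) :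
  \sum_(i < 3) F i = F 0 + F 1 + F 2%:R.
Proof.
rewrite !big_ord_recl big_ord0 addr0 addrA.
by congr (F _ + F _ + F _); apply: val_inj.
Qed.

Lemma ord3P (P : 'I_3 -> Prop) : P 0 -> P 1 -> P 2%:R -> forall i, P i.
Proof.
move=> p0 p1 p2 [[|[|[|//]]] h].
- by rewrite (_ : Ordinal h = 0) //; apply: val_inj.
- by rewrite (_ : Ordinal h = 1) //; apply: val_inj.
- by rewrite (_ : Ordinal h = 2%:R) //; apply: val_inj.
Qed.

Lemma ord2P (P : 'I_2 -> Prop) : P 0 -> P 1 -> forall i, P i.
Proof.
move=> p0 p1 [[|[|//]] h].
- by rewrite (_ : Ordinal h = 0) //; apply: val_inj.
- by rewrite (_ : Ordinal h = 1) //; apply: val_inj.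
Qed.

Lemma sum2E (V : nmodType) (F : 'I_2 -> V) : \sum_(i < 2) F i = F 0 + F 1.
Proof.
by rewrite !big_ord_recl big_ord0 addr0; congr (F _ + F _); apply: val_inj.
Qed.

Lemma vec3_0 (a b c : R) : vec3 a b c 0 0 = a. Proof. by rewrite mxE. Qed.

Lemma vec3_1 (a b c : R) : vec3 a b c 1 0 = b. Proof. by rewrite mxE. Qed.

Lemma vec3_2 (a b c : R) : vec3 a b c 2%:R 0 = c. Proof. by rewrite mxE. Qed.

Definition vec3E := (vec3_0, vec3_1, vec3_2).

Lemma vec3P (u v : 'cV[R]_3) :
  u 0 0 = v 0 0 -> u 1 0 = v 1 0 -> u 2%:R 0 = v 2%:R 0 -> u = v.
Proof. by move=> *; apply/matrixP => i j; rewrite ord1; move: i; apply: ord3P. Qed.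

Lemma mulmx3E m (A : 'M[R]_(m, 3)) (v : 'cV[R]_3) i :
  (A *m v) i 0 = A i 0 * v 0 0 + A i 1 * v 1 0 + A i 2%:R * v 2%:R 0.
Proof. by rewrite mxE sum3E. Qed.

Lemma dotv3E (u v : 'cV[R]_3) :
  dotv u v = u 0 0 * v 0 0 + u 1 0 * v 1 0 + u 2%:R 0 * v 2%:R 0.
Proof. by rewrite /dotv sum3E. Qed.

Lemma crossE (u v : 'cV[R]_3) :
  ((cross u v 0 0 = u 1 0 * v 2%:R 0 - u 2%:R 0 * v 1 0) *
   (cross u v 1 0 = u 2%:R 0 * v 0 0 - u 0 0 * v 2%:R 0) *
   (cross u v 2%:R 0 = u 0 0 * v 1 0 - u 1 0 * v 0 0))%type.
Proof. by rewrite /cross !vec3E. Qed.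

Lemma hatE (u : 'cV[R]_3) :
  ((hat u 0 0 = 0) * (hat u 0 1 = - u 2%:R 0) * (hat u 0 2%:R = u 1 0) *
   ((hat u 1 0 = u 2%:R 0) * (hat u 1 1 = 0) * (hat u 1 2%:R = - u 0 0)) *
   ((hat u 2%:R 0 = - u 1 0) * (hat u 2%:R 1 = u 0 0) *
    (hat u 2%:R 2%:R = 0)))%type.
Proof.
by rewrite /hat; do !split; rewrite mxE crossE !mxE /=; ring.
Qed.

Lemma hat_mul (u v : 'cV[R]_3) : hat u *m v = cross u v.
Proof. by apply: vec3P; rewrite mulmx3E !hatE !crossE; ring. Qed.

Lemma crossDr (u v w : 'cV[R]_3) : cross u (v + w) = cross u v + cross u w.
Proof. by rewrite -!hat_mul mulmxDr. Qed.

Lemma crossZr a (u v : 'cV[R]_3) : cross u (a *: v) = a *: cross u v.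
Proof. by rewrite -!hat_mul scalemxAr. Qed.

Lemma crossNl (u v : 'cV[R]_3) : cross (- u) v = - cross u v.
Proof. by apply: vec3P; rewrite [RHS]mxE !crossE !mxE; ring. Qed.

Lemma crossC (u v : 'cV[R]_3) : cross u v = - cross v u.
Proof. by apply: vec3P; rewrite [RHS]mxE !crossE; ring. Qed.

Lemma crossDl (u v w : 'cV[R]_3) : cross (v + w) u = cross v u + cross w u.
Proof. by rewrite crossC crossDr opprD -!crossC. Qed.

Lemma crossNr (u v : 'cV[R]_3) : cross u (- v) = - cross u v.
Proof. by rewrite -!hat_mul mulmxN. Qed.

Lemma crossvv (u : 'cV[R]_3) : cross u u = 0.
Proof. by apply: vec3P; rewrite !crossE !mxE; ring. Qed.

Lemma cross_cross (q u : 'cV[R]_3) :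
  cross q (cross q u) = dotv q u *: q - dotv q q *: u.
Proof.
have E (w z : 'cV[R]_3) c e i : (c *: w - e *: z) i 0 = c * w i 0 - e * z i 0.
  by rewrite !mxE.
by apply: vec3P; rewrite E !crossE !dotv3E; ring.
Qed.

Lemma cross3 (q y : 'cV[R]_3) : dotv q q = 1 ->
  cross q (cross q (cross q y)) = - cross q y.
Proof.
move=> qq; rewrite cross_cross qq scale1r (_ : dotv q (cross q y) = 0).
  by rewrite scale0r sub0r.
by rewrite !dotv3E !crossE; ring.
Qed.

Lemma cross_projected (q a y g : 'cV[R]_3) (m k c : R) : dotv q q = 1 ->
  m *: a - cross q (cross q y) = - (k *: q) - c *: cross q (cross q g) ->
  cross q (m *: a + y) = c *: cross q g.
Proof.
move=> qq /(congr1 (cross q)); rewrite !crossDr !crossNr !crossZr crossvv.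
by rewrite !cross3 // scaler0 scalerN !opprK oppr0 add0r.
Qed.

Lemma norm2_cross (u v : 'cV[R]_3) : norm2 (cross u v) <= norm2 u * norm2 v.
Proof.
rewrite norm2_le_sqr ?mulr_ge0 ?norm2_ge0 // exprMn !norm2_sqr.
have -> : dotv (cross u v) (cross u v) = dotv u u * dotv v v - dotv u v ^+ 2.
  by rewrite !dotv3E !crossE; ring.
by rewrite lerBlDr lerDl sqr_ge0.
Qed.

Lemma e3E :
  ((e3 R 0 0 = 0) * (e3 R 1 0 = 0) * (e3 R 2%:R 0 = 1))%type.
Proof. by rewrite /e3 !vec3E. Qed.

Lemma C32E :
  ((C32 R 0 0 = 1) * (C32 R 0 1 = 0) * (C32 R 1 0 = 0) * (C32 R 1 1 = 1) *
   (C32 R 2%:R 0 = 0) * (C32 R 2%:R 1 = 0))%type.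
Proof.
have c (i : 'I_3) (j : 'I_2) : C32 R i j = if j == 0 then e1 R i 0 else e2 R i 0.
  rewrite /C32 mxE; case: (@splitP 1 1 j) => k; rewrite (ord1 k) => jk.
    by rewrite ifT //; apply/eqP/val_inj.
  by rewrite ifF //; apply/negP => /eqP/(congr1 val)/=; rewrite jk.
by do !split; rewrite c /e1 /e2 /= ?vec3E.
Qed.

End Vec3.

(** * The linearized chain of links *)

Section Chain.
Context {R : realType} (n : nat) (pl : plant R n).
Hypothesis plok : plant_ok pl.

(** A vector of linearized coordinates is split into the part of the quadrotor
    and one horizontal vector for each link. *)
Definition topv k (s : 'cV[R]_(3 + k)) : 'cV[R]_3 := usubmx s.
Definition linkv (s : 'cV[R]_(dimx n)) (i : 'I_n) : 'cV[R]_2 :=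
  submxcol (dsubmx s) i.
Definition mkv (x : 'cV[R]_3) (w : 'I_n -> 'cV[R]_2) : 'cV[R]_(dimx n) :=
  col_mx x (\mxcol_i w i).

Lemma norm2_topv k (s : 'cV[R]_(3 + k)) : norm2 (topv s) <= norm2 s.
Proof. by rewrite -{2}(vsubmxK s) norm2_col_mx_l. Qed.

Lemma mkvK s : mkv (topv s) (linkv s) = s.
Proof. by rewrite /mkv /topv /linkv submxcolK vsubmxK. Qed.

Lemma topv_mkv x w : topv (mkv x w) = x.
Proof. by rewrite /topv col_mxKu. Qed.

Lemma linkv_mkv x w i : linkv (mkv x w) i = w i.
Proof. by rewrite /linkv col_mxKd mxcolK. Qed.

Lemma dotv_mkv x w y z :
  dotv (mkv x w) (mkv y z) = dotv x y + \sum_i dotv (w i) (z i).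
Proof. by rewrite /mkv dotv_col_mx dotv_mxcol. Qed.

Lemma norm2_mkv x w :
  norm2 (mkv x w) <= norm2 x + \sum_i norm2 (w i).
Proof.
have s0 : 0 <= \sum_i norm2 (w i) by apply: sumr_ge0 => i _; exact: norm2_ge0.
rewrite norm2_le_sqr ?addr_ge0 ?norm2_ge0 // dotv_mkv sqrrD norm2_sqr.
have -> : \sum_i dotv (w i) (w i) = \sum_i norm2 (w i) ^+ 2.
  by apply: eq_bigr => i _; rewrite norm2_sqr.
have /andP[_ le] : (0 <= \sum_i norm2 (w i)) &&
    (\sum_i norm2 (w i) ^+ 2 <= (\sum_i norm2 (w i)) ^+ 2).
  elim/big_rec2: _ => [|i a b _ /andP[b0 ab]]; first by rewrite expr0n /= lexx.
  have n0 := norm2_ge0 (w i); rewrite addr_ge0 //= sqrrD.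
  by have := mulr_ge0 n0 b0; lra.
have := mulr_ge0 (norm2_ge0 x) s0; lra.
Qed.

Lemma mkvD x w y z : mkv x w + mkv y z = mkv (x + y) (fun i => w i + z i).
Proof. by rewrite /mkv add_col_mx mxcolD. Qed.

Lemma mkvZ a x w : a *: mkv x w = mkv (a *: x) (fun i => a *: w i).
Proof. rewrite /mkv scale_col_mx; congr col_mx.
by apply/matrixP => i j; rewrite !mxE. Qed.

(** The velocity of the direction of a hanging link is tilt *m w when w is the
    horizontal part of its angular velocity. *)
Definition tilt : 'M[R]_(3, 2) := - (hat (e3 R) *m C32 R).

Lemma Mlin_mkv x w : Mlin pl *m mkv x w =
  mkv (M00 pl *: x + \sum_i M0 pl i *: (tilt *m w i))
      (fun i => M0 pl i *: (tilt^T *m x) + \sum_j Mq pl i j *: w j).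
Proof.
rewrite /Mlin /mkv mul_block_col mul_scalar_mx /Mxq mul_mxrow_mxcol.
congr (col_mx (_ + _) _).
  by apply: eq_bigr => i _; rewrite mulNmx /tilt mulNmx scalerN -scalemxAl.
rewrite tr_mxrow mxcol_mul mul_mxblock_mxrow.
rewrite -mxcolD; apply: eq_mxcol => i; congr (_ + _).
  by rewrite /tilt [(- _)^T]linearN [(- _)^T]linearN !mulNmx linearZ /= -scalemxAl scalerN.
by apply: eq_bigr => j _; rewrite mul_scalar_mx.
Qed.

Lemma tiltE :
  ((tilt 0 0 = 0) * (tilt 0 1 = 1) * (tilt 1 0 = -1) * (tilt 1 1 = 0) *
   (tilt 2%:R 0 = 0) * (tilt 2%:R 1 = 0))%type.
Proof.
rewrite /tilt; do !split; rewrite mxE mxE sum3E !hatE !e3E !C32E; ring.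
Qed.

Lemma tilt_orth : tilt^T *m tilt = 1%:M.
Proof.
apply/matrixP; apply: ord2P; apply: ord2P; rewrite mxE sum3E ![_^T _ _]mxE !tiltE [1%:M _ _]mxE /=; ring.
Qed.

(** The gain of a PD feedback of the quadrotor position alone, and the stiffness
    of the linear system that this feedback closes. *)
Definition pos_gain : 'M[R]_(3, dimx n) := gain_mx 1 (fun=> 0).
Definition stiffness : 'M[R]_(dimx n) := Glin pl + Blin R n *m pos_gain.

Lemma gain_mx_mkv k x w : gain_mx k (fun=> 0) *m mkv x w = k *: x.
Proof.
rewrite /gain_mx /mkv mul_row_col mul_scalar_mx mul_mxrow_mxcol big1 ?addr0 //.
by move=> i _; rewrite scale0r mul0mx.
Qed.

Lemma Blin_mkv y : Blin R n *m y = mkv y (fun=> 0).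
Proof.
rewrite /Blin /mkv mul_col_mx mul1mx mul0mx; congr col_mx.
by rewrite mxcol0.
Qed.

Lemma trBlin_mkv s : (Blin R n)^T *m s = topv s.
Proof.
rewrite -{1}(vsubmxK s) /Blin tr_col_mx mul_row_col trmx1 trmx0 mul1mx mul0mx.
by rewrite addr0.
Qed.

Lemma stiffness_mkv x w :
  stiffness *m mkv x w = mkv x (fun i => Gq pl i *: w i).
Proof.
rewrite /stiffness mulmxDl -mulmxA gain_mx_mkv scale1r Blin_mkv.
rewrite {1}/mkv /Glin mul_block_col !mul0mx addr0 add0r mul_mxdiag_mxcol.
rewrite -[col_mx _ _]/(mkv 0 (fun i => _ *m w i)) mkvD add0r /mkv.
congr col_mx; apply: eq_mxcol => i.
by rewrite addr0 mul_scalar_mx.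
Qed.

Lemma tr_Mlin : (Mlin pl)^T = Mlin pl.
Proof.
rewrite /Mlin tr_block_mx trmxK tr_scalar_mx tr_mxblock; congr block_mx.
apply: eq_mxblock => i j; rewrite tr_scalar_mx; congr (_%:M).
by rewrite /Mq maxnC mulrAC.
Qed.

Lemma tr_stiffness : stiffness^T = stiffness.
Proof.
rewrite /stiffness /Glin /pos_gain /gain_mx /Blin mul_col_mx mul1mx mul0mx.
rewrite linearD /= tr_block_mx !trmx0 tr_mxdiag; congr (_ + _).
  by congr block_mx; apply: eq_mxdiag => i; rewrite tr_scalar_mx.
rewrite (_ : \mxrow_(i < n) (0 *: C32 R) = 0); last first.
  by apply/mxrowP => i; rewrite mxrowK submxrow0 scale0r.
rewrite -[X in col_mx _ X](row_mx0 _ _ 3 (dimq n)) -block_mxEv tr_block_mx.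
by rewrite !trmx0 tr_scalar_mx.
Qed.

Let lpos a : 0 < lmass pl a. Proof. by case: plok. Qed.
Let llpos a : 0 < llen pl a. Proof. by case: plok. Qed.

Lemma Gq_gt0 i : 0 < Gq pl i.
Proof.
have [_ _ _ _ g0] := plok.
rewrite /Gq (bigD1 i) //= ltr_pwDl ?mulr_gt0 //.
by apply: sumr_ge0 => j _; rewrite ltW ?mulr_gt0.
Qed.

Lemma stiffness_posdef : posdef stiffness.
Proof.
apply/posdefE; split; first exact: tr_stiffness.
move=> v; rewrite -(mkvK v); set x := topv v; set w := linkv v => v0.
rewrite stiffness_mkv dotv_mkv lt_def; apply/andP; split; last first.
  rewrite addr_ge0 ?dotvv_ge0 // sumr_ge0 // => i _.
  by rewrite dotvZr mulr_ge0 ?dotvv_ge0 ?(ltW (Gq_gt0 i)).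
have g i : 0 <= dotv (w i) (Gq pl i *: w i).
  by rewrite dotvZr mulr_ge0 ?dotvv_ge0 ?(ltW (Gq_gt0 i)).
apply: contra v0; rewrite paddr_eq0 ?dotvv_ge0 ?sumr_ge0 // dotvv_eq0.
move=> /andP[/eqP -> ]; rewrite psumr_eq0 // => /allP w0.
rewrite /mkv col_mx_eq0 eqxx; apply/eqP/mxcolP => i; rewrite mxcolK submxcol0.
have := w0 i (mem_index_enum i); rewrite dotvZr mulf_eq0 gt_eqF ?Gq_gt0 //=.
by rewrite dotvv_eq0 => /eqP.
Qed.

(** Twice the kinetic energy is the sum of the kinetic energies of the point
    masses: the mass a moves with velocity x + sum_(i <= a) l_i tilt w_i. *)
Lemma Mlin_form x w : dotv (mkv x w) (Mlin pl *m mkv x w) =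
  mass pl * dotv x x + \sum_(a < n) lmass pl a *
   (let y := x + \sum_(i < n | (i <= a)%N) llen pl i *: (tilt *m w i) in dotv y y).
Proof.
rewrite Mlin_mkv dotv_mkv.
pose u i := tilt *m w i.
have uu i j : dotv (w i) (w j) = dotv (u i) (u j).
  by rewrite /u dotv_mulmx mulmxA tilt_orth mul1mx.
have xu i : dotv (w i) (tilt^T *m x) = dotv x (u i).
  by rewrite dotv_mulmx trmxK dotvC.
have E1 : \sum_(i < n) dotv (w i) (M0 pl i *: (tilt^T *m x) +
     \sum_j Mq pl i j *: w j)
  = \sum_i M0 pl i * dotv x (u i) + \sum_i \sum_j Mq pl i j * dotv (u i) (u j).
  rewrite -big_split; apply: eq_bigr => i _.
  rewrite dotvDr dotvZr xu dotv_sumr; congr (_ + _).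
  by apply: eq_bigr => j _; rewrite dotvZr uu.
have E2 : \sum_i M0 pl i * dotv x (u i) =
  \sum_(a < n) lmass pl a * dotv x (\sum_(i < n | (i <= a)%N) llen pl i *: u i).
  under [RHS]eq_bigr do rewrite dotv_sumr mulr_sumr.
  rewrite (exchange_big_dep xpredT) //=; apply: eq_bigr => i _.
  by rewrite mulr_suml; apply: eq_bigr => a _; rewrite dotvZr mulrA.
have E3 : \sum_i \sum_j Mq pl i j * dotv (u i) (u j) =
  \sum_(a < n) lmass pl a * dotv (\sum_(i < n | (i <= a)%N) llen pl i *: u i)
    (\sum_(i < n | (i <= a)%N) llen pl i *: u i).
  under [RHS]eq_bigr do rewrite dotv_suml mulr_sumr.
  rewrite [RHS](exchange_big_dep xpredT) //=; apply: eq_bigr => i _.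
  under [RHS]eq_bigr do rewrite dotv_sumr mulr_sumr.
  rewrite [RHS](exchange_big_dep xpredT) //=; apply: eq_bigr => j _.
  rewrite /Mq !mulr_suml; apply: eq_big => [a|a _]; first by rewrite geq_max.
  by rewrite dotvZl dotvZr; ring.
rewrite E1 dotvDr dotvZr dotv_sumr.
under eq_bigr do rewrite dotvZr -/(u _).
rewrite E2 E3 /M00 mulrDl -!addrA; congr (_ + _).
rewrite mulr_suml -!big_split /=; apply: eq_bigr => a _.
rewrite -/u dotvDl !dotvDr [dotv (\sum_(i < n | _) _) x]dotvC; ring.
Qed.

Lemma Mlin_posdef : posdef (Mlin pl).
Proof.
have [m0 _ _ _ _] := plok.
apply/posdefE; split; first exact: tr_Mlin.
move=> v; rewrite -(mkvK v); set x := topv v; set w := linkv v => v0.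
have f0 a : 0 <= lmass pl a * (let y := x + \sum_(i < n | (i <= a)%N)
    llen pl i *: (tilt *m w i) in dotv y y).
  by rewrite mulr_ge0 ?dotvv_ge0 // ltW.
rewrite Mlin_form lt_def; apply/andP; split; last first.
  by rewrite addr_ge0 ?mulr_ge0 ?dotvv_ge0 ?(ltW m0) // sumr_ge0.
apply: contra v0; rewrite paddr_eq0 ?mulr_ge0 ?dotvv_ge0 ?(ltW m0) ?sumr_ge0 //.
rewrite mulf_eq0 gt_eqF //= dotvv_eq0 => /andP[/eqP x0].
rewrite psumr_eq0 // => /allP w0.
have wi : forall k (i : 'I_n), (i < k)%N -> w i = 0.
  elim=> // k IH i; rewrite ltnS leq_eqVlt => /orP[/eqP ik|]; last exact: IH.
  have := w0 i (mem_index_enum i); rewrite mulf_eq0 gt_eqF //= x0 add0r dotvv_eq0.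
  rewrite (bigD1 i) //= big1 ?addr0; last first.
    move=> j /andP[ji jn]; rewrite IH ?mulmx0 ?scaler0 //.
    by rewrite -ik ltn_neqAle ji andbT; apply: contra jn => /eqP/val_inj ->.
  rewrite scaler_eq0 gt_eqF //= => /eqP/(congr1 (mulmx tilt^T)).
  by rewrite mulmxA tilt_orth mul1mx mulmx0.
rewrite x0 /mkv col_mx_eq0 eqxx; apply/eqP/mxcolP => i.
by rewrite mxcolK submxcol0; apply: (wi n).
Qed.

End Chain.

Section ChainDominated.
Context {R : realType} (n : nat) (pl : plant R n).
Hypothesis plok : plant_ok pl.

Local Notation M := (Mlin pl).
Local Notation S := (stiffness pl).
Local Notation B := (Blin R n).
Let K := invmx M *m S.
Let pw k := iter k (mulmx K) 1%:M.
Local Notation dom := (dominatedv M S B).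

Let pwS k : pw k.+1 = K *m pw k. Proof. by []. Qed.

Let pwSr k : pw k.+1 = pw k *m K.
Proof. by elim: k => [|k IH]; rewrite pwS ?mul1mx ?mulmx1 // {1}IH mulmxA. Qed.

(** The damped quantity is the velocity of the quadrotor; alternating velocity
    and position steps reaches its images under all powers of K = M^-1 S. *)
Let dominated_top k : dom (fun s v => topv (pw k *m v)).
Proof.
suff h : dom (fun s v => B^T *m pw k *m v).
  by apply: dominatedv_eq h => s v; rewrite -mulmxA trBlin_mkv.
elim: k => [|k IH].
  by apply: dominatedv_eq (dominated_input M S B) => s v; rewrite mulmx1.
apply: dominatedv_eq (dominated_velocity (dominated_position IH)) => s v.
by rewrite pwSr !mulmxA.
Qed.

Let MK (u : 'cV[R]_(dimx n)) : M *m (K *m u) = S *m u.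
Proof.
by rewrite /K mulmxA mulmxA mulmxV ?mul1mx //; exact/posdef_unitmx/Mlin_posdef.
Qed.

Lemma Mq_ge (i j : 'I_n) : (i <= j)%N -> Mq pl i j = llen pl i * M0 pl j.
Proof.
by move=> ij; rewrite /Mq /M0 (maxn_idPr ij) -mulr_suml; ring.
Qed.

(** Row i of the chain and l_i times its top row have the same coefficients on
    the links j >= i, because the tension on link i carries all of these. *)
Lemma link_elimination (u u' : 'cV[R]_(dimx n)) i : M *m u' = S *m u ->
  Gq pl i *: linkv u i =
   llen pl i *: ((@tilt R)^T *m topv u) +
   (M0 pl i - llen pl i * M00 pl) *: ((@tilt R)^T *m topv u') +
   \sum_(j < n | (j < i)%N) (Mq pl i j - llen pl i * M0 pl j) *: linkv u' j.
Proof.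
rewrite -{1}(mkvK u) -{1}(mkvK u') Mlin_mkv stiffness_mkv => e.
have := congr1 (fun s => linkv s i) e; have := congr1 (@topv R (dimq n)) e.
rewrite !topv_mkv !linkv_mkv => et <-.
move/(congr1 (mulmx (@tilt R)^T)): et => <-.
rewrite mulmxDr -scalemxAr mulmx_sumr !scalerDr scalerA scalerBl.
have -> : \sum_j (@tilt R)^T *m (M0 pl j *: (@tilt R *m linkv u' j))
          = \sum_j M0 pl j *: linkv u' j.
  by apply: eq_bigr => j _; rewrite -scalemxAr mulmxA tilt_orth mul1mx.
rewrite [RHS](_ : _ = M0 pl i *: ((@tilt R)^T *m topv u')
   + (llen pl i *: (\sum_(j < n) M0 pl j *: linkv u' j) +
    \sum_(j < n | (j < i)%N) (Mq pl i j - llen pl i * M0 pl j) *: linkv u' j)).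
  congr (_ + _); rewrite scaler_sumr [X in _ = _ + X]big_mkcond -big_split /=.
  apply: eq_bigr => j _; rewrite scalerA; case: ltnP => ij.
    by rewrite -scalerDl addrC subrK.
  by rewrite addr0 Mq_ge.
set a := (llen pl i * M00 pl) *: _; set b := M0 pl i *: _.
by rewrite [a + _]addrC -(addrA _ a) [a + (b - a)]addrC subrK -addrA addrCA.
Qed.

(** Going down the chain, the coordinate of a link in K^k v is recovered from the
    quadrotor and from the links above it in K^k v and K^(k+1) v. *)
Let dominated_link m (i : 'I_n) k : (i < m)%N ->
  dom (fun s v => linkv (pw k *m v) i).
Proof.
elim: m => // m IH in i k *; rewrite ltnS => im.
pose f (s v : 'cV[R]_(dimx n)) := llen pl i *: ((@tilt R)^T *m topv (pw k *m v)) +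
   (M0 pl i - llen pl i * M00 pl) *: ((@tilt R)^T *m topv (pw k.+1 *m v)) +
   \sum_(j < n | (j < i)%N)
     (Mq pl i j - llen pl i * M0 pl j) *: linkv (pw k.+1 *m v) j : 'cV[R]_2.
have hf : dom f.
  apply: dominatedvD; first apply: dominatedvD.
  - by apply: dominatedvZ; apply: dominatedv_mulmx; exact: dominated_top.
  - by apply: dominatedvZ; apply: dominatedv_mulmx; exact: dominated_top.
  - apply: dominatedv_sum => j ji; apply: dominatedvZ.
    by apply: IH; exact: leq_trans ji im.
apply: dominatedv_eq (dominatedvZ (Gq pl i)^-1 hf) => s v.
rewrite /f -link_elimination; last by rewrite pwS -mulmxA MK.
by rewrite scalerA mulVf ?scale1r // gt_eqF // Gq_gt0.
Qed.

(** A motion of the chain that does not move the quadrotor is at rest, since the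
    quadrotor would feel every swinging link: all links are damped through it. *)
Lemma chain_dominated : dominated M S B (fun s v => dotv s s + dotv v v).
Proof.
have hv : dom (fun s v => v).
  have h := dominatedD (dominated_top 0) (_ : dominated M S B (fun s v =>
    \sum_(i < n) dotv (linkv v i) (linkv v i))).
  apply: (dominated_le ltr01 (h _)) => [|s v]; last first.
    by rewrite mul1r mul1mx -{1 2}(mkvK v) dotv_mkv.
  have H : forall r : seq 'I_n, dominated M S B (fun s v =>
    \sum_(i <- r) dotv (linkv v i) (linkv v i)).
    elim=> [|i r IH].
      apply: (dominated_le ltr01 (@dominatedv0 _ _ _ M S B 1)) => s v.
      by rewrite big_nil dotv0r mulr0.
    have hi : dom (fun s v => linkv v i).
      apply: (dominatedv_eq _ (@dominated_link n i 0 (ltn_ord i))) => s v.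
      by rewrite mul1mx.
    by apply: (dominated_le ltr01 (dominatedD hi IH)) => s v; rewrite big_cons mul1r.
  exact: H.
have hs : dom (fun s v => s).
  have h : dom (fun s v => 1%:M *m v).
    by apply: dominatedv_eq hv => s v; rewrite mul1mx.
  apply: dominatedv_eq (dominatedv_mulmx (invmx S *m M) (dominated_position h)).
  move=> s v; rewrite mul1mx -mulmxA MK mulmxA mulVmx ?mul1mx //.
  exact/posdef_unitmx/stiffness_posdef.
exact: dominatedD.
Qed.

End ChainDominated.

Section Hurwitz.
Context {R : realType}.

(** If v A = l v with v = a + i b, then the form of S = P^-1 along the real
    pair (a, b) grows at the rate 2 Re l, whereas the Lyapunov equation says
    that it decreases. *)
Lemma lyapunov_hurwitz k (A P Q : 'M[R]_k) :
  posdef P -> posdef Q -> A^T *m P + P *m A = - Q -> hurwitz A.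
Proof.
move=> pP pQ e l /eigenvalueP[v vA v0].
have uP := posdef_unitmx pP; have /posdefE[sP qP] := pP; have /posdefE[_ qQ] := pQ.
pose Re := fun z : R[i] => complex.Re z; pose Im := fun z : R[i] => complex.Im z.
pose a : 'cV[R]_k := \col_i Re (v 0 i); pose b : 'cV[R]_k := \col_i Im (v 0 i).
have ab : (a != 0) || (b != 0).
  rewrite -negb_and; apply: contra v0 => /andP[/eqP a0 /eqP b0].
  apply/eqP/rowP => i; rewrite mxE; apply/eqP; rewrite eq_complex /=.
  have := congr1 (fun u : 'cV[R]_k => u i 0) a0.
  have := congr1 (fun u : 'cV[R]_k => u i 0) b0.
  by rewrite !mxE => hb ha; apply/andP; split; apply/eqP.
have ReM x y : Re (x * y) = Re x * Re y - Im x * Im y by case: x y => ? ? [].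
have ImM x y : Im (x * y) = Re x * Im y + Im x * Re y by case: x y => ? ? [].
have Re_sum (F : 'I_k -> R[i]) : Re (\sum_i F i) = \sum_i Re (F i).
  by elim/big_rec2: _ => // i x y _ <-; case: (F i) => ? ?; case: y.
have Im_sum (F : 'I_k -> R[i]) : Im (\sum_i F i) = \sum_i Im (F i).
  by elim/big_rec2: _ => // i x y _ <-; case: (F i) => ? ?; case: y.
have Aa : A^T *m a = Re l *: a - Im l *: b.
  apply/colP => j; have := congr1 (fun u : 'rV[R[i]]_k => Re (u 0 j)) vA.
  rewrite !mxE ReM => <-; rewrite Re_sum; apply: eq_bigr => i _.
  by rewrite !mxE ReM mulr0 subr0 mulrC.
have Ab : A^T *m b = Re l *: b + Im l *: a.
  apply/colP => j; have := congr1 (fun u : 'rV[R[i]]_k => Im (u 0 j)) vA.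
  rewrite !mxE ImM => <-; rewrite Im_sum; apply: eq_bigr => i _.
  by rewrite !mxE ImM mulr0 add0r mulrC.
pose S := invmx P.
have sS : S^T = S by rewrite /S trmx_inv sP.
have key w : dotv (A^T *m w) (S *m w) *+ 2 = - dotv (S *m w) (Q *m (S *m w)).
  have := congr1 (fun X => dotv (S *m w) (X *m (S *m w))) e.
  rewrite mulmxDl mulNmx dotvNr => <-; rewrite dotvDr -!mulmxA.
  rewrite (mulmxA P S) mulmxV // mul1mx mulr2n; congr (_ + _).
    by rewrite dotvC.
  rewrite [RHS]dotv_mulmx sP (mulmxA P S) mulmxV // mul1mx.
  by rewrite [RHS]dotv_mulmx.
have pS w : w != 0 -> 0 < dotv w (S *m w).
  move=> w0; have : S *m w != 0.
    apply: contra w0 => /eqP/(congr1 (mulmx P)).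
    by rewrite mulmx0 mulmxA mulmxV // mul1mx => ->.
  by move=> /qP; rewrite mulmxA mulmxV // mul1mx dotvC.
have nS w : w != 0 -> dotv (A^T *m w) (S *m w) < 0.
  move=> w0; have : S *m w != 0.
    apply: contra w0 => /eqP/(congr1 (mulmx P)).
    by rewrite mulmx0 mulmxA mulmxV // mul1mx => ->.
  by move=> /qQ; have := key w; rewrite mulr2n; lra.
have pS0 w : 0 <= dotv w (S *m w).
  by have [->|/pS/ltW//] := eqVneq w 0; rewrite dotv0l.
have nS0 w : dotv (A^T *m w) (S *m w) <= 0.
  by have [->|/nS/ltW//] := eqVneq w 0; rewrite !mulmx0 dotv0l.
have bS : dotv b (S *m a) = dotv a (S *m b) by rewrite dotv_mulmx sS dotvC.
have tot : dotv (A^T *m a) (S *m a) + dotv (A^T *m b) (S *m b)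
  = Re l * (dotv a (S *m a) + dotv b (S *m b)).
  by rewrite Aa Ab dotvBl dotvDl !dotvZl bS; ring.
have lt0 : Re l * (dotv a (S *m a) + dotv b (S *m b)) < 0.
  rewrite -tot; case/orP: ab => h; have := nS _ h.
    by have := nS0 b; lra.
  by have := nS0 a; lra.
have gt0 : 0 < dotv a (S *m a) + dotv b (S *m b).
  by case/orP: ab => h; have := pS _ h; [have := pS0 b | have := pS0 a]; lra.
by move: lt0; rewrite -/(Re l) pmulr_llt0.
Qed.

End Hurwitz.

Section LinearDesign.
Context {R : realType} (n : nat) (pl : plant R n).
Hypothesis plok : plant_ok pl.

Local Notation M := (Mlin pl).
Local Notation S := (stiffness pl).
Local Notation B := (Blin R n).

Lemma pos_gainE : @pos_gain R n = B^T.
Proof.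
apply/matrixP => i j; suff : forall s : 'cV[R]_(dimx n), @pos_gain R n *m s = B^T *m s.
  by move=> /(_ (delta_mx j 0)); rewrite -!colE => /colP/(_ i); rewrite !mxE.
move=> s; rewrite trBlin_mkv -{1}(mkvK s) /pos_gain gain_mx_mkv.
by rewrite scale1r.
Qed.

(** Keeping M as the velocity block of P makes the velocity part of the
    integrated output (P BB)^T z1 equal to the velocity itself. *)
Lemma linear_design : exists (W : 'M[R]_(dimx n)) (P Q : 'M[R]_(dimx n + dimx n)),
  [/\ (forall gn : gains R n, Kx gn = @pos_gain R n -> Kxdot gn = @pos_gain R n ->
        (AA pl gn)^T *m P + P *m AA pl gn = - Q),
      posdef P /\ posdef Q,
      (forall s v : 'cV[R]_(dimx n), (P *m BB pl)^T *m col_mx s v = W *m s + v),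
      (exists2 r, 0 < r & forall s v : 'cV[R]_(dimx n), r * (dotv s s + dotv v v) <=
        dotv s (S *m s) + 2 * dotv (W *m s) (M *m v) + dotv v (M *m v))
    & (exists2 q, 0 < q & forall s v : 'cV[R]_(dimx n), q * (dotv s s + dotv v v) <=
        2 * dotv (topv v) (topv v) - 2 * dotv (W *m v) (M *m v)
        + 2 * dotv (W *m s) (S *m s + B *m topv v))].
Proof.
have uM := posdef_unitmx (Mlin_posdef plok).
have [N [[q q0 hq] [r r0 hr]]] :=
  strict_energy (Mlin_posdef plok) (stiffness_posdef plok) (chain_dominated plok).
(* the velocity block of P is M itself, so that (P BB)^T z1 = W s + v *)
pose P := block_mx S N^T N M.
pose A := block_mx 0 1%:M (- (invmx M *m S)) (- (invmx M *m B *m B^T)).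
pose Q := - (A^T *m P + P *m A).
have sP : P^T = P by rewrite /P tr_block_mx tr_stiffness tr_Mlin trmxK.
have siM : (invmx M)^T = invmx M by rewrite trmx_inv tr_Mlin.
have WM (s v : 'cV[R]_(dimx n)) : dotv (invmx M *m N *m s) (M *m v) = dotv v (N *m s).
  by rewrite dotv_mulmx tr_Mlin !mulmxA mulmxV // mul1mx dotvC.
have Pf (s v : 'cV[R]_(dimx n)) : dotv (col_mx s v) (P *m col_mx s v)
    = dotv s (S *m s) + 2 * dotv v (N *m s) + dotv v (M *m v).
  rewrite /P mul_block_col dotv_col_mx !dotvDr [dotv s (N^T *m v)]dotv_mulmx trmxK.
  by rewrite [dotv (N *m s) v]dotvC; ring.
have Qf (s v : 'cV[R]_(dimx n)) : dotv (col_mx s v) (Q *m col_mx s v) = dissip M S B 2 N s v.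
  set z := col_mx s v.
  have Ez : A *m z = col_mx v (- (invmx M *m S *m s + invmx M *m B *m B^T *m v)).
    by rewrite /A /z mul_block_col mul0mx mul1mx add0r !mulNmx -opprD.
  have E1 : dotv z (Q *m z) = - (2 * dotv (A *m z) (P *m z)).
    rewrite /Q mulNmx dotvNr mulmxDl dotvDr -!mulmxA.
    rewrite [dotv z (A^T *m _)]dotv_mulmx trmxK [dotv z (P *m _)]dotv_mulmx sP.
    by rewrite [dotv (P *m z) _]dotvC; ring.
  rewrite E1 Ez /P /z mul_block_col dotv_col_mx !dotvDr !dotvNl /dissip.
  set w := invmx M *m S *m s + _.
  have Ew : M *m w = S *m s + B *m (B^T *m v).
    by rewrite /w mulmxDr !mulmxA mulmxV // !mul1mx.
  clearbody w; rewrite [dotv w (M *m v)]dotv_mulmx tr_Mlin Ew dotvDl.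
  rewrite [dotv v (N^T *m v)]dotv_mulmx trmxK [dotv (N *m v) v]dotvC.
  rewrite [dotv (S *m s) v]dotvC [dotv (B *m _) v]dotvC.
  by rewrite [dotv v (B *m _)]dotv_mulmx; ring.
have split_nz (z : 'cV[R]_(dimx n + dimx n)) : z != 0 ->
    0 < dotv (usubmx z) (usubmx z) + dotv (dsubmx z) (dsubmx z).
  move=> z0; rewrite -dotv_col_mx vsubmxK lt_def dotvv_ge0 andbT.
  by rewrite dotvv_eq0.
exists (invmx M *m N), P, Q; split.
- move=> gn ex ev; rewrite /Q opprK.
  suff -> : AA pl gn = A by [].
  by rewrite /AA ex ev /A -pos_gainE.
- split; apply/posdefE; split.
  + exact: sP.
  + move=> z z0; rewrite -(vsubmxK z) Pf; apply: lt_le_trans (hr _ _).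
    by rewrite mulr_gt0 // split_nz.
  + rewrite /Q linearN /= linearD /= !trmx_mul trmxK sP; congr (- _).
    by rewrite addrC.
  + move=> z z0; rewrite -(vsubmxK z) Qf; apply: lt_le_trans (hq _ _).
    by rewrite mulr_gt0 // split_nz.
- move=> s v; rewrite trmx_mul sP /BB tr_col_mx trmx0 siM /P.
  rewrite -mulmxA mul_block_col mul_row_col mul0mx add0r mulmxDr !mulmxA mulVmx //.
  by rewrite mul1mx.
- by exists r => // s v; rewrite WM; exact: hr.
- exists q => // s v; apply: le_trans (hq s v) _; rewrite /dissip WM.
  rewrite trBlin_mkv lerD2l -(trBlin_mkv v) le_eqVlt; apply/orP; left; apply/eqP.
  by congr (2 * _); rewrite -!mulmxA -mulmxDr [LHS]dotvC dotv_mulmx siM.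
Qed.

End LinearDesign.

(** * The matrix exponential near 0 *)

Section MxNorm.
Context {R : realType}.

Lemma entry_le_mxnorm m n (A : 'M[R]_(m, n)) i j : `|A i j| <= `|A|.
Proof. by rewrite [leRHS]/Num.Def.normr /= mx_normrE (le_bigmax _ _ (i, j)). Qed.

Lemma norm2_le_mxnorm3 (u : 'cV[R]_3) a : `|u| <= a -> norm2 u <= 3 * a.
Proof.
move=> h; apply: le_trans (norm2_le_sum u) _; rewrite sum3E.
have e i : `|u i 0| <= a by apply: le_trans h; exact: entry_le_mxnorm.
by have := e 0; have := e 1; have := e 2%:R; lra.
Qed.

Lemma mxnorm_le m n (A : 'M[R]_(m, n)) c : 0 <= c ->
  (forall i j, `|A i j| <= c) -> `|A| <= c.
Proof.
move=> c0 h; rewrite [leLHS]/Num.Def.normr /= mx_normrE.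
by apply: bigmax_le => // -[i j] _; exact: h.
Qed.

Lemma mulmx_mxnorm_le m n p (A : 'M[R]_(m, n)) (B : 'M[R]_(n, p)) :
  `|A *m B| <= n%:R * (`|A| * `|B|).
Proof.
apply: mxnorm_le => [|i j]; first by rewrite !mulr_ge0.
rewrite mxE; apply: le_trans (ler_norm_sum _ _ _) _.
apply: (@le_trans _ _ (\sum_(k < n) `|A| * `|B|)).
  by apply: ler_sum => k _; rewrite normrM ler_pM // entry_le_mxnorm.
by rewrite sumr_const card_ord mulr_natl.
Qed.

Lemma cvg_mx (T : Type) (F : set_system T) (FF : Filter F) m n
    (f : T -> 'M[R]_(m, n)) (l : 'M[R]_(m, n)) :
  (forall i j, f x i j @[x --> F] --> l i j) -> f @ F --> l.
Proof.
move=> h; apply/cvgrPdist_le => /= e e0; near=> x.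
apply: mxnorm_le => [|i j]; first exact: ltW.
rewrite !mxE; move: i j; near: x.
apply: filter_forall => i; apply: filter_forall => j.
by have /cvgrPdist_le/(_ _ e0) := h i j.
Unshelve. all: by end_near. Qed.

Lemma cvg_entry (T : Type) (F : set_system T) (FF : Filter F) m n
    (f : T -> 'M[R]_(m, n)) (l : 'M[R]_(m, n)) i j :
  f @ F --> l -> f x i j @[x --> F] --> l i j.
Proof.
move=> /cvgrPdist_le h; apply/cvgrPdist_le => e e0.
have := h e e0; apply: filterS => x; apply: le_trans.
by apply: le_trans (entry_le_mxnorm _ i j); rewrite !mxE.
Qed.

End MxNorm.

Section Exponential.
Context {R : realType}.
Implicit Types X Y : 'M[R]_3.

Let ecoef X k : 'M[R]_3 := k`!%:R^-1 *: X ^+ k.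

Let mxM X Y : `|X * Y| <= 3 * (`|X| * `|Y|).
Proof. exact: mulmx_mxnorm_le. Qed.

Lemma mxpow_norm X m k : `|X| <= m -> `|X ^+ k.+1| <= (3 * m) ^+ k * m.
Proof.
move=> Xm; have m0 : 0 <= m by apply: le_trans Xm.
elim: k => [|k IH]; first by rewrite expr1 mul1r.
rewrite exprS; apply: le_trans (mxM _ _) _.
by rewrite [(3 * m) ^+ _]exprS -!mulrA ler_pM2l // ler_pM.
Qed.

Lemma mxpow_lipschitz X Y m k : `|X| <= m -> `|Y| <= m ->
  `|X ^+ k.+1 - Y ^+ k.+1| <= k.+1%:R * (3 * m) ^+ k * `|X - Y|.
Proof.
move=> Xm Ym; have m0 : 0 <= m by apply: le_trans Xm.
elim: k => [|k IH]; first by rewrite !expr1 !mul1r.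
have -> : X ^+ k.+2 - Y ^+ k.+2 = X ^+ k.+1 * (X - Y) + (X ^+ k.+1 - Y ^+ k.+1) * Y.
  by rewrite mulrBr mulrBl -!exprSr addrA subrK.
apply: le_trans (ler_normD _ _) _.
have h1 : `|X ^+ k.+1 * (X - Y)| <= (3 * m) ^+ k.+1 * `|X - Y|.
  apply: le_trans (mxM _ _) _; rewrite mulrA ler_wpM2r // [(3 * m) ^+ _]exprS.
  by rewrite -mulrA [m * _]mulrC ler_pM2l // mxpow_norm.
have h2 : `|(X ^+ k.+1 - Y ^+ k.+1) * Y|
          <= k.+1%:R * (3 * m) ^+ k.+1 * `|X - Y|.
  apply: le_trans (mxM _ _) _.
  have := ler_pM (normr_ge0 _) (normr_ge0 _) IH Ym.
  rewrite [(3 * m) ^+ k.+1]exprS => h; have := ler_wpM2l (ler0n R 3) h.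
  by move=> /le_trans; apply; rewrite le_eqVlt; apply/orP; left; apply/eqP; ring.
by apply: le_trans (lerD h1 h2) _; rewrite -[k.+2]addn1 natrD; lra.
Qed.

Let series_ordE (u : nat -> 'M[R]_3) N : series u N = \sum_(k < N) u k.
Proof. by rewrite /series /= big_mkord. Qed.

Let sum_split2 (u : nat -> 'M[R]_3) N :
  \sum_(k < N.+2) u k = u 0%N + u 1%N + \sum_(k < N) u k.+2.
Proof. by rewrite !big_ord_recl addrA. Qed.

Let sum_split3 (u : nat -> 'M[R]_3) N :
  \sum_(k < N.+3) u k = u 0%N + u 1%N + u 2%N + \sum_(k < N) u k.+3.
Proof. by rewrite !big_ord_recl !addrA. Qed.

Let ecoef0 X : ecoef X 0 = 1.
Proof. by rewrite /ecoef fact0 invr1 scale1r expr0. Qed.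

Let ecoef1 X : ecoef X 1 = X.
Proof. by rewrite /ecoef (_ : 1`! = 1%N) // invr1 scale1r expr1. Qed.

Let ecoef2 X : ecoef X 2 = 2^-1 *: X ^+ 2.
Proof. by rewrite /ecoef (_ : 2`! = 2%N). Qed.

Let invfact_ge0 k : 0 <= (k`!%:R : R)^-1.
Proof. by rewrite invr_ge0. Qed.

Lemma expmx_cvg X : series (ecoef X) @ \oo --> expmx X.
Proof.
rewrite /expmx; apply/(@cvg_ex _ (series (ecoef X) @ \oo)).
have h i j : cvgn (series (fun k => ecoef X k i j)).
  apply: normed_cvg; apply: (series_le_cvg _ _ _ (is_cvg_series_exp_coeff (3 * `|X|))).
  - by move=> k /=.
  - by move=> k /=; rewrite divr_ge0 // exprn_ge0 // mulr_ge0.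
  - move=> k /=; rewrite mxE normrM ger0_norm // mulrC ler_wpM2r //.
    case: k => [|k]; first by rewrite !expr0 mxE; case: eqP => _; rewrite ?normr1 ?normr0.
    apply: le_trans (entry_le_mxnorm _ _ _) _.
    apply: le_trans (mxpow_norm _ (lexx _)) _.
    rewrite exprSr ler_wpM2l ?exprn_ge0 ?mulr_ge0 // ler_peMl //; lra.
exists (\matrix_(i, j) limn (series (fun k => ecoef X k i j))).
apply: cvg_mx => i j; rewrite mxE.
apply: cvg_trans (h i j); apply: near_eq_cvg; near=> k.
by rewrite /series /= summxE.
Unshelve. all: by end_near. Qed.

Let invfact_sum N : \sum_(k < N) (k.+1`!%:R : R)^-1 <= 2.
Proof.
suff : \sum_(k < N) (k.+1`!%:R : R)^-1 <= 2 - (N`!%:R)^-1.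
  by have := invfact_ge0 N; lra.
elim: N => [|N IH]; first by rewrite big_ord0 fact0 invr1; lra.
rewrite big_ord_recr /=.
have [->|N0] := posnP N; first by rewrite big_ord0 (_ : 1`! = 1%N) // ?invr1; lra.
suff : 2 * (N.+1`!%:R : R)^-1 <= (N`!%:R)^-1 by move: IH; lra.
rewrite factS natrM invfM mulrA ler_piMl // ler_pdivrMr ?ltr0n // mul1r.
by rewrite ler_nat.
Qed.

(** The powers are Lipschitz, so the exponential minus its linear part is
    Lipschitz with a constant of the order of the radius of the ball. *)
Lemma expmx_lipschitz X Y m : `|X| <= m -> `|Y| <= m -> 3 * m <= 1 ->
  `|expmx X - expmx Y - (X - Y)| <= 6 * m * `|X - Y|.
Proof.
move=> Xm Ym m1; have m0 : 0 <= m by apply: le_trans Xm.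
have c : (fun N => series (ecoef X) N - series (ecoef Y) N - (X - Y)) @ \oo
         --> expmx X - expmx Y - (X - Y).
  by apply: cvgB; [apply: cvgB; exact: expmx_cvg|exact: cvg_cst].
have cn : (fun N => `|series (ecoef X) N - series (ecoef Y) N - (X - Y)|) @ \oo
          --> `|expmx X - expmx Y - (X - Y)| by exact: cvg_norm.
rewrite -(cvg_lim (@Rhausdorff R) cn).
apply: limr_le; first by apply/cvg_ex; eexists; exact: cn.
exists 2%N => // -[//|[//|N]] _.
rewrite !series_ordE !sum_split2 !ecoef0 !ecoef1.
set sX := \sum_(i < N) _; set sY := \sum_(i < N) _.
have -> : 1 + X + sX - (1 + Y + sY) - (X - Y) = sX - sY.
  by apply/matrixP => i j; rewrite !mxE; ring.
rewrite -sumrB; apply: le_trans (ler_norm_sum _ _ _) _.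
apply: (@le_trans _ _ (\sum_(k < N) (3 * m * `|X - Y|) * (k.+1`!%:R)^-1)); last first.
  rewrite -mulr_sumr; have := ler_wpM2l (_ : 0 <= 3 * m * `|X - Y|) (invfact_sum N).
  by rewrite !mulr_ge0 // => /(_ isT); lra.
apply: ler_sum => k _; rewrite /ecoef -scalerBr normrZ ger0_norm //.
rewrite factS natrM invfM [_^-1 * _^-1]mulrC -[leLHS]mulrA [leRHS]mulrC ler_wpM2l //.
rewrite mulrC ler_pdivrMr ?ltr0n //.
apply: le_trans (mxpow_lipschitz _ Xm Ym) _.
rewrite [leRHS]mulrC -mulrA ler_wpM2l // ler_wpM2r // exprS.
by rewrite ler_piMr ?mulr_ge0 // exprn_ile1 ?mulr_ge0.
Qed.

(** The cubic remainder is needed for the height of a link, whose leading term is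
    quadratic. *)
Lemma expmx_quadratic X : 3 * `|X| <= 1 ->
  `|expmx X - (1 + X + 2^-1 *: X ^+ 2)| <= 18 * `|X| ^+ 3.
Proof.
move=> m1; set m := `|X|; have m0 : 0 <= m := normr_ge0 _.
have c : (fun N => series (ecoef X) N - (1 + X + 2^-1 *: X ^+ 2)) @ \oo
         --> expmx X - (1 + X + 2^-1 *: X ^+ 2).
  by apply: cvgB; [exact: expmx_cvg|exact: cvg_cst].
have cn : (fun N => `|series (ecoef X) N - (1 + X + 2^-1 *: X ^+ 2)|) @ \oo
          --> `|expmx X - (1 + X + 2^-1 *: X ^+ 2)| by exact: cvg_norm.
rewrite -(cvg_lim (@Rhausdorff R) cn).
apply: limr_le; first by apply/cvg_ex; eexists; exact: cn.
exists 3%N => // -[//|[//|[//|N]]] _.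
rewrite series_ordE sum_split3 ecoef0 ecoef1 ecoef2.
rewrite [_ + _ - _]addrAC subrr add0r.
apply: le_trans (ler_norm_sum _ _ _) _.
apply: (@le_trans _ _ (\sum_(k < N) (9 * m ^+ 3) * (k.+1`!%:R)^-1)); last first.
  rewrite -mulr_sumr; have := ler_wpM2l (_ : 0 <= 9 * m ^+ 3) (invfact_sum N).
  by rewrite mulr_ge0 ?exprn_ge0 // => /(_ isT); lra.
apply: ler_sum => k _; rewrite /ecoef normrZ ger0_norm //.
rewrite mulrC ler_pM //.
  apply: le_trans (mxpow_norm _ (lexx m)) _.
  have -> : (3 * m) ^+ k.+2 * m = (9 * m ^+ 3) * (3 * m) ^+ k.
    by rewrite !exprS expr0; ring.
  by rewrite ler_piMr ?mulr_ge0 ?exprn_ge0 // exprn_ile1 ?mulr_ge0.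
rewrite lef_pV2 ?posrE ?ltr0n ?fact_gt0 // ler_nat.
by rewrite (factS k.+2) (factS k.+1) mulnA leq_pmull.
Qed.

End Exponential.

(** * The direction of a link in terms of its coordinate *)

Section VectorLimits.
Context {R : realType}.

Lemma cvg_dotv (T : Type) (F : set_system T) (FF : Filter F) k
    (f g : T -> 'cV[R]_k) (l m : 'cV[R]_k) :
  f @ F --> l -> g @ F --> m -> dotv (f x) (g x) @[x --> F] --> dotv l m.
Proof.
move=> fl gm; rewrite /dotv; apply: cvg_big => [|i _]; first exact: add_continuous.
by apply: cvgM; exact: cvg_entry.
Qed.

Lemma cvg_norm2 (T : Type) (F : set_system T) (FF : Filter F) k
    (f : T -> 'cV[R]_k) (l : 'cV[R]_k) :
  f @ F --> l -> norm2 (f x) @[x --> F] --> norm2 l.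
Proof.
move=> fl; rewrite norm2E; under eq_fun do rewrite norm2E.
have h := @continuous_cvg _ _ _ F FF (fun x => dotv (f x) (f x)) Num.sqrt (dotv l l).
by apply: h; [exact: sqrt_continuous|exact: cvg_dotv].
Qed.

Lemma cvg_mulmx (T : Type) (F : set_system T) (FF : Filter F) k l
    (A : 'M[R]_(k, l)) (f : T -> 'cV[R]_l) (a : 'cV[R]_l) :
  f @ F --> a -> A *m f x @[x --> F] --> A *m a.
Proof.
move=> fa; apply: cvg_mx => i j; rewrite mxE; under eq_fun do rewrite mxE.
apply: cvg_big => [|m _]; first exact: add_continuous.
by apply: cvgM; [exact: cvg_cst|exact: cvg_entry].
Qed.

Lemma derive1_cvg (V : normedModType R) (f : R -> V) t : derivable f t 1 ->
  h^-1 *: (f (h + t) - f t) @[h --> 0^'] --> derive1 f t.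
Proof.
move=> df; rewrite derive1E; apply: cvg_trans (df).
apply: near_eq_cvg; near=> h; rewrite /= [h%:A]mulr1 //.
Unshelve. all: by end_near. Qed.

Lemma right_derive1_cvg (V : normedModType R) (f : R -> V) t : derivable f t 1 ->
  h^-1 *: (f (h + t) - f t) @[h --> 0^'+] --> derive1 f t.
Proof. by move=> /derive1_cvg; exact: cvg_dnbhs_at_right. Qed.

Lemma derivable_continuous (V : normedModType R) (f : R -> V) t :
  derivable f t 1 -> {for t, continuous f}.
Proof. by move=> /derivable1_diffP; exact: differentiable_continuous. Qed.

Lemma dnbhs_shift (t : R) : h + t @[h --> (0 : R)^'] --> t.
Proof.
rewrite -{2}[t]add0r; apply: cvgD; last exact: cvg_cst.
exact: cvg_within.
Qed.

Lemma continuous_cvg0 (V : normedModType R) (f : R -> V) t :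
  {for t, continuous f} -> f (h + t) @[h --> 0^'] --> f t.
Proof. by move=> ct; exact: cvg_comp (@dnbhs_shift t) ct. Qed.

End VectorLimits.

Section LinkDirection.
Context {R : realType}.
Implicit Types u v x y : 'cV[R]_3.

Lemma mxnorm_hat u : `|hat u| <= norm2 u.
Proof.
apply: mxnorm_le; first exact: norm2_ge0.
by apply: ord3P; apply: ord3P; rewrite !hatE ?normrN ?normr0 ?norm2_ge0 ?entry_le_norm2.
Qed.

Lemma hatB u v : hat (u - v) = hat u - hat v.
Proof.
apply/matrixP; apply: ord3P; apply: ord3P; rewrite [RHS]mxE [(- hat v) _ _]mxE !hatE ?mxE; ring.
Qed.

Lemma crossNhat u v : cross u v = - (hat v *m u).
Proof. by rewrite hat_mul; apply: vec3P; rewrite [RHS]mxE !crossE; ring. Qed.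

Lemma hat0 : hat (0 : 'cV[R]_3) = 0.
Proof. by rewrite -(subrr 0) hatB subrr. Qed.

Lemma norm2_mulmx_e3 (A : 'M[R]_3) : norm2 (A *m e3 R) <= 3 * `|A|.
Proof.
have e i : (A *m e3 R) i 0 = A i 2%:R.
  by rewrite mulmx3E !e3E; ring.
apply: le_trans (norm2_le_sum _) _; under eq_bigr do rewrite e.
apply: (@le_trans _ _ (\sum_(i < 3) `|A|)).
  by apply: ler_sum => i _; exact: entry_le_mxnorm.
by rewrite sumr_const card_ord mulr_natl.
Qed.

Lemma link_lipschitz x y m : norm2 x <= m -> norm2 y <= m -> 3 * m <= 1 ->
  norm2 (expmx (hat x) *m e3 R - expmx (hat y) *m e3 R - cross (x - y) (e3 R))
  <= 18 * m * norm2 (x - y).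
Proof.
move=> xm ym m1; have m0 : 0 <= m := le_trans (norm2_ge0 x) xm.
rewrite -hat_mul hatB -!mulmxBl; apply: le_trans (norm2_mulmx_e3 _) _.
have := expmx_lipschitz (le_trans (mxnorm_hat x) xm) (le_trans (mxnorm_hat y) ym) m1.
have := mxnorm_hat (x - y); rewrite hatB => h1 h2.
have := ler_wpM2l (mulr_ge0 (ler0n R 6) m0) h1; lra.
Qed.

Lemma expmx0 : expmx (0 : 'M[R]_3) = 1.
Proof.
have h : `|expmx 0 - (1 + 0 + 2^-1 *: 0 ^+ 2)| <= 18 * `|0 : 'M[R]_3| ^+ 3.
  by apply: expmx_quadratic; rewrite normr0 mulr0.
move: h; rewrite normr0 [0 ^+ 3]expr0n mulr0 normr_le0 subr_eq0 => /eqP ->.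
by rewrite expr0n /= scaler0 !addr0.
Qed.

Lemma link_direction x : 3 * norm2 x <= 1 ->
  norm2 (expmx (hat x) *m e3 R - e3 R - cross x (e3 R)) <= 18 * norm2 x ^+ 2.
Proof.
move=> x1; have := link_lipschitz (lexx _) (_ : norm2 0 <= norm2 x) x1.
rewrite norm2_0 norm2_ge0 hat0 expmx0 mul1mx subr0 => /(_ isT).
by rewrite expr2 mulrA.
Qed.

Lemma link_height x : 3 * norm2 x <= 1 -> dotv x (e3 R) = 0 ->
  `|1 - dotv (expmx (hat x) *m e3 R) (e3 R) - 2^-1 * dotv x x|
  <= 18 * norm2 x ^+ 3.
Proof.
move=> n1 xe3; have x2 : x 2%:R 0 = 0 by rewrite -xe3 dotv3E !e3E; ring.
have h := mxnorm_hat x; set X := hat x in h *.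
have hX : 3 * `|X| <= 1 by apply: le_trans n1; rewrite ler_pM2l.
have EX : (1 + X + 2^-1 *: X ^+ 2) 2%:R 2%:R = 1 - 2^-1 * dotv x x.
  have XX : (X ^+ 2) 2%:R 2%:R = - dotv x x.
    by rewrite expr2 -[X * X]/(X *m X) mxE sum3E /X !hatE dotv3E x2; ring.
  have I1 : (1 : 'M[R]_3) 2%:R 2%:R = 1 by rewrite mxE eqxx.
  have D (A C E : 'M[R]_3) i j :
    (A + C + 2^-1 *: E) i j = A i j + C i j + 2^-1 * E i j by rewrite !mxE.
  by rewrite D XX I1 /X !hatE; ring.
have -> : dotv (expmx X *m e3 R) (e3 R) = expmx X 2%:R 2%:R.
  by rewrite dotv3E !mulmx3E !e3E; ring.
apply: (@le_trans _ _ (18 * `|X| ^+ 3)); last first.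
  by rewrite ler_pM2l // lerXn2r // nnegrE ?normr_ge0 ?norm2_ge0.
apply: le_trans (expmx_quadratic hX).
apply: le_trans _ (entry_le_mxnorm _ 2%:R 2%:R).
have D (A C : 'M[R]_3) i j : (A - C) i j = A i j - C i j by rewrite !mxE.
rewrite D EX -normrN.
by rewrite le_eqVlt; apply/orP; left; apply/eqP; congr `|_|; ring.
Qed.

(** The Lipschitz bound passes to the limit of the difference quotients; only
    the right ones are needed. *)
Lemma link_velocity (x q : R -> 'cV[R]_3) (t : R) :
  derivable x t 1 -> derivable q t 1 -> 3 * norm2 (x t) < 1 ->
  (forall s, t <= s -> q s = expmx (hat (x s)) *m e3 R) ->
  norm2 (derive1 q t - cross (derive1 x t) (e3 R))
  <= 18 * norm2 (x t) * norm2 (derive1 x t).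
Proof.
move=> dx dq x1 qx.
(* a radius that contains x t and x (h + t) and tends to |x t| *)
pose m h := norm2 (x t) + norm2 (x (h + t) - x t).
have cx := derivable_continuous dx.
have cdx := right_derive1_cvg dx; have cdq := right_derive1_cvg dq.
have c0 : norm2 (x (h + t) - x t) @[h --> 0^'+] --> (0 : R).
  have : norm2 (x (h + t) - x t) @[h --> 0^'+] --> norm2 (x t - x t).
    apply: cvg_norm2; apply: cvgB; last exact: cvg_cst.
    exact: cvg_dnbhs_at_right (continuous_cvg0 cx).
  by rewrite subrr norm2_0.
have cm : m h @[h --> 0^'+] --> norm2 (x t).
  have : m h @[h --> 0^'+] --> norm2 (x t) + 0 by apply: cvgD => //; exact: cvg_cst.
  by rewrite addr0.
have ccross : (fun h => cross (h^-1 *: (x (h + t) - x t)) (e3 R)) @ 0^'+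
    --> cross (derive1 x t) (e3 R).
  rewrite crossNhat; under eq_fun do rewrite crossNhat.
  by apply: cvgN; apply: cvg_mulmx; exact: cdx.
have cl : norm2 (h^-1 *: (q (h + t) - q t)
                 - cross (h^-1 *: (x (h + t) - x t)) (e3 R)) @[h --> 0^'+]
    --> norm2 (derive1 q t - cross (derive1 x t) (e3 R)).
  by apply: cvg_norm2; apply: cvgB; [exact: cdq|exact: ccross].
have cr : 18 * m h * norm2 (h^-1 *: (x (h + t) - x t)) @[h --> 0^'+]
    --> 18 * norm2 (x t) * norm2 (derive1 x t).
  apply: cvgM; first by apply: cvgM => //; exact: cvg_cst.
  by apply: cvg_norm2; exact: cdx.
rewrite -(cvg_lim (@Rhausdorff R) cl) -(cvg_lim (@Rhausdorff R) cr).
apply: ler_lim; [by apply/cvg_ex; eexists; exact: cl|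
  by apply/cvg_ex; eexists; exact: cr|].
have m3 : 3 * m h @[h --> 0^'+] --> 3 * norm2 (x t).
  by apply: cvgM => //; exact: cvg_cst.
near=> h.
have h0 : 0 < h by near: h; exact: nbhs_right_gt.
have mh : 3 * m h <= 1.
  by near: h; by apply: (cvgr_le _ m3).
have qh : q (h + t) = expmx (hat (x (h + t))) *m e3 R.
  by apply: qx; rewrite lerDr ltW.
have qt : q t = expmx (hat (x t)) *m e3 R := qx t (lexx t).
have -> : h^-1 *: (q (h + t) - q t) - cross (h^-1 *: (x (h + t) - x t)) (e3 R)
   = h^-1 *: (q (h + t) - q t - cross (x (h + t) - x t) (e3 R)).
  rewrite [RHS]scalerBr; congr (_ - _).
  by rewrite !crossNhat scalerN scalemxAr.
rewrite !norm2Z mulrCA ler_pM2l ?normr_gt0 ?invr_eq0 ?gt_eqF // qh qt.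
apply: link_lipschitz => //.
  by rewrite -[X in norm2 X](subrK (x t)) addrC norm2D.
by rewrite lerDl norm2_ge0.
Unshelve. all: by end_near. Qed.

Lemma right_derive_orth (x : R -> 'cV[R]_3) (a : 'cV[R]_3) (t : R) :
  derivable x t 1 -> (forall s, t <= s -> dotv (x s) a = 0) ->
  dotv (derive1 x t) a = 0.
Proof.
move=> dx xa.
have c : dotv (h^-1 *: (x (h + t) - x t)) a @[h --> 0^'+] --> dotv (derive1 x t) a.
  by apply: cvg_dotv; [exact: right_derive1_cvg|exact: cvg_cst].
have z : dotv (h^-1 *: (x (h + t) - x t)) a @[h --> 0^'+] --> (0 : R).
  apply: (@cvg_trans _ (0 @[h --> (0 : R)^'+])); last exact: cvg_cst.
  apply: near_eq_cvg; near=> h; rewrite dotvZl dotvBl !xa ?subrr ?mulr0 //.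
  by rewrite lerDr ltW //; near: h; exact: nbhs_right_gt.
by rewrite -(cvg_lim (@Rhausdorff R) c) (cvg_lim (@Rhausdorff R) z).
Unshelve. all: by end_near. Qed.

End LinkDirection.

(** * Energy and momentum near the hanging configuration *)

Section BigO.
Context {R : realType} (T : Type) (D : T -> Prop) (r : T -> R).
Hypothesis r01 : forall d, D d -> 0 <= r d <= 1.

(** Estimates that are uniform over the configurations d in D, with r d as the
    size of d; a pointwise form is needed because they are used along trajectories,
    not in a limit. *)
Definition isO k (f : T -> R) : Prop :=
  exists2 C, 0 <= C & forall d, D d -> `|f d| <= C * r d ^+ k.

Definition isOv k m (f : T -> 'cV[R]_m) : Prop := isO k (fun d => norm2 (f d)).

Let r0 d : D d -> 0 <= r d. Proof. by move=> /r01/andP[]. Qed.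

Lemma isO_le k f g : (forall d, D d -> `|f d| <= `|g d|) -> isO k g -> isO k f.
Proof. by move=> fg [C C0 h]; exists C => // d Dd; exact: le_trans (fg d Dd) (h d Dd). Qed.

Lemma isO_weaken j k f : (j <= k)%N -> isO k f -> isO j f.
Proof.
move=> jk [C C0 h]; exists C => // d Dd; apply: le_trans (h d Dd) _.
by have /andP[a b] := r01 Dd; rewrite ler_wpM2l // ler_wiXn2l.
Qed.

Lemma isOD k f g : isO k f -> isO k g -> isO k (fun d => f d + g d).
Proof.
move=> [C C0 h] [C' C'0 h']; exists (C + C'); first exact: addr_ge0.
move=> d Dd; apply: le_trans (ler_normD _ _) _; rewrite mulrDl.
by rewrite lerD ?h ?h'.
Qed.

Lemma isOM j k f g : isO j f -> isO k g -> isO (j + k) (fun d => f d * g d).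
Proof.
move=> [C C0 h] [C' C'0 h']; exists (C * C'); first exact: mulr_ge0.
move=> d Dd; rewrite normrM exprD mulrACA.
by rewrite ler_pM // ?h ?h'.
Qed.

Lemma isOZ k a f : isO k f -> isO k (fun d => a * f d).
Proof.
move=> [C C0 h]; exists (`|a| * C); first exact: mulr_ge0.
by move=> d Dd; rewrite normrM -mulrA ler_wpM2l // h.
Qed.

Lemma isO_sum k (I : finType) (f : I -> T -> R) :
  (forall i, isO k (f i)) -> isO k (fun d => \sum_i f i d).
Proof.
move=> h; have /cid2[C C0 hC] : exists2 C : I -> R, (forall i, 0 <= C i) &
    forall i d, D d -> `|f i d| <= C i * r d ^+ k.
  pose C i := projT1 (cid2 (h i)); exists C => [i|i]; rewrite /C; case: cid2 => //.
exists (\sum_i C i); first by apply: sumr_ge0.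
move=> d Dd; apply: le_trans (ler_norm_sum _ _ _) _; rewrite mulr_suml.
by apply: ler_sum => i _; exact: hC.
Qed.

Lemma isOv_eq k m (f g : T -> 'cV[R]_m) :
  (forall d, D d -> f d = g d) -> isOv k g -> isOv k f.
Proof. by move=> fg; apply: isO_le => d Dd; rewrite fg. Qed.

Lemma isO_eq k f g : (forall d, D d -> f d = g d) -> isO k g -> isO k f.
Proof. by move=> fg; apply: isO_le => d Dd; rewrite fg. Qed.

Lemma isOvD k m (f g : T -> 'cV[R]_m) :
  isOv k f -> isOv k g -> isOv k (fun d => f d + g d).
Proof.
move=> hf hg; apply: isO_le (isOD hf hg) => d _.
by rewrite !ger0_norm ?addr_ge0 ?norm2_ge0 // norm2D.
Qed.

Lemma isOv_sum k m (I : finType) (f : I -> T -> 'cV[R]_m) :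
  (forall i, isOv k (f i)) -> isOv k (fun d => \sum_i f i d).
Proof.
move=> hf; apply: isO_le (isO_sum hf) => d _.
rewrite !ger0_norm ?norm2_ge0 ?norm2_sum // sumr_ge0 // => i _.
exact: norm2_ge0.
Qed.

Lemma isOvZ k m a (f : T -> 'cV[R]_m) :
  isOv k f -> isOv k (fun d => a *: f d).
Proof.
move=> hf; apply: isO_le (isOZ `|a| hf) => d _.
by rewrite norm2Z.
Qed.

Lemma isOv_mulmx k m l (A : 'M[R]_(l, m)) (f : T -> 'cV[R]_m) :
  isOv k f -> isOv k (fun d => A *m f d).
Proof.
have [C C0 h] := mulmx_norm2_bounded A => hf; apply: isO_le (isOZ C hf) => d _.
by rewrite !ger0_norm ?mulr_ge0 ?norm2_ge0.
Qed.

Lemma isO_dotv j k m (f g : T -> 'cV[R]_m) :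
  isOv j f -> isOv k g -> isO (j + k) (fun d => dotv (f d) (g d)).
Proof.
move=> hf hg; apply: isO_le (isOM hf hg) => d _.
by rewrite [leRHS]ger0_norm ?mulr_ge0 ?norm2_ge0 // abs_dotv_le.
Qed.

Lemma isOv_cross j k (f g : T -> 'cV[R]_3) :
  isOv j f -> isOv k g -> isOv (j + k) (fun d => cross (f d) (g d)).
Proof.
move=> hf hg; apply: isO_le (isOM hf hg) => d _.
by rewrite !ger0_norm ?mulr_ge0 ?norm2_ge0 // norm2_cross.
Qed.

Lemma isOv_mkv k n (x : T -> 'cV[R]_3) (w : T -> 'I_n -> 'cV[R]_2) :
  isOv k x -> (forall i, isOv k (fun d => w d i)) -> isOv k (fun d => mkv (x d) (w d)).
Proof.
move=> hx hw; apply: isO_le (isOD hx (isO_sum hw)) => d _.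
rewrite !ger0_norm ?addr_ge0 ?norm2_ge0 ?norm2_mkv // sumr_ge0 // => i _.
exact: norm2_ge0.
Qed.

End BigO.

Section Mechanics.
Context {R : realType} (n : nat) (pl : plant R n).

(** The generalized momenta of the exact nonlinear system: that of link i before
    it is projected orthogonally to the link, and that of the quadrotor. *)
Definition link_mom (v : 'cV[R]_3) (dq : 'I_n -> 'cV[R]_3) i : 'cV[R]_3 :=
  M0 pl i *: v + \sum_j Mq pl i j *: dq j.

Definition base_mom (v : 'cV[R]_3) (dq : 'I_n -> 'cV[R]_3) : 'cV[R]_3 :=
  M00 pl *: v + \sum_i M0 pl i *: dq i.

(** The horizontal part of q_i x link_mom i corresponds to the coordinate xi_i, so
    that momentum extends Mlin *m (x', xi') to the nonlinear system. *)
Definition momentum v (q dq : 'I_n -> 'cV[R]_3) : 'cV[R]_(dimx n) :=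
  mkv (base_mom v dq)
      (fun i => (C32 R)^T *m cross (q i) (link_mom v dq i)).

(** Twice the sum of the kinetic energy and of the potential energy of the links
    below the quadrotor, without the part of gravity that acts on the total mass. *)
Definition energy v (q dq : 'I_n -> 'cV[R]_3) : R :=
  dotv v (base_mom v dq) + \sum_i dotv (dq i) (link_mom v dq i)
  + \sum_i 2 * Gq pl i * (1 - dotv (q i) (e3 R)).

(** The derivative of momentum when F is the net external force. *)
Definition momentum_rate F v (q dq : 'I_n -> 'cV[R]_3) : 'cV[R]_(dimx n) :=
  mkv F (fun i => (C32 R)^T *m (cross (dq i) (link_mom v dq i)
                                + Gq pl i *: cross (q i) (e3 R))).

Definition lin (x : 'cV[R]_3) (xi : 'I_n -> 'cV[R]_3) : 'cV[R]_(dimx n) :=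
  mkv x (fun i => (C32 R)^T *m xi i).

Lemma norm2_lin (x : 'cV[R]_3) (xi : 'I_n -> 'cV[R]_3) i :
  dotv (xi i) (e3 R) = 0 -> norm2 (xi i) <= norm2 (lin x xi).
Proof.
rewrite dotv3E !e3E => h; have x2 : xi i 2%:R 0 = 0 by rewrite -h; ring.
rewrite norm2_le_sqr ?norm2_ge0 // norm2_sqr /lin dotv_mkv (bigD1 i) //=.
have -> : dotv ((C32 R)^T *m xi i) ((C32 R)^T *m xi i) = dotv (xi i) (xi i).
  rewrite /dotv sum2E sum3E x2 !mulmx3E ![(C32 R)^T _ _]mxE !C32E; ring.
rewrite addrCA lerDl addr_ge0 ?dotvv_ge0 // sumr_ge0 // => j _; exact: dotvv_ge0.
Qed.

Lemma momentum_sym (v a : 'cV[R]_3) (d b : 'I_n -> 'cV[R]_3) :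
  dotv a (base_mom v d) + \sum_i dotv (b i) (link_mom v d i)
  = dotv v (base_mom a b) + \sum_i dotv (d i) (link_mom a b i).
Proof.
have E (w : 'cV[R]_3) (f : 'I_n -> 'cV[R]_3) x (g : 'I_n -> 'cV[R]_3) :
    dotv x (base_mom w f) + \sum_i dotv (g i) (link_mom w f i)
    = M00 pl * dotv x w + \sum_i M0 pl i * dotv x (f i)
      + (\sum_i M0 pl i * dotv (g i) w
         + \sum_i \sum_j Mq pl i j * dotv (g i) (f j)).
  rewrite /base_mom dotvDr dotvZr dotv_sumr -big_split /=; congr (_ + _ + _).
    by apply: eq_bigr => i _; rewrite dotvZr.
  apply: eq_bigr => i _; rewrite /link_mom dotvDr dotvZr dotv_sumr.
  by congr (_ + _); apply: eq_bigr => j _; rewrite dotvZr.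
rewrite !E (dotvC a v).
have -> : \sum_i \sum_j Mq pl i j * dotv (b i) (d j)
   = \sum_i \sum_j Mq pl i j * dotv (d i) (b j).
  rewrite exchange_big /=; apply: eq_bigr => i _; apply: eq_bigr => j _.
  by rewrite dotvC; congr (_ * _); rewrite /Mq maxnC mulrAC.
have sw (x : 'cV[R]_3) (f : 'I_n -> 'cV[R]_3) :
    \sum_i M0 pl i * dotv (f i) x = \sum_i M0 pl i * dotv x (f i).
  by apply: eq_bigr => i _; rewrite dotvC.
by rewrite !sw; ring.
Qed.

(** A position and velocity of the system together with a bound c_size on its
    linearized coordinates. The directions q_i and their velocities are fields of
    their own, tied to the coordinates only by the estimates in config_ok. *)
Record config := Config {
  c_x : 'cV[R]_3; c_v : 'cV[R]_3;
  c_xi : 'I_n -> 'cV[R]_3; c_dxi : 'I_n -> 'cV[R]_3;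
  c_q : 'I_n -> 'cV[R]_3; c_dq : 'I_n -> 'cV[R]_3;
  c_size : R }.

Definition config_ok (d : config) : Prop :=
  let r := c_size d in
  [/\ 0 <= r <= 1, norm2 (c_x d) <= r /\ norm2 (c_v d) <= r,
    (forall i, norm2 (c_xi d i) <= r /\ norm2 (c_dxi d i) <= r),
    (forall i, dotv (c_xi d i) (e3 R) = 0 /\ dotv (c_dxi d i) (e3 R) = 0)
  & (forall i,
      [/\ norm2 (c_q d i - e3 R - cross (c_xi d i) (e3 R)) <= 18 * r ^+ 2,
          norm2 (c_dq d i - cross (c_dxi d i) (e3 R)) <= 18 * r ^+ 2
        & `|1 - dotv (c_q d i) (e3 R) - 2^-1 * dotv (c_xi d i) (c_xi d i)|
          <= 18 * r ^+ 3])].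

Local Notation O := (isO config_ok c_size).
Local Notation Ov := (isOv config_ok c_size).

Let r01 d : config_ok d -> 0 <= c_size d <= 1. Proof. by case. Qed.

Lemma tilt_trE : (@tilt R)^T = (C32 R)^T *m hat (e3 R).
Proof.
apply/matrixP; apply: ord2P; apply: ord3P;
rewrite [LHS]mxE tiltE mxE sum3E ![(C32 R)^T _ _]mxE !C32E !hatE !e3E; ring.
Qed.

Lemma tilt_C32 (u : 'cV[R]_3) : dotv u (e3 R) = 0 ->
  @tilt R *m ((C32 R)^T *m u) = cross u (e3 R).
Proof.
rewrite dotv3E !e3E => h; have u2 : u 2%:R 0 = 0 by rewrite -h; ring.
by apply: vec3P; rewrite mxE sum2E !mulmx3E ![(C32 R)^T _ _]mxE !C32E !tiltE
  !crossE !e3E u2; ring.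
Qed.

Lemma cross_e3_remainder (q u : 'cV[R]_3) : dotv u (e3 R) = 0 ->
  cross q (e3 R) + u = cross (q - e3 R - cross u (e3 R)) (e3 R).
Proof.
rewrite dotv3E !e3E => h; have u2 : u 2%:R 0 = 0 by rewrite -h; ring.
have E (a b c : 'cV[R]_3) i : (a - b - c) i 0 = a i 0 - b i 0 - c i 0.
  by rewrite !mxE.
by apply: vec3P; rewrite [LHS]mxE !crossE !E !crossE !e3E ?u2; ring.
Qed.

Let p (d : config) i := cross (c_dxi d i) (e3 R).

Let O_of (f : config -> R) k (C : R) : 0 <= C ->
  (forall d, config_ok d -> `|f d| <= C * c_size d ^+ k) -> O k f.
Proof. by move=> C0 h; exists C. Qed.

Let Ov_x : Ov 1 c_x.
Proof.
by apply: (O_of ler01) => d [_ [h _] _ _ _]; rewrite ger0_norm ?norm2_ge0 // mul1r.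
Qed.

Let Ov_v : Ov 1 c_v.
Proof.
by apply: (O_of ler01) => d [_ [_ h] _ _ _]; rewrite ger0_norm ?norm2_ge0 // mul1r.
Qed.

Let Ov_xi i : Ov 1 (fun d => c_xi d i).
Proof.
apply: (O_of ler01) => d [_ _ h _ _]; rewrite ger0_norm ?norm2_ge0 // mul1r.
by case: (h i).
Qed.

Let Ov_dxi i : Ov 1 (fun d => c_dxi d i).
Proof.
apply: (O_of ler01) => d [_ _ h _ _]; rewrite ger0_norm ?norm2_ge0 // mul1r.
by case: (h i).
Qed.

Let Ov_q2 i : Ov 2 (fun d => c_q d i - e3 R - cross (c_xi d i) (e3 R)).
Proof.
apply: (@O_of _ _ 18) => // d [_ _ _ _ h]; rewrite ger0_norm ?norm2_ge0 //.
by case: (h i).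
Qed.

Let Ov_dq2 i : Ov 2 (fun d => c_dq d i - p d i).
Proof.
apply: (@O_of _ _ 18) => // d [_ _ _ _ h]; rewrite ger0_norm ?norm2_ge0 //.
by case: (h i).
Qed.

Let Ov_e3 k (f : config -> 'cV[R]_3) : Ov k f -> Ov k (fun d => cross (f d) (e3 R)).
Proof.
move=> h; have h0 : Ov 0 (fun=> e3 R).
  exists (norm2 (e3 R)); first exact: norm2_ge0.
  by move=> d _; rewrite mulr1 ger0_norm ?norm2_ge0.
by have := isOv_cross h h0; rewrite addn0.
Qed.

Let Ov_p i : Ov 1 (fun d => p d i). Proof. exact: Ov_e3. Qed.

Let Ov_q1 i : Ov 1 (fun d => c_q d i - e3 R).
Proof.
apply: (isOv_eq (g := fun d =>
  (c_q d i - e3 R - cross (c_xi d i) (e3 R)) + cross (c_xi d i) (e3 R))).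
  by move=> d _; rewrite subrK.
apply: isOvD; last exact: Ov_e3.
exact: (isO_weaken r01 _ (Ov_q2 i)).
Qed.

Let Ov_dq i : Ov 1 (fun d => c_dq d i).
Proof.
apply: (isOv_eq (g := fun d => (c_dq d i - p d i) + p d i)).
  by move=> d _; rewrite subrK.
apply: isOvD => //; exact: (isO_weaken r01 _ (Ov_dq2 i)).
Qed.

Let lam d i := link_mom (c_v d) (c_dq d) i.
Let lamp d i := link_mom (c_v d) (p d) i.

Let Ov_lam i : Ov 1 (fun d => lam d i).
Proof.
apply: isOvD; first exact: isOvZ.
by apply: isOv_sum => j; apply: isOvZ.
Qed.

Let Ov_lamp i : Ov 2 (fun d => lam d i - lamp d i).
Proof.
apply: (isOv_eq (g := fun d => \sum_j Mq pl i j *: (c_dq d j - p d j))).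
  move=> d _; rewrite /lam /lamp /link_mom opprD addrACA subrr add0r -sumrB.
  by apply: eq_bigr => j _; rewrite scalerBr.
by apply: isOv_sum => j; apply: isOvZ.
Qed.

Let base_diff d : base_mom (c_v d) (c_dq d) - base_mom (c_v d) (p d)
  = \sum_i M0 pl i *: (c_dq d i - p d i).
Proof.
rewrite /base_mom opprD addrACA subrr add0r -sumrB.
by apply: eq_bigr => j _; rewrite scalerBr.
Qed.

Let Mlin_lin d : config_ok d -> Mlin pl *m lin (c_v d) (c_dxi d) =
  mkv (base_mom (c_v d) (p d))
      (fun i => (C32 R)^T *m cross (e3 R) (lamp d i)).
Proof.
move=> [_ _ _ h _]; rewrite /lin Mlin_mkv /mkv.
have pE i : @tilt R *m ((C32 R)^T *m c_dxi d i) = p d i.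
  by apply: tilt_C32; case: (h i).
have qE i : (C32 R)^T *m c_dxi d i = (C32 R)^T *m cross (e3 R) (p d i).
  by rewrite -pE -hat_mul !mulmxA -tilt_trE tilt_orth mul1mx.
congr col_mx; first by congr (_ + _); apply: eq_bigr => i _; rewrite pE.
apply: eq_mxcol => i; rewrite /lamp /link_mom crossDr mulmxDr tilt_trE.
rewrite crossZr -hat_mul -mulmxA scalemxAr; congr (_ + _).
rewrite -hat_mul !mulmx_sumr; apply: eq_bigr => j _.
by rewrite qE -hat_mul -!scalemxAr.
Qed.

(** A link differs from its linearization by second order terms only, and the
    momentum is linear in the velocities. *)
Lemma momentum_linear :
  Ov 2 (fun d => momentum (c_v d) (c_q d) (c_dq d) - Mlin pl *m lin (c_v d) (c_dxi d)).
Proof.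
apply: (isOv_eq (g := fun d => mkv (\sum_i M0 pl i *: (c_dq d i - p d i))
  (fun i => (C32 R)^T *m (cross (c_q d i - e3 R) (lam d i)
                         + cross (e3 R) (lam d i - lamp d i))))).
  move=> d ok; rewrite (Mlin_lin ok) -scaleN1r mkvZ /momentum mkvD scaleN1r base_diff.
  rewrite /mkv; congr col_mx; apply: eq_mxcol => i.
  rewrite scaleN1r -mulmxBr; congr (_ *m _).
  rewrite crossDl crossDr crossNl crossNr -/(lam d i); apply/matrixP => a b.
  by rewrite !mxE; ring.
apply: isOv_mkv => [|i]; first by apply: isOv_sum => i; apply: isOvZ.
apply: isOv_mulmx; apply: isOvD; first exact: (isOv_cross (j := 1) (k := 1)).
apply: (isOv_eq (g := fun d => - 1 *: cross (lam d i - lamp d i) (e3 R))).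
  by move=> d _; rewrite crossC scaleN1r.
by apply: isOvZ; exact: Ov_e3.
Qed.

Lemma momentum_rate_linear (F : config -> 'cV[R]_3) :
  Ov 2 (fun d => momentum_rate (F d) (c_v d) (c_q d) (c_dq d)
                 - (mkv (F d + c_x d) (fun=> 0) - stiffness pl *m lin (c_x d) (c_xi d))).
Proof.
apply: (isOv_eq (g := fun d => mkv 0 (fun i => (C32 R)^T *m
   (cross (c_dq d i) (lam d i)
    + Gq pl i *: cross (c_q d i - e3 R - cross (c_xi d i) (e3 R)) (e3 R))))).
  move=> d [_ _ _ h _]; rewrite /lin stiffness_mkv.
  rewrite -[X in - (_ + X)]scaleN1r mkvZ mkvD -[X in _ + X]scaleN1r mkvZ mkvD.
  rewrite !scaleN1r addrK subrr /mkv; congr col_mx; apply: eq_mxcol => i.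
  rewrite add0r !scaleN1r opprK -/(lam d i) !mulmxDr -addrA; congr (_ + _).
  rewrite -!scalemxAr -scalerDr -mulmxDr; congr (_ *: (_ *m _)).
  by apply: cross_e3_remainder; case: (h i).
apply: isOv_mkv => [|i].
  by exists 0 => // d _; rewrite norm2_0 normr0 mul0r.
apply: isOv_mulmx; apply: isOvD; first exact: (isOv_cross (j := 1) (k := 1)).
by apply: isOvZ; exact: Ov_e3.
Qed.

Lemma energy_quadratic :
  O 3 (fun d => energy (c_v d) (c_q d) (c_dq d) + dotv (c_x d) (c_x d)
     - (dotv (lin (c_v d) (c_dxi d)) (Mlin pl *m lin (c_v d) (c_dxi d))
        + dotv (lin (c_x d) (c_xi d)) (stiffness pl *m lin (c_x d) (c_xi d)))).
Proof.
apply: (isO_eq (g := fun d =>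
  dotv (c_v d) (\sum_i M0 pl i *: (c_dq d i - p d i))
  + \sum_i (dotv (c_dq d i - p d i) (lam d i) + dotv (p d i) (lam d i - lamp d i))
  + \sum_i 2 * Gq pl i * (1 - dotv (c_q d i) (e3 R)
                          - 2^-1 * dotv (c_xi d i) (c_xi d i)))).
  move=> d ok; have [_ _ _ h _] := ok.
  rewrite (Mlin_lin ok) /lin stiffness_mkv !dotv_mkv -base_diff.
  have e1 i : dotv ((C32 R)^T *m c_dxi d i) ((C32 R)^T *m cross (e3 R) (lamp d i))
            = dotv (p d i) (lamp d i).
    rewrite -hat_mul mulmxA -tilt_trE [LHS]dotv_mulmx trmxK tilt_C32 //.
    by case: (h i).
  have e2 i : dotv ((C32 R)^T *m c_xi d i) (Gq pl i *: ((C32 R)^T *m c_xi d i))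
            = Gq pl i * dotv (c_xi d i) (c_xi d i).
    have [+ _] := h i; rewrite dotv3E !e3E => h2.
    have x2 : c_xi d i 2%:R 0 = 0 by rewrite -h2; ring.
    rewrite dotvZr; congr (_ * _); rewrite /dotv sum2E sum3E x2.
    by rewrite !mulmx3E ![(C32 R)^T _ _]mxE !C32E; ring.
  under eq_bigr do rewrite e1.
  under [X in _ + (_ + X)]eq_bigr do rewrite e2.
  rewrite dotvBr (_ : \sum_i (_ + _) = \sum_i dotv (c_dq d i) (lam d i)
      - \sum_i dotv (p d i) (lamp d i)); last first.
    by rewrite -sumrB; apply: eq_bigr => i _; rewrite dotvBl dotvBr addrA subrK.
  rewrite (_ : \sum_i 2 * Gq pl i * (_ - _) =
      \sum_i 2 * Gq pl i * (1 - dotv (c_q d i) (e3 R))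
      - \sum_i Gq pl i * dotv (c_xi d i) (c_xi d i)); last first.
    by rewrite -sumrB; apply: eq_bigr => i _; field.
  by rewrite /energy; ring.
apply: isOD; first apply: isOD.
- apply: (isO_dotv (j := 1) (k := 2)) => //.
  by apply: isOv_sum => i; apply: isOvZ.
- apply: isO_sum => i; apply: isOD.
    exact: (isO_dotv (j := 2) (k := 1)).
  exact: (isO_dotv (j := 1) (k := 2)).
- apply: isO_sum => i; apply: isOZ.
  by exists 18 => // d [_ _ _ _ h]; case: (h i).
Qed.

Let Ov_s : Ov 1 (fun d => lin (c_x d) (c_xi d)).
Proof. by apply: isOv_mkv => // i; apply: isOv_mulmx. Qed.

Let Ov_ds : Ov 1 (fun d => lin (c_v d) (c_dxi d)).
Proof. by apply: isOv_mkv => // i; apply: isOv_mulmx. Qed.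

Lemma base_mom_bounded : Ov 1 (fun d => base_mom (c_v d) (c_dq d)).
Proof.
by apply: isOvD; [exact: isOvZ|apply: isOv_sum => i; exact: isOvZ].
Qed.

Section Lyapunov.
Variable W : 'M[R]_(dimx n).

(** The Lyapunov function of the linear system, with the exact energy and the
    exact momentum in place of their linearizations; its derivative is then known
    exactly as a function of the force. *)
Definition mech_fun x v xi (q dq : 'I_n -> 'cV[R]_3) : R :=
  energy v q dq + dotv x x + 2 * dotv (W *m lin x xi) (momentum v q dq).

(** The value of the time derivative of mech_fun when the quadrotor is driven by
    the PD feedback - x - v and an additional force F. *)
Definition mech_rate F x v xi dxi (q dq : 'I_n -> 'cV[R]_3) : R :=
  2 * dotv v (F - x - v) + 2 * dotv x v
  + 2 * dotv (W *m lin v dxi) (momentum v q dq)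
  + 2 * dotv (W *m lin x xi) (momentum_rate (F - x - v) v q dq).

Let quad s ds : R :=
  dotv s (stiffness pl *m s) + 2 * dotv (W *m s) (Mlin pl *m ds)
  + dotv ds (Mlin pl *m ds).

Let mech_fun_quad : O 3 (fun d =>
  mech_fun (c_x d) (c_v d) (c_xi d) (c_q d) (c_dq d)
  - quad (lin (c_x d) (c_xi d)) (lin (c_v d) (c_dxi d))).
Proof.
have h : O 3 (fun d => 2 * dotv (W *m lin (c_x d) (c_xi d))
   (momentum (c_v d) (c_q d) (c_dq d) - Mlin pl *m lin (c_v d) (c_dxi d))).
  apply: isOZ; apply: (isO_dotv (j := 1) (k := 2)); last exact: momentum_linear.
  exact: isOv_mulmx.
apply: isO_eq (isOD energy_quadratic h) => d _.
by rewrite /mech_fun /quad dotvBr; ring.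
Qed.

Lemma mech_fun_lower r : (forall s v : 'cV[R]_(dimx n),
    r * (dotv s s + dotv v v) <= quad s v) ->
  exists2 C, 0 <= C & forall d, config_ok d ->
    r * (dotv (lin (c_x d) (c_xi d)) (lin (c_x d) (c_xi d))
         + dotv (lin (c_v d) (c_dxi d)) (lin (c_v d) (c_dxi d)))
    - C * c_size d ^+ 3 <= mech_fun (c_x d) (c_v d) (c_xi d) (c_q d) (c_dq d).
Proof.
move=> hr; have [C C0 h] := mech_fun_quad; exists C => // d ok.
have := h d ok; rewrite ler_norml => /andP[+ _].
by have := hr (lin (c_x d) (c_xi d)) (lin (c_v d) (c_dxi d)); lra.
Qed.

Lemma mech_fun_upper : O 2 (fun d =>
  mech_fun (c_x d) (c_v d) (c_xi d) (c_q d) (c_dq d)).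
Proof.
have h : O 2 (fun d => quad (lin (c_x d) (c_xi d)) (lin (c_v d) (c_dxi d))).
  apply: isOD; first apply: isOD.
  - by apply: (isO_dotv (j := 1) (k := 1)) => //; exact: isOv_mulmx.
  - by apply: isOZ; apply: (isO_dotv (j := 1) (k := 1)); exact: isOv_mulmx.
  - by apply: (isO_dotv (j := 1) (k := 1)) => //; exact: isOv_mulmx.
apply: isO_eq (isOD (isO_weaken r01 _ mech_fun_quad) h) => // d _.
by rewrite subrK.
Qed.

(** Up to cubic terms the derivative is that of the quadratic Lyapunov function
    of the linear system; F only acts on the momentum of the quadrotor, so that
    it enters exactly linearly. *)
Lemma mech_rate_upper q : (forall s v : 'cV[R]_(dimx n),
    q * (dotv s s + dotv v v) <=
      2 * dotv (topv v) (topv v) - 2 * dotv (W *m v) (Mlin pl *m v)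
      + 2 * dotv (W *m s) (stiffness pl *m s + Blin R n *m topv v)) ->
  exists2 C, 0 <= C & forall d F, config_ok d ->
    mech_rate F (c_x d) (c_v d) (c_xi d) (c_dxi d) (c_q d) (c_dq d) <=
    - (q * (dotv (lin (c_x d) (c_xi d)) (lin (c_x d) (c_xi d))
         + dotv (lin (c_v d) (c_dxi d)) (lin (c_v d) (c_dxi d))))
    + C * c_size d ^+ 3
    + 2 * dotv (c_v d + topv (W *m lin (c_x d) (c_xi d))) F.
Proof.
move=> hq.
have h1 : O 3 (fun d => 2 * dotv (W *m lin (c_v d) (c_dxi d))
   (momentum (c_v d) (c_q d) (c_dq d) - Mlin pl *m lin (c_v d) (c_dxi d))).
  apply: isOZ; apply: (isO_dotv (j := 1) (k := 2)); last exact: momentum_linear.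
  exact: isOv_mulmx.
have h2 : O 3 (fun d => 2 * dotv (W *m lin (c_x d) (c_xi d))
   (momentum_rate 0 (c_v d) (c_q d) (c_dq d)
     - (mkv (0 + c_x d) (fun=> 0) - stiffness pl *m lin (c_x d) (c_xi d)))).
  apply: isOZ; apply: (isO_dotv (j := 1) (k := 2)); first exact: isOv_mulmx.
  exact: (momentum_rate_linear (fun=> 0)).
have [C C0 h] := isOD h1 h2; exists C => // d F ok.
have := h d ok; rewrite ler_norml => /andP[_ +].
set s := lin (c_x d) _; set ds := lin (c_v d) _ => hc.
have := hq s ds; have -> : topv ds = c_v d by rewrite topv_mkv.
have -> : topv (W *m s) = (Blin R n)^T *m (W *m s) by rewrite trBlin_mkv.
rewrite /mech_rate -/s -/ds.
have -> : momentum_rate (F - c_x d - c_v d) (c_v d) (c_q d) (c_dq d)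
   = momentum_rate 0 (c_v d) (c_q d) (c_dq d) + Blin R n *m (F - c_x d - c_v d).
  rewrite Blin_mkv /momentum_rate mkvD add0r /mkv; congr col_mx.
  by apply: eq_mxcol => i; rewrite addr0.
move: hc; rewrite -Blin_mkv add0r !(mulmxDr, mulmxN) !(dotvDr, dotvDl, dotvBr, dotvBl, dotvNr).
have E u : dotv ((Blin R n)^T *m (W *m s)) u = dotv (W *m s) (Blin R n *m u).
  by rewrite [RHS]dotv_mulmx.
by rewrite !E (dotvC (c_x d) (c_v d)); lra.
Qed.

End Lyapunov.
End Mechanics.

(** * Rotation errors *)

Section Rotations.
Context {R : realType}.
Implicit Types (A : 'M[R]_3) (u v w : 'cV[R]_3).

Lemma det2E (A : 'M[R]_2) : \det A = A 0 0 * A 1 1 - A 0 1 * A 1 0.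
Proof.
rewrite (expand_det_row _ 0) sum2E /cofactor !det_mx11 !mxE /=.
have -> : lift 0 0 = 1 :> 'I_2 by apply: val_inj.
have -> : lift 1 0 = 0 :> 'I_2 by apply: val_inj.
by rewrite expr0 expr1; ring.
Qed.

Lemma det3E A : \det A =
  A 0 0 * (A 1 1 * A 2%:R 2%:R - A 1 2%:R * A 2%:R 1)
  - A 0 1 * (A 1 0 * A 2%:R 2%:R - A 1 2%:R * A 2%:R 0)
  + A 0 2%:R * (A 1 0 * A 2%:R 1 - A 1 1 * A 2%:R 0).
Proof.
rewrite (expand_det_row _ 0) sum3E /cofactor !det2E !mxE /=.
have -> : lift 0 0 = 1 :> 'I_3 by apply: val_inj.
have -> : lift 0 1 = 2%:R :> 'I_3 by apply: val_inj.
have -> : lift 1 0 = 0 :> 'I_3 by apply: val_inj.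
have -> : lift 1 1 = 2%:R :> 'I_3 by apply: val_inj.
have -> : lift 2%:R 0 = 0 :> 'I_3 by apply: val_inj.
have -> : lift 2%:R 1 = 1 :> 'I_3 by apply: val_inj.
rewrite (_ : (0 + 2%:R)%N = 2%N) // (_ : (0 + 1)%N = 1%N) // addn0.
by rewrite expr0 expr1 sqrrN expr1n; ring.
Qed.

Definition colv A j : 'cV[R]_3 := col j A.

Lemma colvE A i j : colv A j i 0 = A i j. Proof. by rewrite mxE. Qed.

Lemma det_cross A : \det A = dotv (colv A 0) (cross (colv A 1) (colv A 2%:R)).
Proof. by rewrite det3E dotv3E !crossE !colvE; ring. Qed.

Lemma orthonormal_colv A : A^T *m A = 1%:M <->
  forall i j, dotv (colv A i) (colv A j) = (i == j)%:R.
Proof.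
have E i j : (A^T *m A) i j = dotv (colv A i) (colv A j).
  by rewrite mxE; apply: eq_bigr => k _; rewrite !mxE.
split=> [h i j|h]; first by rewrite -E h mxE.
by apply/matrixP => i j; rewrite E h mxE.
Qed.

(** If a, b, c are orthonormal with a.(b x c) = 1 then |a - b x c|^2 = 0. *)
Lemma SO3_cofactor A : SO3 A ->
  [/\ colv A 0 = cross (colv A 1) (colv A 2%:R),
      colv A 1 = cross (colv A 2%:R) (colv A 0)
    & colv A 2%:R = cross (colv A 0) (colv A 1)].
Proof.
move=> [/orthonormal_colv o]; rewrite det_cross.
have key a b c : dotv a a = 1 -> dotv b b = 1 -> dotv c c = 1 -> dotv b c = 0 ->
    dotv a (cross b c) = 1 -> a = cross b c :> 'cV[R]_3.
  move=> aa bb cc bc abc; apply/eqP; rewrite -subr_eq0 -dotvv_eq0.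
  have cr : dotv (cross b c) (cross b c) = dotv b b * dotv c c - dotv b c ^+ 2.
    by rewrite !dotv3E !crossE; ring.
  rewrite dotvBl !dotvBr (dotvC (cross b c) a) cr abc aa bb cc bc.
  by apply/eqP; ring.
move=> d; split; apply: key; rewrite ?o //= -d; by rewrite !dotv3E !crossE; ring.
Qed.

Lemma SO3_mul A B : SO3 A -> SO3 B -> SO3 (A *m B).
Proof.
move=> [oA dA] [oB dB]; split; last by rewrite det_mulmx dA dB mulr1.
by rewrite trmx_mul mulmxA -(mulmxA B^T) oA mulmx1.
Qed.

Lemma SO3_tr A : SO3 A -> SO3 A^T.
Proof. by move=> [oA dA]; split; rewrite ?det_tr // trmxK; exact: mulmx1C. Qed.

Lemma SO3_entry A i j : SO3 A -> `|A i j| <= 1.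
Proof.
move=> [/orthonormal_colv o _]; rewrite -colvE.
apply: le_trans (entry_le_norm2 _ _) _.
by rewrite norm2_le_sqr // o eqxx expr1n.
Qed.

Let dl (i : 'I_3) : 'cV[R]_3 := delta_mx i 0.

Let cross_delta : [/\ cross (dl 0) (dl 1) = dl 2%:R, cross (dl 1) (dl 2%:R) = dl 0
  & cross (dl 2%:R) (dl 0) = dl 1].
Proof. by split; apply: vec3P; rewrite crossE !mxE /=; ring. Qed.

(** A rotation preserves cross products, as its columns are cross products of
    each other. *)
Lemma SO3_hat A w : SO3 A -> hat (A^T *m w) = A^T *m hat w *m A.
Proof.
move=> sA; have [c0 c1 c2] := SO3_cofactor sA; have [d0 d1 d2] := cross_delta.
have E j : colv A j = A *m dl j by rewrite -colE.
have cr i j : A *m cross (dl j) (dl i) = cross (colv A j) (colv A i).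
  move: i j; apply: ord3P; apply: ord3P;
  rewrite ?crossvv ?mulmx0 // ?d0 ?d1 ?d2 -?E //.
  - by rewrite crossC d0 mulmxN -E c2 -crossC.
  - by rewrite crossC d1 mulmxN -E c0 -crossC.
  - by rewrite crossC d2 mulmxN -E c1 -crossC.
apply/matrixP => i j.
have -> : hat (A^T *m w) i j = dotv w (A *m cross (dl j) (dl i)).
  rewrite [RHS]dotv_mulmx [LHS]mxE; set u := A^T *m w.
  by move: i j; apply: ord3P; apply: ord3P; rewrite dotv3E !crossE !mxE /=; ring.
rewrite cr (_ : (_ *m _ *m A) i j = dotv (colv A i) (hat w *m colv A j)).
  by rewrite hat_mul !dotv3E !crossE; ring.
by rewrite /dotv -mulmxA mxE; apply: eq_bigr => k _; rewrite !mxE; congr (_ * _);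
   apply: eq_bigr => l _; rewrite !mxE.
Qed.

(** For the error rotation A = Rc^T R of angle theta, rot_err is 1 - cos theta and
    rot_vec, the error e_R, is sin theta times the axis. *)
Definition rot_err A : R := (2^-1 * \tr (1%:M - A))%R.
Definition rot_vec A : 'cV[R]_3 := 2^-1 *: vee (A - A^T).

Lemma rot_errE A : rot_err A = 2^-1 * (3 - A 0 0 - A 1 1 - A 2%:R 2%:R).
Proof. by rewrite /rot_err /mxtrace sum3E !mxE /=; ring. Qed.

Lemma rot_vecE A :
  ((rot_vec A 0 0 = (2^-1 * (A 2%:R 1 - A 1 2%:R))%R) *
   (rot_vec A 1 0 = (2^-1 * (A 0 2%:R - A 2%:R 0))%R) *
   (rot_vec A 2%:R 0 = (2^-1 * (A 1 0 - A 0 1))%R))%type.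
Proof.
have E i : rot_vec A i 0 = 2^-1 * vee (A - A^T) i 0 by rewrite mxE.
have D i j : (A - A^T) i j = A i j - A j i by rewrite !mxE.
by do !split; rewrite E /vee vec3E D.
Qed.

Lemma rot_err_ge0 A : SO3 A -> 0 <= rot_err A.
Proof.
move=> sA; have h i := le_trans (ler_norm _) (SO3_entry i i sA).
by rewrite rot_errE; have := h 0; have := h 1; have := h 2%:R; lra.
Qed.

(** In terms of the rotation angle this is sin^2 = (1 - cos) (1 + cos). *)
Lemma rot_vec_sqr A : SO3 A ->
  dotv (rot_vec A) (rot_vec A) = rot_err A * (2 - rot_err A).
Proof.
move=> sA; have [c0 c1 c2] := SO3_cofactor sA.
have [/orthonormal_colv o _] := sA.
have := o 0 0; have := o 1 1; have := o 2%:R 2%:R.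
have := congr1 (fun u : 'cV[R]_3 => u 0 0) c0.
have := congr1 (fun u : 'cV[R]_3 => u 1 0) c1.
have := congr1 (fun u : 'cV[R]_3 => u 2%:R 0) c2.
rewrite /= !dotv3E !crossE !colvE rot_errE !rot_vecE.
set a := A 0 0; set b := A 0 1; set c := A 0 2%:R; set d := A 1 0; set e := A 1 1.
set f := A 1 2%:R; set g := A 2%:R 0; set h := A 2%:R 1; set i := A 2%:R 2%:R.
move=> h1 h2 h3 h4 h5 h6.
lra.
Qed.

Lemma rot_err_le A : SO3 A -> rot_err A <= 1 ->
  rot_err A <= dotv (rot_vec A) (rot_vec A).
Proof.
move=> sA p1; rewrite rot_vec_sqr //; have p0 := rot_err_ge0 sA.
by rewrite ler_peMr //; lra.
Qed.

Lemma rot_vec_le A : SO3 A -> dotv (rot_vec A) (rot_vec A) <= 2 * rot_err A.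
Proof.
move=> sA; rewrite rot_vec_sqr // mulrC; have p0 := rot_err_ge0 sA.
by rewrite ler_wpM2r //; lra.
Qed.

(** With a the cosine of the tilt of the third axis, 1 - a^2 <= 2 (1 - a), and
    1 - a is at most the trace of 1 - A. *)
Lemma rot_axis_le A : SO3 A -> 1 - A 2%:R 2%:R ^+ 2 <= 4 * rot_err A.
Proof.
move=> sA; have h i := le_trans (ler_norm _) (SO3_entry i i sA).
rewrite rot_errE; have := h 0; have := h 1; have := h 2%:R.
have := sqr_ge0 (1 - A 2%:R 2%:R); rewrite sqrrB expr1n; lra.
Qed.

Lemma rot_err_rate A w : - (2^-1 * \tr (A *m hat w)) = dotv (rot_vec A) w.
Proof.
rewrite /mxtrace sum3E dotv3E !rot_vecE.
by rewrite !(mxE mulmx_key) /= !sum3E !hatE; field.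
Qed.

Lemma rot_vec_rate A w : SO3 A -> norm2 (rot_vec (A *m hat w)) <= 9 * norm2 w.
Proof.
move=> sA; have e i j : `|(A *m hat w) i j| <= 3 * norm2 w.
  rewrite mxE; apply: le_trans (ler_norm_sum _ _ _) _.
  apply: (@le_trans _ _ (\sum_(k < 3) norm2 w)).
    apply: ler_sum => k _; rewrite normrM -[leRHS]mul1r ler_pM ?SO3_entry //.
    exact: le_trans (entry_le_mxnorm _ _ _) (mxnorm_hat w).
  by rewrite sumr_const card_ord mulr_natl.
have g i j k l : `|2^-1 * ((A *m hat w) i j - (A *m hat w) k l)| <= 3 * norm2 w.
  rewrite normrM ger0_norm // -ler_pdivlMl // invrK.
  by apply: le_trans (ler_normB _ _) _; have := e i j; have := e k l; lra.
apply: le_trans (norm2_le_sum _) _; rewrite sum3E !rot_vecE.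
have := g 2%:R 1 1 2%:R; have := g 0 2%:R 2%:R 0; have := g 1 0 0 1; lra.
Qed.

Lemma projection_error_sqr (a b : 'cV[R]_3) : dotv b b = 1 ->
  dotv (dotv a b *: b - a) (dotv a b *: b - a) = dotv a a - dotv a b ^+ 2.
Proof.
by move=> bb; rewrite dotvBl !dotvBr !dotvZl !dotvZr bb (dotvC b a); ring.
Qed.

Lemma row3E (a b c : 'cV[R]_3) :
  let A : 'M[R]_3 := row_mx a (row_mx b c) in
  [/\ colv A 0 = a, colv A 1 = b & colv A 2%:R = c].
Proof.
split; apply/matrixP => i j; rewrite !ord1 colvE mxE.
- by case: (@splitP 1 2 0) => k //; rewrite (ord1 k).
- case: (@splitP 1 2 1) => k; first by rewrite (ord1 k).
  move=> e; rewrite mxE; case: (@splitP 1 1 k) => l kl; first by rewrite (ord1 l).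
  by move: e; rewrite kl.
- case: (@splitP 1 2 2%:R) => k; first by rewrite (ord1 k).
  move=> e; rewrite mxE; case: (@splitP 1 1 k) => l kl; last by rewrite (ord1 l).
  by move: e; rewrite kl (ord1 l).
Qed.

Lemma SO3_triad (b d : 'cV[R]_3) : dotv b b = 1 -> cross b d != 0 ->
  let h := hat b *m d in let hh := hat b *m hat b *m d in
  SO3 (row_mx (- ((norm2 hh)^-1 *: hh)) (row_mx ((norm2 h)^-1 *: h) b)).
Proof.
move=> bb h0 h hh; have hE : h = cross b d by rewrite /h hat_mul.
have hhE : hh = cross b h by rewrite /hh -mulmxA hat_mul.
have bh : dotv b h = 0 by rewrite hE !dotv3E !crossE; ring.
have nE : norm2 hh = norm2 h.
  rewrite !norm2E hhE; congr Num.sqrt.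
  have -> : dotv (cross b h) (cross b h) = dotv b b * dotv h h - dotv b h ^+ 2.
    by rewrite !dotv3E !crossE; ring.
  by rewrite bb bh; ring.
have n0 : norm2 h != 0 by rewrite norm2_eq0 hE.
pose y := (norm2 h)^-1 *: h.
have yy : dotv y y = 1.
  by rewrite /y dotvZl dotvZr -norm2_sqr; field.
have by0 : dotv b y = 0 by rewrite /y dotvZr bh mulr0.
have -> : - ((norm2 hh)^-1 *: hh) = cross y b.
  by rewrite nE hhE /y [RHS]crossC crossZr.
rewrite -/y; set A := row_mx _ _; have [c0 c1 c2] := row3E (cross y b) y b.
have o0 : dotv (cross y b) (cross y b) = 1.
  have -> : dotv (cross y b) (cross y b) = dotv y y * dotv b b - dotv b y ^+ 2.
    by rewrite !dotv3E !crossE; ring.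
  by rewrite yy bb by0; ring.
split; last by rewrite det_cross c0 c1 c2 o0.
have o1 : dotv (cross y b) y = 0 by rewrite !dotv3E !crossE; ring.
have o2 : dotv (cross y b) b = 0 by rewrite !dotv3E !crossE; ring.
apply/orthonormal_colv; apply: ord3P; apply: ord3P;
by rewrite ?c0 ?c1 ?c2 // ?[dotv y (cross _ _)]dotvC ?[dotv _ (cross _ _)]dotvC
   ?o0 ?o1 ?o2 ?yy ?[dotv y b]dotvC ?by0 ?bb.
Qed.

Lemma vee_hatK (S : 'M[R]_3) : S^T = - S -> hat (vee S) = S.
Proof.
move=> h; have E i j : S j i = - S i j.
  by have := congr1 (fun X : 'M[R]_3 => X i j) h; rewrite !mxE.
have Z i : S i i = 0 by have := E i i; lra.
by apply/matrixP; apply: ord3P; apply: ord3P; rewrite hatE /vee ?vec3E ?Z // -E.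
Qed.

Lemma tr_hat w : (hat w)^T = - hat w.
Proof.
have T (A : 'M[R]_3) i j : A^T i j = A j i by rewrite mxE.
have N (A : 'M[R]_3) i j : (- A) i j = - A i j by rewrite mxE.
by apply/matrixP; apply: ord3P; apply: ord3P; rewrite T N !hatE ?oppr0 ?opprK.
Qed.

End Rotations.

(** * Differentiation rules *)

Section Derivatives.
Context {R : realType}.
Implicit Types t : R.

Lemma is_derive_mx m n (f : R -> 'M[R]_(m, n)) (df : 'M[R]_(m, n)) t :
  (forall i j, is_derive t 1 (fun s => f s i j) (df i j)) -> is_derive t 1 f df.
Proof.
move=> h; have d : derivable f t 1 by apply/derivable_mxP => i j; case: (h i j).
split => //; rewrite derive_mx //; apply/matrixP => i j; rewrite mxE.
by case: (h i j).
Qed.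

Lemma is_derive_entry m n (f : R -> 'M[R]_(m, n)) df t i j :
  is_derive t 1 f df -> is_derive t 1 (fun s => f s i j) (df i j).
Proof.
move=> [d e]; have dij := (derivable_mxP f t 1).1 d i j.
by split => //; rewrite -e derive_mx // mxE.
Qed.

Lemma is_derive1P (V : normedModType R) (f : R -> V) t :
  derivable f t 1 -> is_derive t 1 f (derive1 f t).
Proof. by move=> d; split => //; rewrite derive1E. Qed.

Lemma derive1_is (V : normedModType R) (f : R -> V) df t :
  is_derive t 1 f df -> derive1 f t = df.
Proof. by move=> [_ e]; rewrite derive1E. Qed.

Lemma is_derive_ext (V : normedModType R) (f g : R -> V) df t :
  (forall s, f s = g s) -> is_derive t 1 g df -> is_derive t 1 f df.
Proof. by move=> fg; rewrite (funext fg). Qed.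

Lemma is_derive_addf (V : normedModType R) (f g : R -> V) df dg t :
  is_derive t 1 f df -> is_derive t 1 g dg ->
  is_derive t 1 (fun s => f s + g s) (df + dg).
Proof. exact: is_deriveD. Qed.

Lemma is_derive_subf (V : normedModType R) (f g : R -> V) df dg t :
  is_derive t 1 f df -> is_derive t 1 g dg ->
  is_derive t 1 (fun s => f s - g s) (df - dg).
Proof. exact: is_deriveB. Qed.

Lemma is_derive_scale (V : normedModType R) (f : R -> V) df a t :
  is_derive t 1 f df -> is_derive t 1 (fun s => a *: f s) (a *: df).
Proof. exact: is_deriveZ. Qed.

Lemma is_derive_mulf (f g : R -> R) df dg t :
  is_derive t 1 f df -> is_derive t 1 g dg ->
  is_derive t 1 (fun s => f s * g s) (df * g t + f t * dg).
Proof.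
move=> hf hg; have := is_deriveM hf hg.
by rewrite addrC /GRing.scale /= [g t * _]mulrC.
Qed.

Lemma is_derive_scaler (f : R -> R) df a t :
  is_derive t 1 f df -> is_derive t 1 (fun s => a * f s) (a * df).
Proof. exact: is_deriveZ. Qed.

Lemma is_derive_sumf (V : normedModType R) n (f : 'I_n -> R -> V) df t :
  (forall i, is_derive t 1 (f i) (df i)) ->
  is_derive t 1 (fun s => \sum_i f i s) (\sum_i df i).
Proof.
move=> h; have := is_derive_sum h; apply: is_derive_ext => s.
by rewrite fct_sumE.
Qed.

Lemma is_derive_constf (V : normedModType R) (a : V) t :
  is_derive t 1 (fun=> a) 0.
Proof. exact: is_derive_cst. Qed.

Lemma is_derive_dotv k (f g : R -> 'cV[R]_k) df dg t :
  is_derive t 1 f df -> is_derive t 1 g dg ->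
  is_derive t 1 (fun s => dotv (f s) (g s)) (dotv df (g t) + dotv (f t) dg).
Proof.
move=> hf hg; rewrite /dotv -big_split /=; apply: is_derive_sumf => i.
by apply: is_derive_mulf; exact: is_derive_entry.
Qed.

Lemma is_derive_mulmx m n p (f : R -> 'M[R]_(m, n)) (g : R -> 'M[R]_(n, p)) df dg t :
  is_derive t 1 f df -> is_derive t 1 g dg ->
  is_derive t 1 (fun s => f s *m g s) (df *m g t + f t *m dg).
Proof.
move=> hf hg; apply: is_derive_mx => i j.
rewrite !mxE -big_split /=; apply: (is_derive_ext (fun s => mxE _ _ i j)).
by apply: is_derive_sumf => k; apply: is_derive_mulf; exact: is_derive_entry.
Qed.

Lemma is_derive_mulmxl m n p (A : 'M[R]_(m, n)) (g : R -> 'M[R]_(n, p)) dg t :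
  is_derive t 1 g dg -> is_derive t 1 (fun s => A *m g s) (A *m dg).
Proof.
move=> hg; have := is_derive_mulmx (is_derive_constf A t) hg.
by rewrite mul0mx add0r.
Qed.

Lemma is_derive_trmx m n (f : R -> 'M[R]_(m, n)) df t :
  is_derive t 1 f df -> is_derive t 1 (fun s => (f s)^T) df^T.
Proof.
move=> hf; apply: is_derive_mx => i j; rewrite mxE.
by apply: (is_derive_ext (fun s => mxE _ _ i j)); exact: is_derive_entry.
Qed.

Lemma is_derive_col_mx k l (f : R -> 'cV[R]_k) (g : R -> 'cV[R]_l) df dg t :
  is_derive t 1 f df -> is_derive t 1 g dg ->
  is_derive t 1 (fun s => col_mx (f s) (g s)) (col_mx df dg).
Proof.
move=> hf hg; apply: is_derive_mx => i j; rewrite mxE.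
apply: (is_derive_ext (fun s => mxE _ _ i j)).
by case: (fintype.split i) => k'; exact: is_derive_entry.
Qed.

Lemma is_derive_topv k (f : R -> 'cV[R]_(3 + k)) df t :
  is_derive t 1 f df -> is_derive t 1 (fun s => topv (f s)) (topv df).
Proof.
move=> hf; apply: is_derive_mx => i j; rewrite mxE.
by apply: (is_derive_ext (fun s => mxE _ _ i j)); exact: is_derive_entry.
Qed.

Lemma is_derive_mkv n (x : R -> 'cV[R]_3) (w : R -> 'I_n -> 'cV[R]_2) dx dw t :
  is_derive t 1 x dx -> (forall i, is_derive t 1 (fun s => w s i) (dw i)) ->
  is_derive t 1 (fun s => mkv (x s) (w s)) (mkv dx dw).
Proof.
move=> hx hw; apply: is_derive_col_mx => //; apply: is_derive_mx => i j.
rewrite mxE; apply: (is_derive_ext (fun s => mxE _ _ i j)).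
exact: (is_derive_entry _ _ (hw _)).
Qed.

Lemma is_derive_cross (f g : R -> 'cV[R]_3) df dg t :
  is_derive t 1 f df -> is_derive t 1 g dg ->
  is_derive t 1 (fun s => cross (f s) (g s)) (cross df (g t) + cross (f t) dg).
Proof.
move=> hf hg; apply: is_derive_mx => i j; rewrite ord1 mxE; move: i.
have E a b c d : is_derive t 1 (fun s => f s a 0 * g s b 0 - f s c 0 * g s d 0)
  ((df a 0 * g t b 0 + f t a 0 * dg b 0) - (df c 0 * g t d 0 + f t c 0 * dg d 0)).
  by apply: is_derive_subf; apply: is_derive_mulf; exact: is_derive_entry.
apply: ord3P; rewrite !crossE.
- rewrite [X in is_derive _ _ _ X](_ : _ = (df 1 0 * g t 2%:R 0 + f t 1 0 * dg 2%:R 0)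
    - (df 2%:R 0 * g t 1 0 + f t 2%:R 0 * dg 1 0)); last by ring.
  by apply: is_derive_ext (E _ _ _ _) => s; rewrite crossE.
- rewrite [X in is_derive _ _ _ X](_ : _ = (df 2%:R 0 * g t 0 0 + f t 2%:R 0 * dg 0 0)
    - (df 0 0 * g t 2%:R 0 + f t 0 0 * dg 2%:R 0)); last by ring.
  by apply: is_derive_ext (E _ _ _ _) => s; rewrite crossE.
- rewrite [X in is_derive _ _ _ X](_ : _ = (df 0 0 * g t 1 0 + f t 0 0 * dg 1 0)
    - (df 1 0 * g t 0 0 + f t 1 0 * dg 0 0)); last by ring.
  by apply: is_derive_ext (E _ _ _ _) => s; rewrite crossE.
Qed.

Lemma is_derive_rot_vec (f : R -> 'M[R]_3) df t :
  is_derive t 1 f df -> is_derive t 1 (fun s => rot_vec (f s)) (rot_vec df).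
Proof.
move=> hf; apply: is_derive_mx => i j; rewrite ord1; move: i.
have E a b c d : is_derive t 1 (fun s => 2^-1 * (f s a b - f s c d))
  (2^-1 * (df a b - df c d)).
  by apply: is_derive_scaler; apply: is_derive_subf; exact: is_derive_entry.
by apply: ord3P; rewrite rot_vecE; apply: is_derive_ext (E _ _ _ _) => s;
   rewrite rot_vecE.
Qed.

Lemma is_derive_rot_err (f : R -> 'M[R]_3) df t :
  is_derive t 1 f df ->
  is_derive t 1 (fun s => rot_err (f s)) (- (2^-1 * \tr df)).
Proof.
move=> hf; have -> : - (2^-1 * \tr df)
    = 2^-1 * (0 - df 0 0 - df 1 1 - df 2%:R 2%:R).
  by rewrite /mxtrace sum3E; ring.
apply: is_derive_ext (fun s => rot_errE (f s)) _.
apply: is_derive_scaler.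
do 3 (apply: is_derive_subf; last exact: is_derive_entry).
Qed.

End Derivatives.

Lemma is_derive_exp (R : realType) (k s : R) :
  is_derive s 1 (fun s => expR (k * s)) (k * expR (k * s)).
Proof.
have h : is_derive s 1 (fun s : R => k * s) (k * 1).
  by apply: is_derive_scaler; exact: is_derive_id.
have := is_derive1_comp (is_derive_expR (k * s)) h.
by rewrite mulr1 mulrC.
Qed.

(** * Exponential decay, barriers and integrals *)

Section Barrier.
Context {R : realType}.

Lemma continuous_segment (f : R -> R) a b :
  (forall t : R, a <= t -> {for t, continuous f}) -> {within `[a, b], continuous f}.
Proof.
move=> h; apply: continuous_in_subspaceT => t; rewrite inE /= in_itv /=.
by move=> /andP[/h].
Qed.

(** Multiplying by the exponential reduces the claim to monotonicity. *)
Lemma exp_decay (S : R -> R) (k b : R) :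
  (forall t : R, 0 <= t -> {for t, continuous S}) ->
  (forall t : R, 0 < t < b -> derivable S t 1) ->
  (forall t : R, 0 < t < b -> derive1 S t <= - (k * S t)) ->
  forall t : R, 0 <= t <= b -> S t <= S 0 * expR (- (k * t)).
Proof.
move=> cS dS hS t /andP[t0 tb].
pose E (s : R) := expR (k * s).
have dE (s : R) : is_derive s 1 E (k * E s) by exact: is_derive_exp.
have dF (s : R) : 0 < s < b -> is_derive s 1 (fun s => S s * E s)
    (derive1 S s * E s + S s * (k * E s)).
  by move=> sb; apply: is_derive_mulf; exact/is_derive1P/dS.
have : S t * E t <= S 0 * E 0.
  apply: (@ler0_derive1_nincr _ (fun s => S s * E s) 0 b) => //.
  - by move=> s; rewrite in_itv /= => /dF[].
  - move=> s; rewrite in_itv /= => sb; rewrite (derive1_is (dF s sb)).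
    have := hS s sb; have := expR_gt0 (k * s) => e0 h.
    have := ler_wpM2r (ltW e0) h; rewrite -/(E s); lra.
  - apply: continuous_segment => s s0; apply: cvgM; first exact: cS.
    by apply: derivable_continuous; case: (dE s).
rewrite {2}/E mulr0 expR0 mulr1 expRN ler_pdivlMr ?expR_gt0 //.
Qed.

(** At the first time at which g reaches 3/4, S has not increased yet, which
    brings g back below 1/2. *)
Lemma barrier (S g : R -> R) (k Smax : R) :
  0 <= k ->
  (forall t : R, 0 <= t -> {for t, continuous S}) ->
  (forall t : R, 0 <= t -> {for t, continuous g}) ->
  (forall t : R, 0 < t -> derivable S t 1) ->
  (forall t : R, 0 < t -> g t <= 1 -> derive1 S t <= - (k * S t)) ->
  (forall t : R, 0 <= t -> g t <= 1 -> 0 <= S t) ->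
  (forall t : R, 0 <= t -> g t <= 1 -> S t <= Smax -> g t <= 2^-1) ->
  g 0 <= 1 -> S 0 <= Smax ->
  forall t : R, 0 <= t -> g t <= 2^-1 /\ S t <= S 0 * expR (- (k * t)).
Proof.
move=> k0 cS cg dS hS S0 hg g0 S0m.
have g0h := hg 0 (lexx _) g0 S0m.
have dec (b : R) : 0 <= b -> (forall s, 0 <= s < b -> g s <= 1) ->
    S b <= S 0 * expR (- (k * b)).
  move=> b0 gb; apply: (@exp_decay S k b) => //; last by rewrite b0 lexx.
  - by move=> t /andP[t0 _]; exact: dS.
  - by move=> t /andP[t0 tb]; apply: hS => //; apply: gb; rewrite (ltW t0).
have decS (b : R) : 0 <= b -> S 0 * expR (- (k * b)) <= S 0.
  move=> b0; rewrite ler_piMr ?S0 // -expR0 ler_expR oppr_le0.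
  exact: mulr_ge0.
suff g1 : forall t : R, 0 <= t -> g t <= 1.
  move=> t t0; have Sd : S t <= S 0 * expR (- (k * t)).
    by apply: dec => // s /andP[s0 _]; exact: g1.
  split => //; apply: hg; rewrite ?g1 //.
  by apply: le_trans Sd (le_trans (decS _ t0) S0m).
move=> t1 t10; rewrite leNgt; apply/negP => gt1.
(* the supremum of E is the first time at which g reaches 3/4 *)
pose E := [set t | 0 <= t <= t1 /\ forall s, 0 <= s <= t -> g s < 3 / 4].
have E0 : E 0.
  split; first by rewrite lexx.
  move=> s /andP[s0 s0']; have -> : s = 0 by apply/eqP; rewrite eq_le s0 s0'.
  by apply: le_lt_trans g0h _; lra.
have supE : has_sup E.
  by split; [exists 0|exists t1 => t [/andP[]]].
pose tau := sup E.
have tau0 : 0 <= tau by exact: sup_upper_bound.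
have tau1 : tau <= t1 by apply: ge_sup => [|t [/andP[]]] //; exists 0.
have below (s : R) : 0 <= s < tau -> g s < 3 / 4.
  move=> /andP[s0 st]; have [|e [_ he] se] := @sup_adherent _ E (tau - s) _ supE.
    by rewrite subr_gt0.
  by apply: he; rewrite s0 /=; move: se; rewrite -/tau; lra.
have Stau : S tau <= Smax.
  apply: le_trans S0m; apply: le_trans (decS _ tau0); apply: dec => // s hs.
  by apply/ltW; apply: lt_trans (below s hs) _; lra.
have gtau : g tau <= 1.
  rewrite leNgt; apply/negP => gtau.
  have [tau00|taup] := eqVneq tau 0; first by move: gtau; rewrite tau00; lra.
  have tp : 0 < tau by rewrite lt_def taup.
  have /cvgrPdist_lt/(_ (1 - 3 / 4)) := cg tau tau0.
  have -> : 0 < 1 - 3 / 4 :> R by lra.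
  move=> /(_ isT)/nbhs_ballP[d /= d0 hd].
  have [s [st s0 sd]] : exists s, [/\ s < tau, 0 <= s & tau - d < s].
    exists (Num.max (tau / 2) (tau - d / 2)); split.
    - by rewrite gt_max; apply/andP; split; lra.
    - by rewrite le_max divr_ge0.
    - by rewrite lt_max; apply/orP; right; lra.
  have := hd s; rewrite /ball /= ger0_norm ?subr_ge0 ?(ltW st) // => h.
  have /h : tau - s < d by lra.
  have := below s; rewrite s0 st => /(_ isT) b1.
  by have := ler_norm (g tau - g s); lra.
have gtau2 := hg _ tau0 gtau Stau.
have ltau : tau < t1.
  rewrite lt_def tau1 andbT; apply/eqP => e; move: gt1; rewrite e; lra.
have /cvgrPdist_lt/(_ (3 / 4 - 2^-1)) := cg tau tau0.
have -> : 0 < 3 / 4 - 2^-1 :> R by lra.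
move=> /(_ isT)/nbhs_ballP[d /= d0 hd].
pose e := Num.min t1 (tau + d / 2).
have te : tau < e by rewrite lt_min ltau /=; lra.
have Ee : E e.
  split; first by rewrite (le_trans tau0 (ltW te)) ge_min lexx.
  move=> s /andP[s0 se]; have [st|ts] := ltP s tau; first by apply: below; rewrite s0.
  have := hd s; rewrite /ball /= ler0_norm ?subr_le0 // opprB => h.
  have /h : s - tau < d.
    by move: se; rewrite le_min => /andP[_]; lra.
  by rewrite distrC; have := ler_norm (g s - g tau); lra.
have := sup_upper_bound supE Ee; rewrite -/tau; lra.
Qed.

End Barrier.

Lemma exp_squeeze (R : realType) (f : R -> R) (c k : R) : 0 < k ->
  (forall t : R, 0 <= t -> 0 <= f t <= c * expR (- (k * t))) ->
  f t @[t --> +oo] --> (0 : R).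
Proof.
move=> k0 h.
have e0 : c * expR (- (k * t)) @[t --> +oo] --> (0 : R).
  rewrite -[X in _ --> X](mulr0 c); apply: cvgM; first exact: cvg_cst.
  have kt : k * t @[t --> +oo] --> +oo by apply: gt0_cvgMry => //; exact: cvg_id.
  exact: (cvg_comp _ _ kt (@cvgr_expR R)).
apply: squeeze_cvgr (cvg_cst _) e0.
by near=> t; apply: h; near: t; exact: nbhs_pinfty_ge.
Unshelve. all: by end_near.
Qed.

Section Integral.
Context {R : realType}.

Let integrable_segment (f : R -> R) u :
  (forall t : R, 0 <= t -> {for t, continuous f}) ->
  (@lebesgue_measure R).-integrable `[0, u] (EFin \o f).
Proof.
move=> cf; apply: continuous_compact_integrable; first exact: segment_compact.
exact: continuous_segment.
Qed.

Lemma vint_derive k (f : R -> 'cV[R]_k) (t : R) :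
  (forall s : R, 0 <= s -> {for s, continuous f}) -> 0 < t ->
  is_derive t 1 (vint f) (f t).
Proof.
move=> cf t0; apply: is_derive_mx => i j; rewrite ord1.
have ci (s : R) : 0 <= s -> {for s, continuous (fun s => f s i 0)}.
  by move=> /cf; exact: cvg_entry.
have tt : t < t + 1 by rewrite ltrDl.
have [d e] := @continuous_FTC1_closed R (fun s => f s i 0) 0 t (t + 1)
  tt (integrable_segment _ ci) t0 (ci t (ltW t0)).
apply: (is_derive_ext (fun s => mxE _ _ i 0)).
by split; [exact: d|rewrite -derive1E; exact: e].
Qed.

Lemma vint0 k (f : R -> 'cV[R]_k) : vint f 0 = 0.
Proof.
by apply/matrixP => i j; rewrite !mxE set_itv1 Rintegral_set1.
Qed.

Lemma vint_continuous0 k (f : R -> 'cV[R]_k) :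
  (forall s : R, 0 <= s -> {for s, continuous f}) -> {for 0, continuous (vint f)}.
Proof.
move=> cf; rewrite /prop_for /continuous_at vint0; apply: cvg_mx => i j; rewrite ord1 [X in _ --> X]mxE.
under eq_fun do rewrite mxE.
apply: (@parameterized_integral_cvg_left R 0 1) => //.
by apply: integrable_segment => s /cf; exact: cvg_entry.
Qed.

End Integral.

(** Bound the component along each fixed vector y by adding the primitive of the
    bound of its derivative; then take for y the value at the final time. *)
Lemma bounded_primitive (R : realType) k (f df : R -> 'cV[R]_k) (c a : R) :
  0 < a -> 0 <= c ->
  (forall t : R, 0 <= t -> {for t, continuous f}) ->
  (forall t : R, 0 < t -> is_derive t 1 f (df t)) ->
  (forall t : R, 0 < t -> norm2 (df t) <= c * expR (- (a * t))) ->
  forall t : R, 0 <= t -> norm2 (f t) <= norm2 (f 0) + c / a.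
Proof.
move=> a0 c0 cf hf hdf t t0; set y := f t.
pose h s : R := dotv y (f s) + norm2 y * (c / a) * expR (- (a * s)).
have dh (s : R) : 0 < s -> is_derive s 1 h
   (dotv y (df s) - norm2 y * c * expR (- (a * s))).
  move=> s0; have d1 := is_derive_dotv (is_derive_constf y s) (hf s s0).
  have d2 : is_derive s 1 (fun s : R => expR (- (a * s))) (- a * expR (- (a * s))).
    rewrite -mulNr; apply: is_derive_ext (is_derive_exp (- a) s) => r.
    by rewrite mulNr.
  have := is_derive_addf d1 (is_derive_scaler (norm2 y * (c / a)) d2).
  congr is_derive; rewrite dotv0l add0r; congr (_ + _).
  by field; rewrite gt_eqF.
have hc (s : R) : 0 <= s -> {for s, continuous h}.
  move=> s0; apply: cvgD.
    by apply: cvg_dotv; [exact: cvg_cst|exact: cf].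
  apply: cvgM; first exact: cvg_cst.
  apply: (@continuous_comp _ _ _ (fun s : R => - (a * s)) (@expR R)).
    by apply: cvgN; apply: cvgM; [exact: cvg_cst|exact: cvg_id].
  exact: continuous_expR.
have dec : h t <= h 0 * expR (- (0 * t)).
  apply: (@exp_decay R h 0 t) => //.
  - by move=> s /andP[s0 _]; have [] := dh s s0.
  - move=> s /andP[s0 _]; rewrite (derive1_is (dh s s0)) mul0r oppr0 subr_le0.
    apply: le_trans (ler_norm _) _; apply: le_trans (abs_dotv_le _ _) _.
    by rewrite -mulrA ler_wpM2l ?norm2_ge0 // hdf.
  - by rewrite t0 lexx.
move: dec; rewrite mul0r oppr0 expR0 mulr1 /h mulr0 oppr0 expR0 mulr1 => dec.
have ny := norm2_ge0 y; have [->|y0] := eqVneq (norm2 y) 0.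
  by rewrite addr_ge0 ?norm2_ge0 // divr_ge0 // ltW.
have ypos : 0 < norm2 y by rewrite lt_neqAle eq_sym y0.
rewrite -(ler_pM2l ypos) -expr2 norm2_sqr mulrDr.
apply: (@le_trans _ _ (dotv y (f 0) + norm2 y * (c / a))).
  apply: le_trans dec; rewrite lerDl mulr_ge0 ?expR_ge0 // mulr_ge0 // divr_ge0 //.
  exact: ltW.
by rewrite lerD2r; apply: le_trans (ler_norm _) (abs_dotv_le _ _).
Qed.

(** * The attitude Lyapunov function *)

Section AttitudeFunction.
Context {R : realType} (J : 'M[R]_3).

Definition att_fun (kI c2 mu : R) (A : 'M[R]_3) (w i : 'cV[R]_3) : R :=
  2^-1 * dotv w (J *m w) + rot_err A + c2 * dotv (rot_vec A) (J *m w)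
  + 2^-1 * kI * dotv i i + mu * dotv i (J *m w).

(** The derivative of att_fun along A' = A hat(w), w' = dw, i' = w + c2 rot_vec A. *)
Definition att_rate (kI c2 mu : R) (A : 'M[R]_3) (w dw i : 'cV[R]_3) : R :=
  dotv w (J *m dw) + dotv (rot_vec A) w
  + c2 * (dotv (rot_vec (A *m hat w)) (J *m w) + dotv (rot_vec A) (J *m dw))
  + kI * dotv i (w + c2 *: rot_vec A)
  + mu * (dotv (w + c2 *: rot_vec A) (J *m w) + dotv i (J *m dw)).

Definition att_size kI (A : 'M[R]_3) (w i : 'cV[R]_3) : R :=
  rot_err A + dotv w w + kI * dotv i i.

End AttitudeFunction.

(** The cross term c2 eR.Jw dissipates the attitude error and cancels what the
    integrand c2 eR adds to the rate of the integral part; mu i.Jw dissipates the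
    integral error. Apart from the dissipation mu kI |i|^2 the gain kI drops out of
    the rate, which makes the constants uniform in kI. *)
Lemma attitude_design (R : realType) (J : 'M[R]_3) : posdef J -> exists c2 mu k cl cu : R,
  [/\ 0 < c2, 0 < mu, 0 < k, 0 < cl & 0 < cu] /\
  forall (kI : R) (A : 'M[R]_3) (w i : 'cV[R]_3),
    1 <= kI -> SO3 A -> rot_err A <= 1 ->
    [/\ cl * att_size kI A w i <= att_fun J kI c2 mu A w i,
        att_fun J kI c2 mu A w i <= cu * att_size kI A w i
      & forall dw, J *m dw = - rot_vec A - w - kI *: i ->
        att_rate J kI c2 mu A w dw i <= - (k * att_fun J kI c2 mu A w i)].
Proof.
move=> Jpos.
have abs_le (a b c : R) : `|a| <= b * c -> a <= b * c /\ - a <= b * c.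
  by rewrite ler_norml => /andP[h1 h2]; split => //; lra.
have [jm jm0 hjm] := posdef_coercive Jpos.
have [jM jM0 hjM] := mulmx_norm2_bounded J.
(* c2 = 1 / D must be small against 1, against 1 / jM and against jm / jM *)
pose D := 4 + 36 * jM + 4 * jM / jm.
have jj0 : 0 <= 4 * jM / jm by rewrite divr_ge0 ?(ltW jm0) // mulr_ge0.
have D0 : 0 < D by rewrite /D; lra.
pose c2 := D^-1; have c0 : 0 < c2 by rewrite invr_gt0.
have cD : c2 * D = 1 by rewrite mulVf ?gt_eqF.
have cjm : c2 * jM <= jm / 4.
  rewrite -(ler_pM2r D0) mulrAC cD mul1r.
  apply: (@le_trans _ _ (jm / 4 * (4 * jM / jm))).
    by rewrite le_eqVlt; apply/orP; left; apply/eqP; field; rewrite gt_eqF.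
  by rewrite ler_pM2l ?divr_gt0 // /D; lra.
have cM0 : 0 <= c2 * jM by rewrite mulr_ge0 // ltW.
have c36 : 4 * c2 + 36 * (c2 * jM) <= 1.
  have := mulr_ge0 (ltW c0) jj0; move: cD; rewrite /D !mulrDr; lra.
have c36a : c2 + 9 * (c2 * jM) <= 4^-1 by lra.
have cM1 : c2 * jM <= 36^-1 by lra.
have cM2 : c2 * jM <= 2^-1 by lra.
have c4 : c2 <= 4^-1 by lra.
pose mu := c2 / 8; have m0 : 0 < mu by rewrite divr_gt0.
have mM : mu * jM <= 36^-1 by rewrite /mu; lra.
have m4 : mu <= 32^-1 by rewrite /mu; lra.
pose cu := 2 + jM + jm; have u0 : 0 < cu by rewrite /cu; lra.
pose cl := Num.min (4^-1) (jm / 4).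
have l0 : 0 < cl by rewrite lt_min invr_gt0 divr_gt0 //= ltr0n.
have l1 : cl <= 4^-1 by rewrite ge_min lexx.
have l2 : cl <= jm / 4 by rewrite ge_min lexx orbT.
pose k := mu / (2 * cu); have k0 : 0 < k by rewrite divr_gt0 // mulr_gt0.
exists c2, mu, k, cl, cu; split => // kI A w i kI1 sA p1.
have p0 := rot_err_ge0 sA; have pa := rot_err_le sA p1; have ap := rot_vec_le sA.
pose a := norm2 (rot_vec A); pose b := norm2 w; pose n := norm2 i.
have a0 : 0 <= a := norm2_ge0 _; have b0 : 0 <= b := norm2_ge0 _.
have n0 : 0 <= n := norm2_ge0 _.
have Jb : norm2 (J *m w) <= jM * b := hjM w.
have bil (u : 'cV[R]_3) : `|dotv u (J *m w)| <= norm2 u * (jM * b).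
  by apply: le_trans (abs_dotv_le _ _) _; rewrite ler_wpM2l ?norm2_ge0.
have [e1 e1'] := abs_le _ _ _ (bil (rot_vec A)); have [e2 e2'] := abs_le _ _ _ (bil i).
have e3' := hjm w; have [e4 _] := abs_le _ _ _ (bil w).
rewrite -!norm2_sqr -/a -/b -/n in pa ap e1 e1' e2 e2' e3' e4 *.
have ab := amgm a b; have nb := amgm n b.
have nI : n ^+ 2 <= kI * n ^+ 2 by rewrite ler_peMl ?sqr_ge0.
have f1 : c2 * (a * (jM * b)) <= 2^-1 * rot_err A + jm / 8 * b ^+ 2.
  have h := ler_wpM2l cM0 ab.
  have h2 := ler_wpM2l cM0 ap.
  have h3 := ler_wpM2r (sqr_ge0 b) cjm.
  have h4 : c2 * jM * rot_err A <= 2^-1 * rot_err A by rewrite ler_wpM2r.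
  by rewrite mulrDr in h; clear -h h2 h3 h4; lra.
have f2 : mu * (n * (jM * b)) <= 4^-1 * (kI * n ^+ 2) + jm / 8 * b ^+ 2.
  have h := ler_wpM2l cM0 nb.
  have h3 := ler_wpM2r (sqr_ge0 b) cjm.
  have h4 : c2 * jM * n ^+ 2 <= 2^-1 * n ^+ 2 by rewrite ler_wpM2r ?sqr_ge0.
  have h5 : 0 <= jm * b ^+ 2 by rewrite mulr_ge0 ?sqr_ge0 // ltW.
  have n2 := sqr_ge0 n; rewrite mulrDr in h; rewrite /mu.
  by clear -h h3 h4 h5 nI n2; lra.
have g1 := ler_wpM2l (ltW c0) e1; have g1' := ler_wpM2l (ltW c0) e1'.
have g2 := ler_wpM2l (ltW m0) e2; have g2' := ler_wpM2l (ltW m0) e2'.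
have low : cl * att_size kI A w i <= att_fun J kI c2 mu A w i.
  have h1 := ler_wpM2r p0 l1; have h2 := ler_wpM2r (sqr_ge0 b) l2.
  have h3 : cl * (kI * n ^+ 2) <= 4^-1 * (kI * n ^+ 2).
    by rewrite ler_wpM2r // (le_trans (sqr_ge0 n)).
  rewrite /att_size /att_fun -!norm2_sqr -/b -/n !mulrDr.
  by clear -h1 h2 h3 f1 f2 g1' g2' e3' p0; lra.
have up : att_fun J kI c2 mu A w i <= cu * att_size kI A w i.
  have jb : 0 <= jM * b ^+ 2 by rewrite mulr_ge0 ?sqr_ge0.
  have jp : 0 <= jM * rot_err A by rewrite mulr_ge0.
  have mp : 0 <= jm * rot_err A by rewrite mulr_ge0 // ltW.
  have mb : 0 <= jm * b ^+ 2 by rewrite mulr_ge0 ?sqr_ge0 // ltW.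
  have kn : 0 <= kI * n ^+ 2 by apply: le_trans nI; exact: sqr_ge0.
  have jk : 0 <= jM * (kI * n ^+ 2) by rewrite mulr_ge0.
  have mk : 0 <= jm * (kI * n ^+ 2) by rewrite mulr_ge0 // ltW.
  rewrite /att_size /att_fun -!norm2_sqr -/b -/n /cu !mulrDr !mulrDl.
  have b2 := sqr_ge0 b.
  by clear -jb jp mp mb kn jk mk b2 f1 f2 g1 g2 e4 p0 c4 nI; lra.
split => // dw Jdw.
suff rate : att_rate J kI c2 mu A w dw i <= - (mu / 2 * att_size kI A w i).
  apply: le_trans rate _; rewrite lerN2.
  have := ler_wpM2l (ltW k0) up.
  by have -> : k * (cu * att_size kI A w i) = mu / 2 * att_size kI A w i
    by rewrite /k; field; rewrite gt_eqF.
have bil2 : dotv (rot_vec (A *m hat w)) (J *m w) <= 9 * b * (jM * b).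
  apply: le_trans (ler_norm _) _; apply: le_trans (abs_dotv_le _ _) _.
  by rewrite ler_pM ?norm2_ge0 // rot_vec_rate.
have ew : - dotv (rot_vec A) w <= a * b.
  by apply: le_trans (abs_dotv_le _ _); rewrite -normrN ler_norm.
have ia : - dotv i (rot_vec A) <= n * a.
  by apply: le_trans (abs_dotv_le _ _); rewrite -normrN ler_norm.
have iw : - dotv i w <= n * b.
  by apply: le_trans (abs_dotv_le _ _); rewrite -normrN ler_norm.
have rE : att_rate J kI c2 mu A w dw i =
  - b ^+ 2 - c2 * a ^+ 2 + c2 * (- dotv (rot_vec A) w)
  + c2 * dotv (rot_vec (A *m hat w)) (J *m w)
  + mu * (dotv w (J *m w) + c2 * dotv (rot_vec A) (J *m w)
          + (- dotv i (rot_vec A)) + (- dotv i w) - kI * n ^+ 2).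
  rewrite /att_rate Jdw /a /b /n !norm2_sqr.
  move: (rot_vec A) (rot_vec (A *m hat w)) => r r'.
  rewrite !(dotvDl, dotvDr, dotvNr, dotvNl, dotvZl, dotvZr).
  rewrite (dotvC w r) (dotvC w i) (dotvC r i); ring.
rewrite rE /att_size -!norm2_sqr -/b -/n.
have s1 := ler_wpM2l (ltW c0) ew; have s2 := ler_wpM2l (ltW c0) bil2.
have s3 := ler_wpM2l (ltW m0) e4; have s4 := ler_wpM2l (ltW m0) ia.
have s5 := ler_wpM2l (ltW m0) iw; have s6 := ler_wpM2l (ltW m0) g1.
have q1 := amgm4 a b; have q2 := amgm4 n a; have q3 := amgm4 n b.
have t1 := ler_wpM2l (ltW c0) q1; have t2 := ler_wpM2l (ltW m0) q2.
have t3 := ler_wpM2l (ltW m0) q3.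
have t4 := ler_wpM2l (ltW m0) (ler_wpM2l cM0 ab).
have t5 := ler_wpM2l (ltW m0) nI.
have bb := sqr_ge0 b; have aa := sqr_ge0 a.
have v1 : (c2 + 9 * (c2 * jM)) * b ^+ 2 <= 4^-1 * b ^+ 2 by rewrite ler_wpM2r.
have v2 : mu * (c2 * jM) * (a ^+ 2 + b ^+ 2) <= mu * (a ^+ 2 + b ^+ 2).
  by rewrite ler_wpM2r ?addr_ge0 // ler_piMr ?(ltW m0) // (le_trans cM1) // invf_le1 // ler1n.
have v3 : mu * jM * b ^+ 2 <= 36^-1 * b ^+ 2.
  by rewrite ler_wpM2r.
have v4 : mu * b ^+ 2 <= 32^-1 * b ^+ 2 by rewrite ler_wpM2r.
have v5 := ler_wpM2l (ltW m0) pa.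
have w1 : c2 * a ^+ 2 = 8 * (mu * a ^+ 2) by rewrite /mu; field.
have w2 : 0 <= mu * a ^+ 2 by rewrite mulr_ge0 // ltW.
rewrite !mulrDr in t2 t3 t4 v2 *; rewrite mulrDr in t1.
rewrite !mulrDl in v1.
clear -s1 s2 s3 s4 s5 s6 t1 t2 t3 t4 t5 v1 v2 v3 v4 v5 w1 w2 aa bb pa n0 nI m0; clearbody mu; lra.
Qed.

(** * Dynamics of the closed loop *)

Section ClosedLoop.
Context {R : realType} (n : nat) (pl : plant R n).

(** The feedback acts on the quadrotor position only, with unit gains; all gains
    on the links vanish, the links being damped through the quadrotor. *)
Definition design_gains (kz kI c2 : R) (P Q : 'M[R]_(dimx n + dimx n)) : gains R n :=
  Gains 1 (fun=> 0) 1 (fun=> 0) kz (fun=> 0) 1 1 kI c2 1 Q P.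

Variables (kz kI c2 : R) (P Q : 'M[R]_(dimx n + dimx n)) (W : 'M[R]_(dimx n)).
Hypothesis PB : forall s v : 'cV[R]_(dimx n),
  (P *m BB pl)^T *m col_mx s v = W *m s + v.

Let gn := design_gains kz kI c2 P Q.

Variables (Dx DR xd b1d eI0 : 'cV[R]_3) (ex0 : 'cV[R]_(dimx n)).
Variable tr : trajectory R n.
Hypothesis closed : closed_loop pl gn Dx DR xd b1d eI0 ex0 tr.

Definition perr (t : R) := pos tr t - xd.
Definition vel (t : R) := derive1 (pos tr) t.
Definition tilts (t : R) := fun i => xi tr i t.
Definition dtilts (t : R) := fun i => derive1 (xi tr i) t.
Definition dirs (t : R) := fun i => link tr i t.
Definition ddirs (t : R) := fun i => derive1 (link tr i) t.
(** The left-hand side of the translational equation, that is, the rate of change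
    of base_mom. *)
Definition force (t : R) : 'cV[R]_3 := M00 pl *: derive1 (derive1 (pos tr)) t
  + \sum_(i < n) M0 pl i *: derive1 (derive1 (link tr i)) t.

Let reg (t : R) : 0 <= t -> regular pl gn xd b1d tr t.
Proof. by move=> /closed[[]]. Qed.

Lemma perr_derive (t : R) : 0 <= t -> is_derive t 1 perr (vel t).
Proof.
move=> /reg[[d _] _ _ _ _]; rewrite -[vel t]subr0.
exact: is_derive_subf (is_derive1P d) (is_derive_constf _ _).
Qed.

Lemma tilts_derive (t : R) i : 0 <= t -> is_derive t 1 (fun s => tilts s i) (dtilts t i).
Proof. by move=> /reg[_ _ /(_ i)[d _] _ _]; exact: is_derive1P. Qed.

Lemma xx_derive (t : R) : 0 <= t ->
  is_derive t 1 (xx xd tr) (lin (vel t) (dtilts t)).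
Proof.
move=> t0; apply: is_derive_mkv; first exact: perr_derive.
by move=> i; apply: is_derive_mulmxl; exact: tilts_derive.
Qed.

Lemma z1E (t : R) : 0 <= t ->
  z1 xd tr t = col_mx (lin (perr t) (tilts t)) (lin (vel t) (dtilts t)).
Proof. by move=> t0; rewrite /z1 (derive1_is (xx_derive t0)). Qed.

Let vel_derive (t : R) : 0 <= t -> is_derive t 1 vel (derive1 (derive1 (pos tr)) t).
Proof. by move=> /reg[[_ d] _ _ _ _]; exact: is_derive1P. Qed.

Let dirs_derive (t : R) i : 0 <= t -> is_derive t 1 (fun s => dirs s i) (ddirs t i).
Proof. by move=> /reg[_ /(_ i)[d _] _ _ _]; exact: is_derive1P. Qed.

Let ddirs_derive (t : R) i : 0 <= t ->
  is_derive t 1 (fun s => ddirs s i) (derive1 (derive1 (link tr i)) t).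
Proof. by move=> /reg[_ /(_ i)[_ d] _ _ _]; exact: is_derive1P. Qed.

Lemma base_mom_derive (t : R) : 0 <= t ->
  is_derive t 1 (fun s => base_mom pl (vel s) (ddirs s)) (force t).
Proof.
move=> t0; apply: is_derive_addf; first by apply: is_derive_scale; exact: vel_derive.
by apply: is_derive_sumf => i; apply: is_derive_scale; exact: ddirs_derive.
Qed.

Let acc (t : R) := link_mom pl (derive1 (derive1 (pos tr)) t)
               (fun i => derive1 (derive1 (link tr i)) t).

Let link_mom_derive (t : R) i : 0 <= t ->
  is_derive t 1 (fun s => link_mom pl (vel s) (ddirs s) i) (acc t i).
Proof.
move=> t0; apply: is_derive_addf; first by apply: is_derive_scale; exact: vel_derive.
by apply: is_derive_sumf => j; apply: is_derive_scale; exact: ddirs_derive.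
Qed.

Let unit_dir (t : R) i : 0 <= t -> dotv (dirs t i) (dirs t i) = 1.
Proof.
move=> t0; have [_ [_ /(_ i) h _ _] _ _ _] := closed t0.
by rewrite -norm2_sqr h expr1n.
Qed.

Let dir_orth (t : R) i : 0 <= t -> dotv (ddirs t i) (dirs t i) = 0.
Proof.
move=> t0; have [_ _ _ [_ /(_ i) h] _] := closed t0; rewrite /ddirs h.
by rewrite !dotv3E !crossE /dirs; ring.
Qed.

(** The equation of link i says that the force that its outboard part needs in
    excess of gravity is carried by the tension of the link, along q_i. *)
Let link_balance (t : R) i : 0 <= t ->
  cross (dirs t i) (acc t i) = Gq pl i *: cross (dirs t i) (e3 R).
Proof.
move=> t0; have [_ _ [_ /(_ i) eqi _] _ _] := closed t0.
move: eqi; rewrite /eq_link -!mulmxA !hat_mul.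
move=> /(cross_projected (unit_dir i t0)) <-; congr cross.
have split_sum (v : 'cV[R]_3) (f : 'I_n -> 'cV[R]_3) :
    v + \sum_j f j = f i + (v + \sum_(j < n | j != i) f j).
  by rewrite (bigD1 i) //= addrCA.
exact: split_sum.
Qed.

Lemma momentum_derive (t : R) : 0 <= t ->
  is_derive t 1 (fun s => momentum pl (vel s) (dirs s) (ddirs s))
    (momentum_rate pl (force t) (vel t) (dirs t) (ddirs t)).
Proof.
move=> t0; apply: is_derive_mkv; first exact: base_mom_derive.
move=> i; apply: is_derive_mulmxl; rewrite -link_balance //.
by apply: is_derive_cross; [exact: dirs_derive|exact: link_mom_derive].
Qed.

(** The tensions do no work, because the links keep unit length. *)
Lemma energy_derive (t : R) : 0 <= t ->
  is_derive t 1 (fun s => energy pl (vel s) (dirs s) (ddirs s))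
    (2 * dotv (vel t) (force t)).
Proof.
move=> t0; set a := derive1 (derive1 (pos tr)) t.
pose b i := derive1 (derive1 (link tr i)) t.
have d : is_derive t 1 (fun s => energy pl (vel s) (dirs s) (ddirs s))
  ((dotv a (base_mom pl (vel t) (ddirs t)) + dotv (vel t) (force t))
   + \sum_i (dotv (b i) (link_mom pl (vel t) (ddirs t) i) + dotv (ddirs t i) (acc t i))
   + \sum_i 2 * Gq pl i * (0 - dotv (ddirs t i) (e3 R))).
  apply: is_derive_addf; first apply: is_derive_addf.
  - by apply: is_derive_dotv; [exact: vel_derive|exact: base_mom_derive].
  - apply: is_derive_sumf => i.
    by apply: is_derive_dotv; [exact: ddirs_derive|exact: link_mom_derive].
  - apply: is_derive_sumf => i; apply: is_derive_scaler; apply: is_derive_subf.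
    have := is_derive_dotv (dirs_derive i t0) (is_derive_constf (e3 R) t).
    by rewrite dotv0r addr0.
suff E : 2 * dotv (vel t) (force t) =
  ((dotv a (base_mom pl (vel t) (ddirs t)) + dotv (vel t) (force t))
   + \sum_i (dotv (b i) (link_mom pl (vel t) (ddirs t) i) + dotv (ddirs t i) (acc t i))
   + \sum_i 2 * Gq pl i * (0 - dotv (ddirs t i) (e3 R))) by rewrite E.
have tension i : dotv (ddirs t i) (acc t i) = Gq pl i * dotv (ddirs t i) (e3 R).
  set q := dirs t i; pose u := acc t i - Gq pl i *: e3 R.
  have qu : cross q u = 0.
    by rewrite /u crossDr crossNr crossZr link_balance // subrr.
  have uE : u = dotv q u *: q.
    have := cross_cross q u.
    rewrite qu -hat_mul mulmx0 unit_dir // scale1r => /esym/eqP.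
    by rewrite subr_eq0 => /eqP.
  have : dotv (ddirs t i) u = 0 by rewrite uE dotvZr dir_orth // mulr0.
  by rewrite /u dotvBr dotvZr => /eqP; rewrite subr_eq0 => /eqP.
have sym : dotv a (base_mom pl (vel t) (ddirs t))
    + \sum_i dotv (b i) (link_mom pl (vel t) (ddirs t) i)
  = dotv (vel t) (force t) + \sum_i dotv (ddirs t i) (acc t i).
  exact: (momentum_sym pl (vel t) a (ddirs t) b).
rewrite big_split /=.
have -> : \sum_i 2 * Gq pl i * (0 - dotv (ddirs t i) (e3 R))
   = - (2 * \sum_i dotv (ddirs t i) (acc t i)).
  rewrite mulr_sumr -sumrN; apply: eq_bigr => i _; rewrite tension; ring.
have alg (x y z u : R) : x + y = z + u -> 2 * z = x + z + (y + u) + - (2 * u).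
  by move=> e; rewrite -[y](addKr x) e; ring.
exact: alg sym.
Qed.

Lemma mech_derive (t : R) F : 0 <= t -> force t = F - perr t - vel t ->
  is_derive t 1
    (fun s => mech_fun pl W (perr s) (vel s) (tilts s) (dirs s) (ddirs s))
    (mech_rate pl W F (perr t) (vel t) (tilts t) (dtilts t) (dirs t) (ddirs t)).
Proof.
move=> t0 FE; rewrite /mech_rate -FE -addrA.
apply: is_derive_addf; first apply: is_derive_addf.
- exact: energy_derive.
- have h := perr_derive t0; have := is_derive_dotv h h.
  by rewrite dotvC -mulr2n mulr_natl.
- rewrite -mulrDr; apply: is_derive_scaler; apply: is_derive_dotv.
    by apply: is_derive_mulmxl; exact: xx_derive.
  exact: momentum_derive.
Qed.

(** The part of the thrust vector that the attitude error misdirects. *)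
Definition thrust_err (t : R) : 'cV[R]_3 :=
  let A := Athrust pl gn xd tr t in let b := att tr t *m e3 R in
  dotv A b *: b - A.

Let thrustE (t : R) : 0 <= t -> Athrust pl gn xd tr t =
  - perr t - vel t - kz *: topv (satv 1 (e_x tr t)) - (M00 pl * grav pl) *: e3 R.
Proof.
move=> t0; rewrite /Athrust (derive1_is (xx_derive t0)).
have E y (k : R) : gain_mx k (fun=> 0) *m y = k *: topv y.
  by rewrite -{1}(mkvK y) gain_mx_mkv.
rewrite /Kx /Kxdot /Kz /gn /= !E !scale1r.
by rewrite -[xx xd tr t]/(mkv (perr t) _) topv_mkv topv_mkv.
Qed.

(** Besides the PD feedback the quadrotor feels the disturbance, the integral
    action and the misdirected thrust; gravity is compensated. *)
Lemma forceE (t : R) : 0 <= t ->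
  force t = (Dx - kz *: topv (satv 1 (e_x tr t)) + thrust_err t) - perr t - vel t.
Proof.
move=> t0; have [_ _ [eqt _ _] _ _] := closed t0.
move: eqt; rewrite /eq_translation /force => ->; rewrite /thrust /thrust_err.
rewrite -scaleNr opprK; set A := Athrust _ _ _ _ _; have := thrustE t0; rewrite -/A.
set g := _ *: e3 R; set k := kz *: _; set b := dotv _ _ *: _ => ->.
apply/matrixP => i j; rewrite !mxE; ring.
Qed.

Lemma thrust_norm (t : R) : 0 <= t -> norm2 (Athrust pl gn xd tr t) <=
  norm2 (perr t) + norm2 (vel t) + norm2 (kz *: topv (satv 1 (e_x tr t)))
  + norm2 ((M00 pl * grav pl) *: e3 R).
Proof.
move=> t0; rewrite thrustE //.
apply: le_trans (norm2B _ _) _; rewrite lerD2r.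
apply: le_trans (norm2B _ _) _; rewrite lerD2r.
by apply: le_trans (norm2B _ _) _; rewrite norm2N.
Qed.

Local Notation Rct := (Rc pl gn xd b1d tr).
Local Notation Omct := (Omc pl gn xd b1d tr).
Local Notation eOm := (e_Om pl gn xd b1d tr).

Lemma b3c_unit (t : R) : 0 <= t ->
  dotv (b3c pl gn xd tr t) (b3c pl gn xd tr t) = 1.
Proof.
move=> t0; have [[_ A0 _] _ _ _ _] := closed t0; rewrite /b3c.
move: (Athrust _ _ _ _ _) A0 => A A0; rewrite -norm2_eq0 in A0.
by rewrite dotvNl dotvNr opprK dotvZl dotvZr -norm2_sqr; field.
Qed.

Lemma Rc_SO3 (t : R) : 0 <= t -> SO3 (Rct t).
Proof.
move=> t0; have [[_ _ c0] _ _ _ _] := closed t0.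
exact: (SO3_triad (b3c_unit t0) c0).
Qed.

Let att_SO3 (t : R) : 0 <= t -> SO3 (att tr t).
Proof. by move=> t0; have [_ [h _ _ _] _ _ _] := closed t0. Qed.

Definition err_rot (t : R) : 'M[R]_3 := (Rct t)^T *m att tr t.

Lemma err_rot_SO3 (t : R) : 0 <= t -> SO3 (err_rot t).
Proof. by move=> t0; apply: SO3_mul; [apply/SO3_tr/Rc_SO3|exact: att_SO3]. Qed.

Lemma e_RE (t : R) : e_R pl gn xd b1d tr t = rot_vec (err_rot t).
Proof. by rewrite /e_R /rot_vec /err_rot trmx_mul trmxK. Qed.

Let near_pos (t : R) : 0 < t -> \forall s \near t, 0 <= s.
Proof.
move=> t0; apply/nbhs_ballP; exists t => // s.
by rewrite /ball /= ltr_distlC subrr => /andP[/ltW].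
Qed.

(** Differentiating Rc^T Rc = 1, which holds on both sides of a positive time,
    shows that Rc^T Rc' is skew, hence the hat of its vee. *)
Lemma Rc_derive (t : R) : 0 < t -> is_derive t 1 Rct (Rct t *m hat (Omct t)).
Proof.
move=> t0; have [_ _ _ _ [dR _]] := reg (ltW t0).
have d := is_derive1P dR; have [orth _] := Rc_SO3 (ltW t0).
have eO : Omct t = vee ((Rct t)^T *m derive1 Rct t) by [].
move: d eO; set D := derive1 Rct t => d ->.
have d2 := is_derive_mulmx (is_derive_trmx d) d.
have z : D^T *m Rct t + (Rct t)^T *m D = 0.
  case: d2 => _ <-; rewrite -(derive_cst (1%:M : 'M[R]_3) t 1).
  apply: near_eq_derive; apply: filterS (near_pos t0) => s s0.
  by have [-> _] := Rc_SO3 s0.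
rewrite vee_hatK; first by rewrite mulmxA (mulmx1C orth) mul1mx.
by rewrite trmx_mul trmxK; apply/eqP; rewrite -addr_eq0 z.
Qed.

Let att_derive (t : R) : 0 <= t ->
  is_derive t 1 (att tr) (att tr t *m hat (angvel tr t)).
Proof.
move=> t0; have [_ _ _ [d _] _] := reg t0; have [_ _ _ [<- _] _] := closed t0.
exact: is_derive1P.
Qed.

Let Omct_derive (t : R) : 0 <= t -> is_derive t 1 Omct (derive1 Omct t).
Proof. by move=> /reg[_ _ _ _ [_ d]]; exact: is_derive1P. Qed.

Let angvel_derive (t : R) : 0 <= t ->
  is_derive t 1 (angvel tr) (derive1 (angvel tr) t).
Proof. by move=> /reg[_ _ _ [_ d] _]; exact: is_derive1P. Qed.

Let e_OmE (t : R) : eOm t = angvel tr t - (err_rot t)^T *m Omct t.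
Proof. by rewrite /e_Om /err_rot trmx_mul trmxK. Qed.

Lemma err_rot_derive (t : R) : 0 < t ->
  is_derive t 1 err_rot (err_rot t *m hat (eOm t)).
Proof.
move=> t0; have := is_derive_mulmx (is_derive_trmx (Rc_derive t0)) (att_derive (ltW t0)).
congr is_derive; have sE := err_rot_SO3 (ltW t0); have [oE _] := sE.
rewrite e_OmE hatB SO3_hat // mulmxBr !mulmxA (mulmx1C oE) mul1mx.
rewrite trmx_mul tr_hat !mulNmx -mulmxA addrC -/(err_rot t).
by rewrite /err_rot !mulmxA.
Qed.

Lemma err_rot_derivable (t : R) : 0 <= t -> derivable err_rot t 1.
Proof.
move=> t0; have [_ _ _ _ [dR _]] := reg t0.
by have [] := is_derive_mulmx (is_derive_trmx (is_derive1P dR)) (att_derive t0).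
Qed.

Lemma e_Om_derivable (t : R) : 0 <= t -> derivable eOm t 1.
Proof.
move=> t0; have dE := is_derive1P (err_rot_derivable t0).
have [] := is_derive_subf (angvel_derive t0)
  (is_derive_mulmx (is_derive_trmx dE) (Omct_derive t0)).
by rewrite (_ : (fun s => _) = eOm) //; apply/funext => s; rewrite e_OmE.
Qed.

(** The deviation of the integral term e_I from the value DR / kI that compensates
    the disturbance moment. *)
Definition int_err (t : R) : 'cV[R]_3 :=
  eI0 + vint (fun s => eOm s + c2 *: e_R pl gn xd b1d tr s) t - kI^-1 *: DR.

Lemma e_I_int_err (t : R) : 0 <= t -> e_I tr t = int_err t + kI^-1 *: DR.
Proof.
by move=> t0; have [_ _ _ _ [-> _]] := closed t0; rewrite /int_err subrK.
Qed.

Lemma attitude_error_dynamics (J E : 'M[R]_3) (Om w dOm Oc dOc r i D : 'cV[R]_3) :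
  w = Om - E^T *m Oc ->
  J *m dOm + hat Om *m J *m Om = - (1 *: r) - 1 *: w - kI *: i
    + cross Om (J *m Om) - J *m (hat Om *m E^T *m Oc - E^T *m dOc) + D ->
  J *m (dOm - ((E *m hat w)^T *m Oc + E^T *m dOc)) = - r - w - kI *: i + D.
Proof.
move=> wE; rewrite trmx_mul tr_hat -!mulmxA !hat_mul mulNmx hat_mul.
move: wE; set y := E^T *m Oc; set z := E^T *m dOc; move: y z => y z wE.
have -> : cross Om y = cross w y.
  by rewrite wE crossDl crossNl crossvv oppr0 addr0.
move=> e; have {e} e : J *m dOm
    = - r - w - kI *: i - J *m (cross w y - z) + D.
  apply: (addIr (cross Om (J *m Om))); rewrite e !scale1r.
  by apply/matrixP => a b; rewrite !mxE; ring.
rewrite opprD opprK addrA -addrA mulmxDr e.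
by apply/matrixP => a b; rewrite !mxE; ring.
Qed.

Lemma e_Om_derive (t : R) : 0 < t -> kI != 0 -> exists2 dw, is_derive t 1 eOm dw &
  inertia pl *m dw = - rot_vec (err_rot t) - eOm t - kI *: int_err t.
Proof.
move=> t0 kI0; have tn := ltW t0.
have d := is_derive_subf (angvel_derive tn)
  (is_derive_mulmx (is_derive_trmx (err_rot_derive t0)) (Omct_derive tn)).
eexists; first by apply: is_derive_ext d => s; exact: e_OmE.
have eT : (att tr t)^T *m Rct t = (err_rot t)^T by rewrite /err_rot trmx_mul trmxK.
have [_ _ [_ _ eqa] _ _] := closed tn; move: eqa.
rewrite /eq_attitude /moment eT e_RE (e_I_int_err tn).
move=> /(attitude_error_dynamics (e_OmE t)) ->.
rewrite scalerDr scalerA divff // scale1r -addrA; congr (_ + _).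
by rewrite (opprD (kI *: _)) subrK.
Qed.

Let int_err_integrand_continuous (t : R) : 0 <= t ->
  {for t, continuous (fun s => eOm s + c2 *: e_R pl gn xd b1d tr s)}.
Proof.
move=> t0; have dE := is_derive_rot_vec (is_derive1P (err_rot_derivable t0)).
apply: derivable_continuous.
have [] := is_derive_addf (is_derive1P (e_Om_derivable t0)) (is_derive_scale c2 dE).
by rewrite (_ : (fun s => _) = (fun s => eOm s + c2 *: e_R pl gn xd b1d tr s)) //;
   apply/funext => s; rewrite e_RE.
Qed.

Lemma int_err_derive (t : R) : 0 < t ->
  is_derive t 1 int_err (eOm t + c2 *: rot_vec (err_rot t)).
Proof.
move=> t0; have h := vint_derive int_err_integrand_continuous t0.
have := is_derive_subf (is_derive_addf (is_derive_constf eI0 t) h)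
  (is_derive_constf (kI^-1 *: DR) t).
by rewrite add0r subr0 e_RE.
Qed.

Lemma int_err0 : int_err 0 = eI0 - kI^-1 *: DR.
Proof. by rewrite /int_err vint0 addr0. Qed.

Lemma int_err_continuous (t : R) : 0 <= t -> {for t, continuous int_err}.
Proof.
rewrite le_eqVlt => /orP[/eqP <-|/int_err_derive[d _]]; last exact: derivable_continuous.
apply: cvgB; last exact: cvg_cst.
apply: cvgD; first exact: cvg_cst.
exact: (vint_continuous0 int_err_integrand_continuous).
Qed.

Definition posv (t : R) := lin (perr t) (tilts t).
Definition velv (t : R) := lin (vel t) (dtilts t).

Lemma posv_derive (t : R) : 0 <= t -> is_derive t 1 posv (velv t).
Proof. exact: xx_derive. Qed.

Lemma velv_derivable (t : R) : 0 <= t -> derivable velv t 1.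
Proof.
move=> t0; have h i : is_derive t 1 (fun s => (C32 R)^T *m dtilts s i)
    ((C32 R)^T *m derive1 (derive1 (xi tr i)) t).
  apply: is_derive_mulmxl; have [_ _ /(_ i)[_ d] _ _] := reg t0.
  exact: is_derive1P.
by have [] := is_derive_mkv (vel_derive t0) h.
Qed.

(** A version of e_x that is meaningful, and differentiable, without reference to
    the values of derivatives at negative times. *)
Definition int_pos (t : R) : 'cV[R]_(dimx n) :=
  ex0 + vint (fun s => W *m posv s + velv s) t.

Let int_pos_integrand_continuous (t : R) : 0 <= t ->
  {for t, continuous (fun s => W *m posv s + velv s)}.
Proof.
move=> t0; apply: derivable_continuous.
by have [] := is_derive_addf (is_derive_mulmxl W (posv_derive t0))
  (is_derive1P (velv_derivable t0)).
Qed.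

Lemma e_x_int_pos (t : R) : 0 <= t -> e_x tr t = int_pos t.
Proof.
move=> t0; have [_ _ _ _ [_ ->]] := closed t0; congr (_ + _).
apply/matrixP => i j; rewrite !mxE; apply: eq_Rintegral => s.
rewrite inE /= in_itv /= => /andP[s0 _].
by rewrite (z1E s0) PB.
Qed.

Lemma int_pos_derive (t : R) : 0 < t ->
  is_derive t 1 int_pos (W *m posv t + velv t).
Proof.
move=> t0; have h := vint_derive int_pos_integrand_continuous t0.
by have := is_derive_addf (is_derive_constf ex0 t) h; rewrite add0r.
Qed.

Lemma int_pos0 : int_pos 0 = ex0.
Proof. by rewrite /int_pos vint0 addr0. Qed.

Lemma int_pos_continuous (t : R) : 0 <= t -> {for t, continuous int_pos}.
Proof.
rewrite le_eqVlt => /orP[/eqP <-|/int_pos_derive[d _]]; last exact: derivable_continuous.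
apply: cvgD; first exact: cvg_cst.
exact: (vint_continuous0 int_pos_integrand_continuous).
Qed.

(** The misdirected thrust is the part of A orthogonal to the third body axis. *)
Lemma thrust_err_sqr (t : R) : 0 <= t ->
  dotv (thrust_err t) (thrust_err t) <=
  4 * norm2 (Athrust pl gn xd tr t) ^+ 2 * rot_err (err_rot t).
Proof.
move=> t0; set A := Athrust _ _ _ _ _; set b := att tr t *m e3 R.
have [/orthonormal_colv oa _] := att_SO3 t0.
have bE : b = colv (att tr t) 2%:R.
  by apply: vec3P; rewrite !mulmx3E !e3E !colvE; ring.
have bb : dotv b b = 1 by rewrite bE oa.
rewrite /thrust_err -/A -/b projection_error_sqr // -norm2_sqr.
have AE : A = - (norm2 A *: b3c pl gn xd tr t).
  have [[_ A0 _] _ _ _ _] := closed t0; rewrite /b3c -/A scalerN opprK scalerA.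
  by rewrite divff ?scale1r // norm2_eq0.
have b3E : dotv (b3c pl gn xd tr t) b = err_rot t 2%:R 2%:R.
  have [_ _ c2'] := row3E (- ((norm2 (hat (b3c pl gn xd tr t) *m hat (b3c pl gn xd tr t) *m b1d))^-1
     *: (hat (b3c pl gn xd tr t) *m hat (b3c pl gn xd tr t) *m b1d)))
    ((norm2 (hat (b3c pl gn xd tr t) *m b1d))^-1 *: (hat (b3c pl gn xd tr t) *m b1d))
    (b3c pl gn xd tr t).
  rewrite /err_rot mxE bE -[X in dotv X _]c2' /dotv; apply: eq_bigr => k _.
  by rewrite !mxE.
rewrite {2}AE dotvNl dotvZl b3E sqrrN exprMn.
have h := rot_axis_le (err_rot_SO3 t0).
have := ler_wpM2l (sqr_ge0 (norm2 A)) h; rewrite mulrBr mulr1 => /le_trans; apply.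
by rewrite mulrCA mulrA.
Qed.

End ClosedLoop.

(** * The position Lyapunov function *)

Section PositionFunction.
Context {R : realType} (n : nat) (pl : plant R n) (W : 'M[R]_(dimx n)).

Definition pos_fun (kz mu : R) (e x v : 'cV[R]_3) xi (q dq : 'I_n -> 'cV[R]_3) : R :=
  mech_fun pl W x v xi q dq + kz * dotv e e + mu * dotv (base_mom pl v dq) e.

(** The derivative of pos_fun when the force on the quadrotor is X - kz e besides
    the PD feedback, and e' = v + topv (W s). *)
Definition pos_rate (kz mu : R) (X e x v : 'cV[R]_3) xi dxi (q dq : 'I_n -> 'cV[R]_3) : R :=
  let e' := v + topv (W *m lin x xi) in
  mech_rate pl W (X - kz *: e) x v xi dxi q dq + kz * (2 * dotv e e')
  + mu * (dotv (X - kz *: e - x - v) e + dotv (base_mom pl v dq) e').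

End PositionFunction.

(** The work of the force - kz e in mech_rate and the derivative of kz |e|^2
    cancel; the cross term mu P0.e then makes e dissipate. *)
Lemma position_design (R : realType) (n : nat) (pl : plant R n)
    (W : 'M[R]_(dimx n)) (r q : R) : 0 < r -> 0 < q ->
  (forall s v : 'cV[R]_(dimx n), r * (dotv s s + dotv v v) <=
    dotv s (stiffness pl *m s) + 2 * dotv (W *m s) (Mlin pl *m v)
    + dotv v (Mlin pl *m v)) ->
  (forall s v : 'cV[R]_(dimx n), q * (dotv s s + dotv v v) <=
      2 * dotv (topv v) (topv v) - 2 * dotv (W *m v) (Mlin pl *m v)
      + 2 * dotv (W *m s) (stiffness pl *m s + Blin R n *m topv v)) ->
  exists mu r0 k CX l u : R,
  [/\ 0 < mu, 0 < r0 <= 4^-1, 0 < k, 0 < CX & 0 < l /\ 0 < u] /\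
  forall (kz : R) (d : @config R n) (e X : 'cV[R]_3), 1 <= kz -> config_ok d ->
    c_size d ^+ 2 = dotv (lin (c_x d) (c_xi d)) (lin (c_x d) (c_xi d))
      + dotv (lin (c_v d) (c_dxi d)) (lin (c_v d) (c_dxi d)) -> c_size d <= r0 ->
    [/\ l * (c_size d ^+ 2 + kz * dotv e e) <=
          pos_fun pl W kz mu e (c_x d) (c_v d) (c_xi d) (c_q d) (c_dq d),
        pos_fun pl W kz mu e (c_x d) (c_v d) (c_xi d) (c_q d) (c_dq d) <=
          u * (c_size d ^+ 2 + kz * dotv e e)
      & pos_rate pl W kz mu X e (c_x d) (c_v d) (c_xi d) (c_dxi d) (c_q d) (c_dq d)
        <= - (k * (c_size d ^+ 2 + kz * dotv e e)) + CX * dotv X X].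
Proof.
move=> r0 q0 hr hq.
have [C1 C10 h1] := mech_rate_upper hq; have [C2 C20 h2] := mech_fun_lower hr.
have [C3 C30 h3] := mech_fun_upper pl W; have [Cp Cp0 hp] := base_mom_bounded pl.
have [Cw' Cw'0 hw'] := mulmx_norm2_bounded W.
pose Cw := 1 + Cw'; have Cw0 : 0 < Cw by rewrite /Cw; lra.
(* the radius 1 / D makes the cubic remainders a fraction of r and q *)
pose D := 4 + 8 * C1 / q + 4 * C2 / r.
have D1 : 0 <= 8 * C1 / q by rewrite divr_ge0 ?(ltW q0) // mulr_ge0.
have D2 : 0 <= 4 * C2 / r by rewrite divr_ge0 ?(ltW r0) // mulr_ge0.
have D0 : 0 < D by rewrite /D; lra.
pose rr := D^-1; have rr0 : 0 < rr by rewrite invr_gt0.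
have rD : rr * D = 1 by rewrite mulVf ?gt_eqF.
have rq : C1 * rr <= q / 4.
  rewrite -(ler_pM2r D0) -mulrA rD mulr1.
  apply: (@le_trans _ _ (q / 4 * (8 * C1 / q))); last first.
    by rewrite ler_pM2l ?divr_gt0 // /D; lra.
  rewrite (_ : q / 4 * (8 * C1 / q) = 2 * C1); first by lra.
  by field; rewrite gt_eqF.
have rl : C2 * rr <= r / 4.
  rewrite -(ler_pM2r D0) -mulrA rD mulr1.
  apply: (@le_trans _ _ (r / 4 * (4 * C2 / r))); last first.
    by rewrite ler_pM2l ?divr_gt0 // /D; lra.
  by rewrite le_eqVlt; apply/orP; left; apply/eqP; field; rewrite gt_eqF.
(* mu = 1 / E makes the cross term mu P0.e and its derivative a fraction of
   the quadratic terms *)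
pose E := 1 + 4 * (4 + Cp * Cw) / q + 4 * Cp ^+ 2 / r.
have cpw : 0 <= Cp * Cw by rewrite mulr_ge0 // ltW.
have E1 : 0 <= 4 * (4 + Cp * Cw) / q by rewrite divr_ge0 ?(ltW q0) //; lra.
have E2 : 0 <= 4 * Cp ^+ 2 / r.
  by rewrite divr_ge0 ?(ltW r0) // mulr_ge0 ?sqr_ge0.
have E0 : 0 < E by rewrite /E; lra.
pose mu := E^-1; have m0 : 0 < mu by rewrite invr_gt0.
have mE : mu * E = 1 by rewrite mulVf ?gt_eqF.
have m1 : mu <= 1 by rewrite -mE ler_peMr ?(ltW m0) // /E; lra.
have mq : mu * (4 + Cp * Cw) <= q / 4.
  rewrite -(ler_pM2r E0) mulrAC mE mul1r.
  apply: (@le_trans _ _ (q / 4 * (4 * (4 + Cp * Cw) / q))); last first.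
    by rewrite ler_pM2l ?divr_gt0 // /E; lra.
  by rewrite le_eqVlt; apply/orP; left; apply/eqP; field; rewrite gt_eqF.
have mr : mu * Cp ^+ 2 <= r / 4.
  rewrite -(ler_pM2r E0) mulrAC mE mul1r.
  apply: (@le_trans _ _ (r / 4 * (4 * Cp ^+ 2 / r))); last first.
    by rewrite ler_pM2l ?divr_gt0 // /E; lra.
  by rewrite le_eqVlt; apply/orP; left; apply/eqP; field; rewrite gt_eqF.
pose CX := 4 * Cw ^+ 2 / q + 1.
have CX0 : 0 < CX by rewrite /CX ltr_wpDl // divr_ge0 ?(ltW q0) // mulr_ge0 ?sqr_ge0.
pose k := Num.min (q / 4) (mu / 2).
have k0 : 0 < k by rewrite lt_min !divr_gt0.
have kq : k <= q / 4 by rewrite ge_min lexx.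
have km : k <= mu / 2 by rewrite ge_min lexx orbT.
pose l := Num.min (r / 4) (4^-1).
have l0 : 0 < l by rewrite lt_min divr_gt0 //= invr_gt0.
have l1 : l <= r / 4 by rewrite ge_min lexx.
have l2 : l <= 4^-1 by rewrite ge_min lexx orbT.
pose u := C3 + 2 + Cp ^+ 2.
have u0 : 0 < u by rewrite /u ltr_wpDr ?sqr_ge0 // ltr_wpDl.
exists mu, rr, k, CX, l, u; split.
  split => //; rewrite rr0 /= -(ler_pM2r D0) rD.
  rewrite -ler_pdivrMl ?invr_gt0 // invrK mulr1 /D.
  by rewrite -addrA lerDl addr_ge0.
move=> kz d e X kz1 ok z2E small; set rho := c_size d in z2E small *.
have [/andP[p0 p1] [nx nv] _ _ _] := ok; rewrite -/rho in p0 p1 nx nv.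
set s := lin (c_x d) (c_xi d); set y := c_v d + topv (W *m s).
set P0 := base_mom pl (c_v d) (c_dq d).
pose ne := norm2 e; have ne0 : 0 <= ne := norm2_ge0 e.
pose nX := norm2 X; have nX0 : 0 <= nX := norm2_ge0 X.
have yb : norm2 y <= Cw * rho.
  apply: le_trans (norm2D _ _) _; rewrite /Cw mulrDl mul1r lerD //.
  apply: (@le_trans _ _ (norm2 (W *m s))).
    by rewrite -{2}(vsubmxK (W *m s)) norm2_col_mx_l.
  apply: le_trans (hw' s) _; rewrite ler_wpM2l // norm2_le_sqr // z2E.
  by rewrite lerDl dotvv_ge0.
have Pb : norm2 P0 <= Cp * rho.
  by have := hp d ok; rewrite ger0_norm ?norm2_ge0.
have Pe : `|dotv P0 e| <= Cp * rho * ne.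
  by apply: le_trans (abs_dotv_le _ _) _; rewrite ler_wpM2r.
have Py : dotv P0 y <= Cp * Cw * rho ^+ 2.
  apply: le_trans (ler_norm _) (le_trans (abs_dotv_le _ _) _).
  have -> : Cp * Cw * rho ^+ 2 = Cp * rho * (Cw * rho) by ring.
  by rewrite ler_pM ?norm2_ge0.
have yX : dotv y X <= Cw * rho * nX.
  by apply: le_trans (ler_norm _) (le_trans (abs_dotv_le _ _) _); rewrite ler_wpM2r.
have xe : - dotv (c_x d) e <= rho * ne.
  apply: (@le_trans _ _ `|dotv (c_x d) e|); first by rewrite -normrN ler_norm.
  by apply: le_trans (abs_dotv_le _ _) _; rewrite ler_wpM2r.
have ve : - dotv (c_v d) e <= rho * ne.
  apply: (@le_trans _ _ `|dotv (c_v d) e|); first by rewrite -normrN ler_norm.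
  by apply: le_trans (abs_dotv_le _ _) _; rewrite ler_wpM2r.
have Xe : dotv X e <= nX * ne.
  exact: le_trans (ler_norm _) (abs_dotv_le _ _).
have q2 := sqr_ge0 rho; have q3 : 0 <= ne ^+ 2 := sqr_ge0 ne.
have cub : rho ^+ 3 <= rr * rho ^+ 2.
  by rewrite exprS ler_wpM2r.
have kn : ne ^+ 2 <= kz * ne ^+ 2 by rewrite ler_peMl.
have eE : dotv e e = ne ^+ 2 by rewrite norm2_sqr.
have XE : dotv X X = nX ^+ 2 by rewrite norm2_sqr.
have Ple : mu * (Cp * rho * ne) <= r / 4 * rho ^+ 2 + 4^-1 * ne ^+ 2.
  have a := sqr_ge0 (Cp * rho - 2^-1 * ne).
  rewrite sqrrB !exprMn in a.
  have b := ler_wpM2r q2 mr.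
  have c := ler_wpM2l (ltW m0) a; have c2 : mu * ne ^+ 2 <= 1 * ne ^+ 2.
    by rewrite ler_wpM2r.
  by rewrite mulr0 in c; clear -a b c c2; clearbody mu; lra.
have Pup : mu * (Cp * rho * ne) <= Cp ^+ 2 * rho ^+ 2 + ne ^+ 2.
  have a := sqr_ge0 (Cp * rho - 2^-1 * ne); rewrite sqrrB !exprMn in a.
  have b : mu * (Cp * rho * ne) <= 1 * (Cp * rho * ne).
    by rewrite ler_wpM2r // !mulr_ge0.
  by have c := sqr_ge0 (Cp * rho); rewrite exprMn in c; clear -a b c q3; clearbody mu; lra.
have mPe : mu * `|dotv P0 e| <= mu * (Cp * rho * ne) by rewrite ler_wpM2l // ltW.
have nP : - (mu * `|dotv P0 e|) <= mu * dotv P0 e <= mu * `|dotv P0 e|.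
  by rewrite -mulrN !ler_pM2l // ler_norm andbT lerNl -normrN ler_norm.
have {nP} /andP[nP1 nP2] := nP.
split.
- rewrite /pos_fun eE -/P0; have := h2 d ok; rewrite -/rho -z2E.
  have := ler_wpM2l C20 cub; have := ler_wpM2r q2 rl.
  have := ler_wpM2r q2 l1; have := ler_wpM2r (le_trans q3 kn) l2.
  have := mulr_ge0 (ltW r0) q2.
  rewrite mulrDr; clear -Ple nP1 mPe kn q3; clearbody mu l rr rho P0; lra.
- rewrite /pos_fun eE -/P0; have := h3 d ok; rewrite -/rho => /(le_trans (ler_norm _)).
  have a : 0 <= (C3 + Cp ^+ 2) * (kz * ne ^+ 2).
    by rewrite mulr_ge0 ?addr_ge0 ?sqr_ge0 ?(le_trans q3 kn).
  rewrite /u; clear -a Pup nP2 mPe kn q2; clearbody mu rho P0; lra.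
- rewrite /pos_rate -/s -/y -/P0 eE XE.
  have := h1 d (X - kz *: e) ok; rewrite -/rho -z2E -/s -/y.
  set mrate := mech_rate _ _ _ _ _ _ _ _ _.
  rewrite !(dotvBl, dotvBr) dotvZl dotvZr eE (dotvC e y) => hm.
  have b1 := ler_wpM2l C10 cub; have b2 := ler_wpM2r q2 rq.
  have b3 : 2 * (Cw * rho * nX) <= q / 4 * rho ^+ 2 + 4 * Cw ^+ 2 / q * nX ^+ 2.
    have a := sqr_ge0 (q / 4 * rho - Cw * nX).
    have qn : q != 0 by rewrite gt_eqF.
    have iq : 0 <= 4 / q by rewrite divr_ge0 ?(ltW q0).
    have := mulr_ge0 iq a.
    have -> : 4 / q * (q / 4 * rho - Cw * nX) ^+ 2
       = q / 4 * rho ^+ 2 + 4 * Cw ^+ 2 / q * nX ^+ 2 - 2 * (Cw * rho * nX) by field.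
    by rewrite subr_ge0.
  have b4 : 2 * (rho * ne) <= 4^-1 * (kz * ne ^+ 2) + 4 * rho ^+ 2.
    have := amgm4 ne (2 * rho); rewrite exprMn => h.
    by clear -h kn; clearbody ne rho; lra.
  have b5 : nX * ne <= 4^-1 * (kz * ne ^+ 2) + nX ^+ 2.
    have := amgm4 ne nX; rewrite (mulrC ne) => h.
    by clear -h kn; clearbody ne nX; lra.
  have b6 : dotv X e - kz * ne ^+ 2 - dotv (c_x d) e - dotv (c_v d) e + dotv P0 y
     <= - (2^-1 * (kz * ne ^+ 2)) + nX ^+ 2 + (4 + Cp * Cw) * rho ^+ 2.
    by clear -b4 b5 Xe xe ve Py; clearbody ne nX y P0 rho Cw; lra.
  have b7 := ler_wpM2l (ltW m0) b6; have b8 := ler_wpM2r q2 mq.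
  have b9 : mu * nX ^+ 2 <= 1 * nX ^+ 2 by rewrite ler_wpM2r ?sqr_ge0.
  have d1 := ler_wpM2r q2 kq; have d2 := ler_wpM2r (le_trans q3 kn) km.
  rewrite /CX; clear -hm b1 b2 b3 b7 b8 b9 d1 d2 yX.
  clearbody mrate y k mu Cw rr nX ne P0 rho; lra.
Qed.

Section TrajectoryConfig.
Context {R : realType} (n : nat) (pl : plant R n) (gn : gains R n).
Variables (Dx DR xd b1d eI0 : 'cV[R]_3) (ex0 : 'cV[R]_(dimx n)).
Variable tr : trajectory R n.
Hypothesis closed : closed_loop pl gn Dx DR xd b1d eI0 ex0 tr.

Definition err_norm (t : R) : R := norm2 (col_mx (posv xd tr t) (velv tr t)).

Definition traj_config (t : R) : @config R n :=
  Config (perr xd tr t) (vel tr t) (tilts tr t) (dtilts tr t) (dirs tr t)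
         (ddirs tr t) (err_norm t).

Lemma err_norm_sqr (t : R) : err_norm t ^+ 2 =
  dotv (posv xd tr t) (posv xd tr t) + dotv (velv tr t) (velv tr t).
Proof. by rewrite /err_norm norm2_sqr dotv_col_mx. Qed.

(** The link estimates come from the Lipschitz and quadratic bounds of the
    exponential; 3 |xi| < 1 keeps its series under control. *)
Lemma traj_config_ok (t : R) : 0 <= t -> err_norm t <= 4^-1 ->
  config_ok (traj_config t).
Proof.
move=> t0 small.
have [[[[_ _] dl dx _ _] _ _] [_ _ _ coord] _ _ _] := closed t0.
have n0 : 0 <= err_norm t := norm2_ge0 _.
have sv : norm2 (posv xd tr t) <= err_norm t := norm2_col_mx_l _ _.
have vv : norm2 (velv tr t) <= err_norm t := norm2_col_mx_r _ _.
have orth i : dotv (tilts tr t i) (e3 R) = 0 by case: (coord i).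
have dorth i : dotv (dtilts tr t i) (e3 R) = 0.
  apply: right_derive_orth; first by case: (dx i).
  move=> s ts; have [_ [_ _ _ c] _ _ _] := closed (le_trans t0 ts).
  by case: (c i).
have xn i : norm2 (tilts tr t i) <= err_norm t.
  exact: le_trans (norm2_lin _ (orth i)) sv.
have dn i : norm2 (dtilts tr t i) <= err_norm t.
  exact: le_trans (norm2_lin _ (dorth i)) vv.
have x3 i : 3 * norm2 (tilts tr t i) < 1 by have := xn i; lra.
split => /=.
- by rewrite n0 /=; lra.
- split.
    have := norm2_topv (posv xd tr t); rewrite topv_mkv => /le_trans; exact.
  have := norm2_topv (velv tr t); rewrite topv_mkv => /le_trans; exact.
- by move=> i; split; [exact: xn|exact: dn].
- by move=> i; split; [exact: orth|exact: dorth].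
- move=> i; have [_ qE] := coord i; have n1 := norm2_ge0 (tilts tr t i).
  have x1 := ltW (x3 i).
  rewrite [dirs tr t i]qE; split.
  + apply: le_trans (link_direction x1) _.
    by rewrite ler_pM2l // ler_sqr ?nnegrE.
  + apply: (@le_trans _ _ (18 * norm2 (tilts tr t i) * norm2 (dtilts tr t i))).
      apply: (@link_velocity R (xi tr i) (link tr i)).
      * by case: (dx i).
      * by case: (dl i).
      * exact: x3.
      * move=> s ts; have [_ [_ _ _ c] _ _ _] := closed (le_trans t0 ts).
        by case: (c i).
    by rewrite -mulrA ler_pM2l // expr2 ler_pM ?norm2_ge0.
  + apply: le_trans (link_height x1 (orth i)) _.
    by rewrite ler_pM2l // lerXn2r // ?nnegrE.
Qed.

End TrajectoryConfig.

(** * Decay of the attitude errors along a trajectory *)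

Section AttitudeTrajectory.
Context {R : realType} (J : 'M[R]_3).
Variables (kI c2 mu : R).

Lemma att_fun_derive (A : R -> 'M[R]_3) (w i : R -> 'cV[R]_3) (dw : 'cV[R]_3) (t : R) :
  J^T = J ->
  is_derive t 1 A (A t *m hat (w t)) -> is_derive t 1 w dw ->
  is_derive t 1 i (w t + c2 *: rot_vec (A t)) ->
  is_derive t 1 (fun s => att_fun J kI c2 mu (A s) (w s) (i s))
    (att_rate J kI c2 mu (A t) (w t) dw (i t)).
Proof.
move=> Js dA dw' di; have dJ := is_derive_mulmxl J dw'.
have dv := is_derive_rot_vec dA; have dr := is_derive_rot_err dA.
rewrite rot_err_rate in dr.
have sym : dotv dw (J *m w t) = dotv (w t) (J *m dw) by rewrite dotv_mulmx Js dotvC.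
have d := is_derive_addf (is_derive_addf (is_derive_addf (is_derive_addf
  (is_derive_scaler 2^-1 (is_derive_dotv dw' dJ)) dr)
  (is_derive_scaler c2 (is_derive_dotv dv dJ)))
  (is_derive_scaler (2^-1 * kI) (is_derive_dotv di di)))
  (is_derive_scaler mu (is_derive_dotv di dJ)).
move: d; congr is_derive; rewrite /att_rate sym (dotvC _ (i t)).
by field.
Qed.

Lemma att_fun_continuous (A : R -> 'M[R]_3) (w i : R -> 'cV[R]_3) (t : R) :
  derivable A t 1 -> derivable w t 1 -> {for t, continuous i} ->
  {for t, continuous (fun s => att_fun J kI c2 mu (A s) (w s) (i s))}.
Proof.
move=> dA dw ci.
have cr : {for t, continuous (fun s => rot_err (A s))}.
  apply: derivable_continuous.
  by have [] := is_derive_rot_err (is_derive1P dA).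
have cv : {for t, continuous (fun s => rot_vec (A s))}.
  apply: derivable_continuous.
  by have [] := is_derive_rot_vec (is_derive1P dA).
have cw := derivable_continuous dw.
have cJ : {for t, continuous (fun s => J *m w s)} by apply: cvg_mulmx.
have sc a (f : R -> R) : {for t, continuous f} -> {for t, continuous (fun s => a * f s)}.
  by move=> cf; apply: cvgM => //; exact: cvg_cst.
have cd (f g : R -> 'cV[R]_3) : {for t, continuous f} -> {for t, continuous g} ->
    {for t, continuous (fun s => dotv (f s) (g s))} by move=> cf cg; apply: cvg_dotv.
apply: cvgD; last by apply: sc; exact: cd.
apply: cvgD; last by apply: sc; exact: cd.
apply: cvgD; last by apply: sc; exact: cd.
by apply: cvgD => //; apply: sc; exact: cd.
Qed.

End AttitudeTrajectory.

Section AttitudeDecay.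
Context {R : realType} (n : nat) (pl : plant R n).
Variables (kz kI c2 : R) (P Q : 'M[R]_(dimx n + dimx n)).
Variables (Dx DR xd b1d eI0 : 'cV[R]_3) (ex0 : 'cV[R]_(dimx n)).
Variable tr : trajectory R n.
Hypothesis closed :
  closed_loop pl (design_gains kz kI c2 P Q) Dx DR xd b1d eI0 ex0 tr.
Variables (mu k cl cu : R).
Hypothesis Jpos : posdef (inertia pl).
Hypotheses (kI1 : 1 <= kI) (k0 : 0 < k) (cl0 : 0 < cl).
Let gn := design_gains kz kI c2 P Q.
Let J := inertia pl.

Hypothesis design : forall (A : 'M[R]_3) (w i : 'cV[R]_3),
    SO3 A -> rot_err A <= 1 ->
    [/\ cl * att_size kI A w i <= att_fun J kI c2 mu A w i,
        att_fun J kI c2 mu A w i <= cu * att_size kI A w i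
      & forall dw, J *m dw = - rot_vec A - w - kI *: i ->
        att_rate J kI c2 mu A w dw i <= - (k * att_fun J kI c2 mu A w i)].

Let E := err_rot pl kz kI c2 P Q xd b1d tr.
Let w := e_Om pl gn xd b1d tr.
Let i := int_err pl kz kI c2 P Q DR xd b1d eI0 tr.

Definition att_val (t : R) : R := att_fun J kI c2 mu (E t) (w t) (i t).
Definition att_err (t : R) : R := att_size kI (E t) (w t) (i t).

Lemma att_val_derive (t : R) : 0 < t -> exists2 dw,
  J *m dw = - rot_vec (E t) - w t - kI *: i t
  & is_derive t 1 att_val (att_rate J kI c2 mu (E t) (w t) dw (i t)).
Proof.
move=> t0; have kIn : kI != 0 by rewrite gt_eqF // (lt_le_trans ltr01).
have [dw ddw dwE] := e_Om_derive closed t0 kIn.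
exists dw; first exact: dwE.
have [Js _] := Jpos; apply: att_fun_derive => //.
  exact: (err_rot_derive closed t0).
exact: (int_err_derive closed t0).
Qed.

Lemma att_val_continuous (t : R) : 0 <= t -> {for t, continuous att_val}.
Proof.
move=> t0; apply: att_fun_continuous.
- exact: (err_rot_derivable closed t0).
- exact: (e_Om_derivable closed t0).
- exact: (int_err_continuous closed t0).
Qed.

Lemma att_err_ge (t : R) : 0 <= t ->
  0 <= rot_err (E t) /\ rot_err (E t) <= att_err t.
Proof.
move=> t0; have r0 := rot_err_ge0 (err_rot_SO3 closed t0).
rewrite /att_err /att_size -/E; move: r0; rewrite -/E.
have := dotvv_ge0 (w t); have : 0 <= kI * dotv (i t) (i t).
  by rewrite mulr_ge0 ?dotvv_ge0 // (le_trans ler01).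
by move: (rot_err _) (dotv (w t) _) (kI * _) => a b c; split => //; lra.
Qed.

(** The sublevel set of the Lyapunov function that stays away from the rotations
    by an angle of pi/2 is invariant, and the attitude error decays in it
    whatever the motion of the cable. *)
Lemma attitude_decay : rot_err (E 0) < 1 -> cu * att_err 0 <= cl / 2 ->
  (forall t : R, 0 <= t -> rot_err (E t) <= 1) /\
  forall t : R, 0 < t -> derivable att_val t 1 /\ derive1 att_val t <= - (k * att_val t).
Proof.
move=> r01 small.
have so (t : R) : 0 <= t -> SO3 (E t) by move=> h; exact: (err_rot_SO3 closed).
have dv (s : R) : 0 < s -> rot_err (E s) <= 1 -> derive1 att_val s <= - (k * att_val s).
  move=> s0 r1; have [dw dwE dS] := att_val_derive s0; rewrite (derive1_is dS).
  by have [_ _] := design (w s) (i s) (so _ (ltW s0)) r1; apply.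
have S0 : att_val 0 <= cl / 2.
  by apply: le_trans small; have [_ ] := design (w 0) (i 0) (so _ (lexx 0)) (ltW r01).
have B := @barrier R att_val (fun t => rot_err (E t)) k (cl / 2) (ltW k0)
  att_val_continuous.
have {}B : forall t : R, 0 <= t -> rot_err (E t) <= 2^-1 /\
    att_val t <= att_val 0 * expR (- (k * t)).
  apply: B; last exact: S0; last exact: ltW r01.
  - move=> t t0; apply: derivable_continuous.
    by have [] := is_derive_rot_err (is_derive1P (err_rot_derivable closed t0)).
  - by move=> t t0; have [dw _ []] := att_val_derive t0.
  - exact: dv.
  - move=> t t0 r1; have [h _ _] := design (w t) (i t) (so _ t0) r1.
    have [h1 h2] := att_err_ge t0.
    apply: le_trans h; rewrite mulr_ge0 ?(ltW cl0) //; exact: le_trans h1 h2.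
  - move=> t t0 r1 hS; have [h _ _] := design (w t) (i t) (so _ t0) r1.
    have [h1 h2] := att_err_ge t0.
    rewrite -(ler_pM2l cl0); apply: le_trans hS; apply: le_trans h.
    by rewrite ler_pM2l.
have half : (2^-1 : R) <= 1 by rewrite invf_le1 // ler1n.
have r1 (t : R) : 0 <= t -> rot_err (E t) <= 1.
  by move=> /B[h _]; exact: le_trans h half.
split=> [//|t t0]; have [dw _ [d _]] := att_val_derive t0.
by split; [exact: d|exact: dv t0 (r1 _ (ltW t0))].
Qed.

End AttitudeDecay.

(** * Decay of the position errors along a trajectory *)

(** The attitude function pays, with the weight g, for the force that the
    attitude error misdirects. *)
Lemma cascade_rate (R : realFieldType) (k1 u k2 g CX c a X2 N S1 S2 dS1 dS2 psi kap : R) :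
  0 <= CX -> 0 < u -> 0 <= g -> 0 <= k2 -> 0 <= psi -> 0 <= N -> 0 <= kap ->
  dS1 <= - (k1 * N) + CX * X2 -> X2 <= 4 * a ^+ 2 * psi -> c * psi <= S2 ->
  dS2 <= - (k2 * S2) -> S1 <= u * N -> 0 <= S2 ->
  8 * CX * a ^+ 2 <= g * k2 * c -> kap * u <= k1 -> kap <= k2 / 2 ->
  dS1 + g * dS2 <= - (kap * (S1 + g * S2)).
Proof.
move=> CX0 u0 g0 k20 psi0 N0 kap0 d1 hX hS2 d2 hS1 S20 hg h1 h2.
have a1 := ler_wpM2l CX0 hX.
have a2 := ler_wpM2r psi0 hg.
have a3 := ler_wpM2l (mulr_ge0 g0 k20) hS2.
have a4 := ler_wpM2l kap0 hS1.
have a5 := ler_wpM2r N0 h1.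
have a6 := ler_wpM2l g0 d2.
have a7 := ler_wpM2r (mulr_ge0 g0 S20) h2.
lra.
Qed.

Section PositionDecay.
Context {R : realType} (n : nat) (pl : plant R n).
Variables (kz kI c2 : R) (P Q : 'M[R]_(dimx n + dimx n)) (W : 'M[R]_(dimx n)).
Hypothesis PB : forall s v : 'cV[R]_(dimx n),
  (P *m BB pl)^T *m col_mx s v = W *m s + v.
Variables (Dx DR xd b1d eI0 : 'cV[R]_3) (ex0 : 'cV[R]_(dimx n)).
Variable tr : trajectory R n.
Hypothesis closed :
  closed_loop pl (design_gains kz kI c2 P Q) Dx DR xd b1d eI0 ex0 tr.
Variables (mu r0 k1 CX l u : R).
Hypotheses (r0gt : 0 < r0) (r04 : r0 <= 4^-1) (k10 : 0 < k1) (CX0 : 0 < CX).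
Hypotheses (l0 : 0 < l) (lu : l <= u).

Hypothesis design : forall (d : @config R n) (e X : 'cV[R]_3), config_ok d ->
    c_size d ^+ 2 = dotv (lin (c_x d) (c_xi d)) (lin (c_x d) (c_xi d))
      + dotv (lin (c_v d) (c_dxi d)) (lin (c_v d) (c_dxi d)) -> c_size d <= r0 ->
    [/\ l * (c_size d ^+ 2 + kz * dotv e e) <=
          pos_fun pl W kz mu e (c_x d) (c_v d) (c_xi d) (c_q d) (c_dq d),
        pos_fun pl W kz mu e (c_x d) (c_v d) (c_xi d) (c_q d) (c_dq d) <=
          u * (c_size d ^+ 2 + kz * dotv e e)
      & pos_rate pl W kz mu X e (c_x d) (c_v d) (c_xi d) (c_dxi d) (c_q d) (c_dq d)
        <= - (k1 * (c_size d ^+ 2 + kz * dotv e e)) + CX * dotv X X].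

Let gn := design_gains kz kI c2 P Q.
Let x : R -> 'cV[R]_3 := perr xd tr.
Let v : R -> 'cV[R]_3 := vel tr.
Let s := posv xd tr.
Let ex := int_pos W xd ex0 tr.

(** The deviation of the integral term from the value that compensates Dx. *)
Definition comp_err (t : R) : 'cV[R]_3 := topv (ex t) - kz^-1 *: Dx.

Let e' t := v t + topv (W *m s t).

Lemma comp_err_derive (t : R) : 0 < t -> is_derive t 1 comp_err (e' t).
Proof.
move=> t0; have h := int_pos_derive W closed t0.
have := is_derive_subf (is_derive_topv h) (is_derive_constf (kz^-1 *: Dx) t).
congr is_derive; rewrite subr0 /e' addrC /topv linearD; congr (_ + _).
exact: topv_mkv.
Qed.

Lemma comp_err_continuous (t : R) : 0 <= t -> {for t, continuous comp_err}.
Proof.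
move=> t0; apply: cvgB; last exact: cvg_cst.
have h : {for t, continuous ex} by exact: (int_pos_continuous closed t0).
apply: cvg_mx => i j; rewrite mxE; under eq_fun do rewrite mxE.
exact: cvg_entry h.
Qed.

Definition pos_val (t : R) : R := pos_fun pl W kz mu (comp_err t) (x t) (v t)
  (tilts tr t) (dirs tr t) (ddirs tr t).

Definition pos_err (t : R) : R :=
  err_norm xd tr t ^+ 2 + kz * dotv (comp_err t) (comp_err t).

Lemma pos_val_derive (t : R) F : 0 < t -> force pl tr t = F - x t - v t ->
  is_derive t 1 pos_val
   (mech_rate pl W F (x t) (v t) (tilts tr t) (dtilts tr t) (dirs tr t) (ddirs tr t)
    + kz * (2 * dotv (comp_err t) (e' t))
    + mu * (dotv (F - x t - v t) (comp_err t)
            + dotv (base_mom pl (v t) (ddirs tr t)) (e' t))).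
Proof.
move=> t0 FE; have d1 := mech_derive W closed (ltW t0) FE.
have d2 := comp_err_derive t0; have d3 := base_mom_derive closed (ltW t0).
have := is_derive_addf (is_derive_addf d1 (is_derive_scaler kz (is_derive_dotv d2 d2)))
  (is_derive_scaler mu (is_derive_dotv d3 d2)).
congr is_derive; rewrite -FE (dotvC (e' t)); congr (_ + _ + _).
by rewrite mulr_natl mulr2n.
Qed.

Lemma pos_val_derivable (t : R) : 0 < t -> derivable pos_val t 1.
Proof.
move=> t0; have FE : force pl tr t = (force pl tr t + v t + x t) - x t - v t.
  by rewrite addrK addrK.
by have [] := pos_val_derive t0 FE.
Qed.

Lemma pos_val_continuous (t : R) : 0 <= t -> {for t, continuous pos_val}.
Proof.
move=> t0; have FE : force pl tr t = (force pl tr t + v t + x t) - x t - v t.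
  by rewrite addrK addrK.
have [d1 _] := mech_derive W closed t0 FE.
have [d3 _] := base_mom_derive closed t0.
have ce := comp_err_continuous t0.
apply: cvgD; first apply: cvgD.
- exact: derivable_continuous d1.
- by apply: cvgM; [exact: cvg_cst|exact: cvg_dotv].
- apply: cvgM; first exact: cvg_cst.
  by apply: cvg_dotv; [exact: derivable_continuous d3|exact: ce].
Qed.

Variables (av : R -> R) (k2 cl : R).
Hypotheses (k20 : 0 < k2) (cl0 : 0 < cl).
Hypothesis av_continuous : forall t : R, 0 <= t -> {for t, continuous av}.
Hypothesis av_derivable : forall t : R, 0 < t -> derivable av t 1.
Hypothesis av_rate : forall t : R, 0 < t -> derive1 av t <= - (k2 * av t).
Hypothesis av_ge : forall t : R, 0 <= t ->
  cl * rot_err (err_rot pl kz kI c2 P Q xd b1d tr t) <= av t.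

Variables (K d2 : R).
Hypotheses (K0 : 0 < K) (Dd : norm2 Dx <= d2).
Hypotheses (kz_sat : 2 + K + d2 <= kz) (kz_r0 : K / r0 ^+ 2 <= kz).

(** A bound on the thrust vector as long as the errors are in the region. *)
Let Amax := 2 + K + d2 + norm2 ((M00 pl * grav pl) *: e3 R).

(** The weight makes half of the decay of the attitude function cover
    CX |X|^2, which is at most 4 CX Amax^2 rot_err. *)
Definition cascade_weight : R := 8 * CX * Amax ^+ 2 / (k2 * cl).
Definition cascade_decay_rate : R := Num.min (k1 / u) (k2 / 2).
Local Notation gam := cascade_weight.
Local Notation kap := cascade_decay_rate.

Let kz1 : 1 <= kz.
Proof.
have d0 := le_trans (norm2_ge0 Dx) Dd; apply: le_trans kz_sat.
by move: K0 d0; move: K d2 => a b ha hb; rewrite -addrA -[leLHS]addr0 lerD ?addr_ge0 ?ler1n // ltW.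
Qed.

Let kz0 : 0 < kz. Proof. exact: lt_le_trans ltr01 kz1. Qed.

Let u0 : 0 < u. Proof. exact: lt_le_trans l0 lu. Qed.

(** region t <= 1 bounds the errors by r0, where the linearization dominates, and
    kz times the compensation error by about sqrt K, which bounds the thrust. *)
Definition region (t : R) : R :=
  err_norm xd tr t ^+ 2 / r0 ^+ 2 + kz ^+ 2 * dotv (comp_err t) (comp_err t) / K.

Lemma region_bounds (t : R) : region t <= 1 ->
  err_norm xd tr t <= r0 /\ norm2 (kz *: comp_err t) <= K + 1.
Proof.
rewrite /region; set e := err_norm xd tr t; set c := dotv _ _.
have c0 : 0 <= c by exact: dotvv_ge0.
have e0 : 0 <= e by exact: norm2_ge0.
have a0 : 0 <= e ^+ 2 / r0 ^+ 2 by rewrite divr_ge0 ?sqr_ge0.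
have b0 : 0 <= kz ^+ 2 * c / K by rewrite divr_ge0 ?mulr_ge0 ?sqr_ge0 // ltW.
move=> h; split.
  rewrite -ler_sqr ?nnegrE // ?(ltW r0gt) //.
  rewrite -[leRHS]mul1r -ler_pdivrMr ?exprn_gt0 //; apply: le_trans h.
  by rewrite lerDl.
rewrite norm2_le_sqr; last by rewrite addr_ge0 // ltW.
rewrite dotvZl dotvZr mulrA -expr2 -/c.
have h2 : kz ^+ 2 * c <= K.
  rewrite -[leRHS]mul1r -ler_pdivrMr //; apply: le_trans h.
  by rewrite lerDr.
apply: le_trans h2 _; rewrite sqrrD1; have := sqr_ge0 K; have := K0.
rewrite mulr2n; move: (K ^+ 2) => K2 h3 h4; lra.
Qed.

Let topv_ex (t : R) : kz *: topv (ex t) = kz *: comp_err t + Dx.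
Proof.
by rewrite /comp_err scalerBr scalerA divff ?gt_eqF // scale1r subrK.
Qed.

(** In the region the integral gain is large enough to keep the integral term
    away from saturation. *)
Lemma unsaturated (t : R) : 0 <= t -> region t <= 1 ->
  topv (satv 1 (e_x tr t)) = topv (ex t).
Proof.
move=> t0 /region_bounds[_ h].
have n1 : norm2 (topv (ex t)) <= 1.
  rewrite -(ler_pM2l kz0) mulr1 -{1}(gtr0_norm kz0) -norm2Z topv_ex.
  apply: le_trans (norm2D _ _) _; apply: le_trans kz_sat.
  apply: le_trans (lerD h Dd) _; lra.
rewrite (e_x_int_pos PB closed t0) -/ex; move: (ex t) n1 => f n1.
apply/matrixP => i j; rewrite ord1.
have := le_trans (entry_le_norm2 (topv f) i) n1.
rewrite /topv /satv !mxE /sat; move: (f _ _) => y; rewrite ler_norml => /andP[y1 y2].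
by rewrite !ltNge y1 y2.
Qed.

Lemma thrust_bounded (t : R) : 0 <= t -> region t <= 1 ->
  norm2 (Athrust pl gn xd tr t) <= Amax.
Proof.
move=> t0 hr; have [he hk] := region_bounds hr.
apply: le_trans (thrust_norm closed t0) _; rewrite lerD2r unsaturated // topv_ex.
have h1 := norm2D (kz *: comp_err t) Dx.
have sv : norm2 (posv xd tr t) <= err_norm xd tr t := norm2_col_mx_l _ _.
have vv : norm2 (velv tr t) <= err_norm xd tr t := norm2_col_mx_r _ _.
have hx : norm2 (x t) <= err_norm xd tr t.
  by have := norm2_topv (posv xd tr t); rewrite topv_mkv => /le_trans; exact.
have hv : norm2 (v t) <= err_norm xd tr t.
  by have := norm2_topv (velv tr t); rewrite topv_mkv => /le_trans; exact.
have he4 := le_trans he r04.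
have -> : 2 + K + d2 = 4^-1 + 4^-1 + (K + 1 + d2) + 2^-1 by lra.
apply: ler_wpDr; first by rewrite invr_ge0.
apply: lerD; first by apply: lerD; [exact: le_trans hx he4|exact: le_trans hv he4].
exact: le_trans h1 (lerD hk Dd).
Qed.

Let gam0 : 0 < gam.
Proof.
have a0 : 0 < Amax.
  apply: ltr_wpDr; first exact: norm2_ge0.
  apply: ltr_wpDr; first exact: le_trans (norm2_ge0 Dx) Dd.
  by rewrite addr_gt0.
by rewrite divr_gt0 ?mulr_gt0 // exprn_gt0.
Qed.

Let kap0 : 0 < kap.
Proof. by rewrite lt_min !divr_gt0. Qed.

Let pos_err_ge0 (t : R) : 0 <= pos_err t.
Proof. by rewrite addr_ge0 ?sqr_ge0 // mulr_ge0 ?dotvv_ge0 // ltW. Qed.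

Let region_small (t : R) : pos_err t <= K / (4 * kz) -> region t <= 2^-1.
Proof.
rewrite /pos_err /region; set e := err_norm _ _ _ ^+ 2; set c := dotv _ _ => h.
have e0 : 0 <= e by exact: sqr_ge0.
have rk : (r0 ^+ 2)^-1 <= kz / K.
  by rewrite ler_pdivlMr // mulrC.
have h1 := ler_wpM2l e0 rk.
have kK : 0 <= kz / K by rewrite divr_ge0 // ltW.
have h2 := ler_wpM2l kK h.
have E1 : kz / K * (K / (4 * kz)) = 4^-1 by field; rewrite !gt_eqF.
have E2 : kz ^+ 2 * c / K = kz / K * (kz * c) by field; rewrite gt_eqF.
rewrite E1 in h2; rewrite E2; move: h1 h2; rewrite mulrDr (mulrC e (kz / K)).
by move: (e / _) (kz / K * e) (kz / K * _) => a b d h1 h2; lra.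
Qed.

Let in_region (t : R) (X : 'cV[R]_3) : 0 <= t -> region t <= 1 ->
  [/\ l * pos_err t <= pos_val t, pos_val t <= u * pos_err t
    & pos_rate pl W kz mu X (comp_err t) (x t) (v t) (tilts tr t) (dtilts tr t)
        (dirs tr t) (ddirs tr t) <= - (k1 * pos_err t) + CX * dotv X X].
Proof.
move=> t0 /region_bounds[he _].
have := @design (traj_config xd tr t) (comp_err t) X
  (traj_config_ok closed t0 (le_trans he r04)).
by apply; [exact: err_norm_sqr|exact: he].
Qed.

Let pos_val_rate (t : R) : 0 < t -> region t <= 1 ->
  derive1 pos_val t <= - (k1 * pos_err t)
    + CX * dotv (thrust_err pl kz kI c2 P Q xd tr t) (thrust_err pl kz kI c2 P Q xd tr t).
Proof.
move=> t0 hr; set X := thrust_err _ _ _ _ _ _ _ _ _.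
have FE : force pl tr t = (X - kz *: comp_err t) - x t - v t.
  rewrite (forceE closed (ltW t0)) -/X (unsaturated (ltW t0) hr) topv_ex opprD.
  rewrite -/x -/v; congr (_ - _ - _).
  by rewrite (addrC Dx) subrK addrC.
rewrite (derive1_is (pos_val_derive t0 FE)).
by have [_ _] := @in_region t X (ltW t0) hr.
Qed.

Let av_ge0 (t : R) : 0 <= t -> 0 <= av t.
Proof.
move=> t0; apply: le_trans (av_ge t0).
by rewrite mulr_ge0 ?(ltW cl0) //; exact: rot_err_ge0 (err_rot_SO3 closed t0).
Qed.

(** In the region the sum of the two Lyapunov functions decays, and once it is
    small it confines the errors to the interior of the region. *)
Lemma position_decay :
  u * pos_err 0 + gam * av 0 <= l * (K / (4 * kz)) ->
  forall t : R, 0 <= t ->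
  l * pos_err t + gam * av t
    <= (u * pos_err 0 + gam * av 0) * expR (- (kap * t)).
Proof.
move=> small.
pose S t : R := pos_val t + gam * av t.
have reg0 : region 0 <= 2^-1.
  apply: region_small; rewrite -(ler_pM2l l0); apply: le_trans small.
  rewrite -[leLHS]addr0; apply: lerD; first by rewrite ler_wpM2r.
  by rewrite mulr_ge0 ?av_ge0 // ltW.
have half : (2^-1 : R) <= 1 by rewrite invf_le1 // ler1n.
have S0 : S 0 <= u * pos_err 0 + gam * av 0.
  by rewrite lerD2r; have [_ h _] := in_region 0 (lexx 0) (le_trans reg0 half).
have S_ge (t : R) : 0 <= t -> region t <= 1 -> l * pos_err t + gam * av t <= S t.
  by move=> t0 hr; rewrite lerD2r; have [h _ _] := in_region 0 t0 hr.
have B : forall t : R, 0 <= t ->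
    region t <= 2^-1 /\ S t <= S 0 * expR (- (kap * t)).
  apply: (@barrier R S region kap (l * (K / (4 * kz))) (ltW kap0)).
  - move=> t t0; apply: cvgD; first exact: pos_val_continuous.
    by apply: cvgM; [exact: cvg_cst|exact: av_continuous].
  - move=> t t0; have ce := comp_err_continuous t0.
    have cs : {for t, continuous (posv xd tr)}.
      by apply: derivable_continuous; have [] := posv_derive closed t0.
    have cv := derivable_continuous (velv_derivable closed t0).
    have ce2 : {for t, continuous (fun s => err_norm xd tr s ^+ 2)}.
      rewrite (_ : (fun s => _) = (fun s => dotv (posv xd tr s) (posv xd tr s)
        + dotv (velv tr s) (velv tr s))).
        by apply: cvgD; apply: cvg_dotv.
      by apply/funext => r; exact: err_norm_sqr.
    apply: cvgD; apply: cvgM; [exact: ce2|exact: cvg_cst| |exact: cvg_cst].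
    by apply: cvgM; [exact: cvg_cst|exact: cvg_dotv].
  - move=> t t0; have [d _] := is_derive_addf (is_derive1P (pos_val_derivable t0))
      (is_derive_scaler gam (is_derive1P (av_derivable t0))).
    exact: d.
  - move=> t t0 hr; have tn := ltW t0.
    have := is_derive_addf (is_derive1P (pos_val_derivable t0))
      (is_derive_scaler gam (is_derive1P (av_derivable t0))).
    move=> /derive1_is; rewrite -/(S) => ->.
    have [_ h1 _] := in_region 0 tn hr.
    have hX := thrust_err_sqr closed tn.
    have hA := thrust_bounded tn hr.
    have r_ge0 := rot_err_ge0 (err_rot_SO3 closed tn).
    apply: (cascade_rate (a := Amax) (ltW CX0) u0 (ltW gam0) (ltW k20) r_ge0 (pos_err_ge0 t)
      (ltW kap0) (pos_val_rate t0 hr) _ (av_ge tn) (av_rate t0) h1 (av_ge0 tn)).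
    + apply: le_trans hX _; rewrite ler_wpM2r // ler_pM2l //.
      have A0 := le_trans (norm2_ge0 _) hA.
      by rewrite ler_sqr ?nnegrE ?norm2_ge0.
    + rewrite le_eqVlt; apply/orP; left; apply/eqP; rewrite /cascade_weight.
      by field; rewrite !gt_eqF.
    + by rewrite -ler_pdivlMr // ge_min lexx.
    + by rewrite ge_min lexx orbT.
  - move=> t t0 hr; apply: le_trans (S_ge t t0 hr).
    by rewrite addr_ge0 // mulr_ge0 ?av_ge0 // ltW.
  - move=> t t0 hr hS; apply: region_small; rewrite -(ler_pM2l l0).
    apply: le_trans hS; apply: le_trans (S_ge t t0 hr).
    by rewrite lerDl mulr_ge0 ?av_ge0 // ltW.
  - exact: le_trans reg0 half.
  - exact: le_trans S0 small.
move=> t t0; have [h1 h2] := B t t0.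
apply: le_trans (S_ge t t0 (le_trans h1 half)) _; apply: le_trans h2 _.
by rewrite ler_wpM2r // expR_ge0.
Qed.

End PositionDecay.

(** * Choice of the gains *)

Section ClosedLoopDecay.
Context {R : realType} (n : nat) (pl : plant R n).
Hypothesis plok : plant_ok pl.

Variables (DR : 'cV[R]_3) (delta : R).
Hypothesis delta0 : 0 < delta.

(** The gains are chosen in the order c2, kz, kI: the constants of the attitude
    part are uniform in kI and those of the position part in kz. A large kz
    makes the initial compensation error -Dx/kz small, a large kI does the same
    for -DR/kI. *)
Lemma closed_loop_decay : exists (kz kI c2 : R) (P Q : 'M[R]_(dimx n + dimx n))
    (W : 'M[R]_(dimx n)) (tp ta C kap : R),
  [/\ gains_ok pl (design_gains kz kI c2 P Q),
      [/\ 1 <= kz, 3 * delta < kz, 1 <= kI, 0 < C & 0 < kap],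
      (forall s v : 'cV[R]_(dimx n), (P *m BB pl)^T *m col_mx s v = W *m s + v),
      (3 * delta) ^+ 2 / kz < tp /\ dotv DR DR / kI < ta
    & forall Dx xd b1d eI0 ex0 tr, `|Dx| <= delta ->
      closed_loop pl (design_gains kz kI c2 P Q) Dx DR xd b1d eI0 ex0 tr ->
      rot_err (err_rot pl kz kI c2 P Q xd b1d tr 0) < 1 ->
      let p := pos_err kz W Dx xd ex0 tr in
      let a := att_err pl kz kI c2 P Q DR xd b1d eI0 tr in
      p 0 <= tp -> a 0 <= ta ->
      forall t : R, 0 <= t -> p t + a t <= C * (p 0 + a 0) * expR (- (kap * t))].
Proof.
have [W [P [Q [lyap [Ppos Qpos] PB [r r0 hr] [q q0 hq]]]]] := linear_design plok.
have [_ Jpos _ _ _] := plok.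
have [c2 [mu2 [k2 [cl [cu [[c20 mu20 k20 cl0 cu0] hatt]]]]]] := attitude_design Jpos.
have [mu1 [rr [k1 [CX [l [u' [[mu10 rr04 k10 CX0 [l0 u'0]] hpos]]]]]]] :=
  position_design r0 q0 hr hq.
have /andP[rr0 rr4] := rr04.
pose u := u' + l; have lu : l <= u by rewrite lerDr ltW.
have u0 : 0 < u by rewrite addr_gt0.
pose d2 := 3 * delta; have d20 : 0 < d2 by rewrite mulr_gt0.
(* with this K the initial value u |Dx|^2 / kz of the position part uses at most
   a quarter of the level l K / (4 kz) of the region *)
pose K := 16 * u * d2 ^+ 2 / l.
have K0 : 0 < K by rewrite divr_gt0 ?mulr_gt0 ?exprn_gt0.
pose kz := (2 + K + d2) + K / rr ^+ 2.
have Krr0 : 0 < K / rr ^+ 2 by rewrite divr_gt0 ?exprn_gt0.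
have kzs : 2 + K + d2 <= kz by rewrite lerDl ltW.
have kzr : K / rr ^+ 2 <= kz by rewrite lerDr !addr_ge0 // ltW.
have kz1 : 1 < kz.
  apply: lt_le_trans kzs; rewrite -addrA ltr_pwDr ?addr_gt0 //.
  by rewrite ler1n.
have kzd : d2 < kz.
  by apply: lt_le_trans kzs; rewrite ltrDr addr_gt0.
have kz0 : 0 < kz := lt_trans ltr01 kz1.
pose g := cascade_weight pl CX k2 cl K d2.
have g0 : 0 < g.
  apply: divr_gt0; last by rewrite mulr_gt0.
  apply: mulr_gt0; first by rewrite mulr_gt0.
  apply: exprn_gt0.
  apply: ltr_wpDr; first exact: norm2_ge0.
  by rewrite !addr_gt0.
pose kap := cascade_decay_rate k1 u k2.
have kap0 : 0 < kap by rewrite lt_min !divr_gt0.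
pose Smax := l * (K / (4 * kz)).
have Smax0 : 0 < Smax by rewrite mulr_gt0 // divr_gt0 // mulr_gt0.
pose tp := Smax / (2 * u).
pose ta := Num.min (Smax / (2 * (g * cu))) (cl / 2 / cu).
have ta0 : 0 < ta.
  rewrite lt_min; apply/andP; split; last by rewrite !divr_gt0.
  by rewrite divr_gt0 // mulr_gt0 // mulr_gt0.
(* the initial value |DR|^2 / kI of the attitude part is then less than ta *)
pose kI := 1 + dotv DR DR / ta.
have kI1 : 1 <= kI by rewrite lerDl divr_ge0 ?dotvv_ge0 // ltW.
have kI0 : 0 < kI := lt_le_trans ltr01 kI1.
pose m := Num.min l (g * cl).
have m0 : 0 < m by rewrite lt_min l0 mulr_gt0.
pose C := (u + g * cu) / m.
exists kz, kI, c2, P, Q, W, tp, ta, C, kap; split.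
- have L := lyap (design_gains kz kI c2 P Q) erefl erefl.
  split; [by split|exact: (lyapunov_hurwitz Ppos Qpos L)|exact: Qpos|exact: Ppos|].
  exact: L.
- split=> //; first exact: ltW.
  by rewrite divr_gt0 // addr_gt0 // mulr_gt0.
- exact: PB.
- split.
    rewrite /tp ltr_pdivrMr // /Smax /K.
    rewrite (_ : _ / (2 * u) * kz = 2 * d2 ^+ 2); last by field; rewrite !gt_eqF.
    by rewrite -/d2 ltr_pMl ?exprn_gt0 // ltr1n.
  by rewrite ltr_pdivrMr // /kI mulrDr mulr1 mulrCA divff ?gt_eqF // mulr1 ltrDr.
- move=> Dx xd b1d eI0 ex0 tr hD closed re p a pt at' t t0.
  have aI A w i := hatt kI A w i kI1.
  have cua : cu * a 0 <= cl / 2.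
    rewrite mulrC -ler_pdivlMr //; apply: le_trans at' _.
    by rewrite ge_min lexx orbT.
  have [r1 av_rate] := attitude_decay closed Jpos kI1 k20 cl0 aI re cua.
  set av := att_val pl kz kI c2 P Q DR xd b1d eI0 tr mu2 in av_rate.
  have av_cont (s : R) : 0 <= s -> {for s, continuous av}.
    by move=> s0; exact: (att_val_continuous closed).
  have av_ge (s : R) : 0 <= s -> cl * a s <= av s.
    move=> s0; have [h _ _] := hatt kI _ (e_Om pl (design_gains kz kI c2 P Q) xd b1d tr s)
      (int_err pl kz kI c2 P Q DR xd b1d eI0 tr s) kI1 (err_rot_SO3 closed s0) (r1 s s0).
    exact: h.
  have av_le : av 0 <= cu * a 0.
    have [_ h _] := hatt kI _ (e_Om pl (design_gains kz kI c2 P Q) xd b1d tr 0)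
      (int_err pl kz kI c2 P Q DR xd b1d eI0 tr 0) kI1
      (err_rot_SO3 closed (lexx 0)) (r1 0 (lexx 0)).
    exact: h.
  have av_rot (s : R) : 0 <= s ->
      cl * rot_err (err_rot pl kz kI c2 P Q xd b1d tr s) <= av s.
    move=> s0; apply: le_trans (av_ge s s0); rewrite ler_pM2l //.
    by have [_ h] := att_err_ge closed kI1 s0.
  have p0 s : 0 <= p s.
    by rewrite addr_ge0 ?sqr_ge0 // mulr_ge0 ?dotvv_ge0 // ltW.
  have a0 (s : R) : 0 <= s -> 0 <= a s.
    by move=> s0; have [h1 h2] := att_err_ge closed kI1 s0; exact: le_trans h1 h2.
  have hposu (d : @config R n) (e X : 'cV[R]_3) : config_ok d ->
    c_size d ^+ 2 = dotv (lin (c_x d) (c_xi d)) (lin (c_x d) (c_xi d))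
      + dotv (lin (c_v d) (c_dxi d)) (lin (c_v d) (c_dxi d)) -> c_size d <= rr ->
    [/\ l * (c_size d ^+ 2 + kz * dotv e e) <=
          pos_fun pl W kz mu1 e (c_x d) (c_v d) (c_xi d) (c_q d) (c_dq d),
        pos_fun pl W kz mu1 e (c_x d) (c_v d) (c_xi d) (c_q d) (c_dq d) <=
          u * (c_size d ^+ 2 + kz * dotv e e)
      & pos_rate pl W kz mu1 X e (c_x d) (c_v d) (c_xi d) (c_dxi d) (c_q d) (c_dq d)
        <= - (k1 * (c_size d ^+ 2 + kz * dotv e e)) + CX * dotv X X].
    move=> ok sz rs; have [h1 h2 h3] := hpos kz d e X (ltW kz1) ok sz rs.
    split=> //; apply: le_trans h2 _; rewrite ler_wpM2r ?lerDl ?(ltW l0) //.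
    by rewrite addr_ge0 ?sqr_ge0 // mulr_ge0 ?dotvv_ge0 // ltW.
  have init : u * p 0 + g * av 0 <= Smax.
    have h1 : u * p 0 <= Smax / 2.
      rewrite mulrC -ler_pdivlMr //; apply: le_trans pt _.
      by rewrite /tp invfM mulrA.
    have h2 : g * av 0 <= Smax / 2.
      apply: (@le_trans _ _ (a 0 * (g * cu))).
        by rewrite mulrCA ler_pM2l // mulrC.
      have gc0 : 0 < g * cu by rewrite mulr_gt0.
      rewrite -(ler_pdivlMr _ _ gc0) -mulrA -invfM; apply: le_trans at' _.
      by rewrite ge_min lexx.
    by rewrite (splitr Smax) lerD.
  have D2 : norm2 Dx <= d2 := norm2_le_mxnorm3 hD.
  have dec := position_decay PB closed rr0 rr4 k10 CX0 l0 lu hposu k20 cl0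
    av_cont (fun t t0 => (av_rate t t0).1)
    (fun t t0 => (av_rate t t0).2) av_rot K0 D2 kzs kzr init t0.
  have exp0 := expR_ge0 (- (kap * t)).
  rewrite -(ler_pM2l m0).
  apply: (@le_trans _ _ (l * p t + g * av t)).
    rewrite mulrDr; apply: lerD; first by rewrite ler_wpM2r // ge_min lexx.
    apply: (@le_trans _ _ (g * (cl * a t))); last by rewrite ler_pM2l // av_ge.
    by rewrite mulrA ler_wpM2r ?a0 // ge_min lexx orbT.
  apply: le_trans dec _; rewrite mulrA ler_wpM2r // mulrA.
  rewrite (_ : m * C = u + g * cu); last by rewrite /C mulrC divfK // gt_eqF.
  rewrite (mulrDl u); apply: lerD; first by rewrite ler_pM2l // lerDl a0.
  rewrite -(mulrA g) ler_pM2l //; apply: le_trans av_le _.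
  by rewrite ler_pM2l // lerDr.
Qed.

End ClosedLoopDecay.

(** * Tracking errors, integral terms and equilibria *)

Section ErrorBounds.
Context {R : realType} (n : nat) (pl : plant R n).
Variables (kz kI c2 : R) (P Q : 'M[R]_(dimx n + dimx n)) (W : 'M[R]_(dimx n)).
Hypothesis PB : forall s v : 'cV[R]_(dimx n),
  (P *m BB pl)^T *m col_mx s v = W *m s + v.
Variables (Dx DR xd b1d eI0 : 'cV[R]_3) (ex0 : 'cV[R]_(dimx n)).
Variable tr : trajectory R n.
Let gn := design_gains kz kI c2 P Q.
Hypothesis closed : closed_loop pl gn Dx DR xd b1d eI0 ex0 tr.
Hypotheses (kz1 : 1 <= kz) (kI1 : 1 <= kI).

Let p := pos_err kz W Dx xd ex0 tr.
Let a := att_err pl kz kI c2 P Q DR xd b1d eI0 tr.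
Let te := tracking_error pl gn xd b1d tr.
Let E := err_rot pl kz kI c2 P Q xd b1d tr.
Let w := e_Om pl gn xd b1d tr.

Let kz0 : 0 <= kz := le_trans ler01 kz1.
Let kI0 : 0 <= kI := le_trans ler01 kI1.

Lemma tracking_error_sqr (t : R) : 0 <= t -> norm2 (te t) ^+ 2 =
  dotv (rot_vec (E t)) (rot_vec (E t)) + dotv (w t) (w t) + err_norm xd tr t ^+ 2.
Proof.
move=> t0; rewrite /te /tracking_error (z1E closed t0) e_RE.
by rewrite !norm2_sqr !dotv_col_mx.
Qed.

Lemma pos_err_ge0 (t : R) : 0 <= p t.
Proof. by rewrite addr_ge0 ?sqr_ge0 // mulr_ge0 ?dotvv_ge0. Qed.

Lemma att_err_nonneg (t : R) : 0 <= t -> 0 <= a t.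
Proof. by move=> t0; have [h1 h2] := att_err_ge closed kI1 t0; exact: le_trans h1 h2. Qed.

Lemma tracking_error_le (t : R) : 0 <= t -> norm2 (te t) ^+ 2 <= 2 * (p t + a t).
Proof.
move=> t0; rewrite tracking_error_sqr //.
have h1 := rot_vec_le (err_rot_SO3 closed t0); rewrite -/E in h1.
have h2 : 0 <= kz * dotv (comp_err kz W Dx xd ex0 tr t) (comp_err kz W Dx xd ex0 tr t).
  by rewrite mulr_ge0 ?dotvv_ge0.
have h3 := dotvv_ge0 (w t).
have h4 : 0 <= kI * dotv (int_err pl kz kI c2 P Q DR xd b1d eI0 tr t)
    (int_err pl kz kI c2 P Q DR xd b1d eI0 tr t) by rewrite mulr_ge0 ?dotvv_ge0.
have h5 := sqr_ge0 (err_norm xd tr t).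
rewrite /p /a /pos_err /att_err /att_size -/E -/w; move: h1 h2 h3 h4 h5.
move: (dotv _ _) (rot_err _) (kz * _) (dotv _ _) (kI * _) (_ ^+ 2) => b1 b2 b3 b4 b5 b6.
by move=> h1 h2 h3 h4 h5; lra.
Qed.

Lemma initial_pos_err : p 0 <= norm2 (te 0) ^+ 2
  + kz * dotv (topv ex0 - kz^-1 *: Dx) (topv ex0 - kz^-1 *: Dx).
Proof.
rewrite /p /pos_err /comp_err int_pos0 lerD2r tracking_error_sqr //.
by rewrite lerDr addr_ge0 ?dotvv_ge0.
Qed.

(** Below a right angle the attitude function is at most |e_R|^2. *)
Lemma initial_att_err : rot_err (E 0) < 1 -> a 0 <= norm2 (te 0) ^+ 2
  + kI * dotv (eI0 - kI^-1 *: DR) (eI0 - kI^-1 *: DR).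
Proof.
move=> r1; rewrite /a /att_err /att_size int_err0 lerD2r tracking_error_sqr //.
rewrite -/E -/w -[leLHS]addr0 lerD ?sqr_ge0 // lerD2r.
exact: rot_err_le (err_rot_SO3 closed (lexx 0)) (ltW r1).
Qed.

Lemma e_I_bounded (t : R) : 0 <= t -> norm2 (e_I tr t) <= 1 + a t + norm2 DR.
Proof.
move=> t0; rewrite (e_I_int_err closed t0).
apply: le_trans (norm2D _ _) _; apply: lerD.
  have [h1 h2] := att_err_ge closed kI1 t0.
  have a0 : 0 <= a t := le_trans h1 h2.
  rewrite norm2_le_sqr; last exact: addr_ge0 ler01 a0.
  set i := int_err pl kz kI c2 P Q DR xd b1d eI0 tr t.
  have h4 : dotv i i <= a t.
    apply: (@le_trans _ _ (kI * dotv i i)); first by rewrite ler_peMl ?dotvv_ge0.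
    by rewrite /a /att_err /att_size lerDr addr_ge0 ?dotvv_ge0.
  apply: le_trans h4 _; move: (a t) a0 => y y0.
  by have := sqr_ge0 y; rewrite [(1 + y) ^+ 2]sqrrD expr1n mul1r => y2; lra.
rewrite norm2Z ler_piMl ?norm2_ge0 // ger0_norm ?invr_ge0 //.
by rewrite invf_le1 // (lt_le_trans ltr01).
Qed.

Lemma e_x_bounded (c k : R) : 0 < k -> 0 <= c ->
  (forall t : R, 0 <= t -> err_norm xd tr t <= c * expR (- (k * t))) ->
  forall L, 0 <= L -> (forall s : 'cV[R]_(dimx n), norm2 (W *m s) <= L * norm2 s) ->
  forall t : R, 0 <= t -> norm2 (e_x tr t) <= norm2 ex0 + (L + 1) * c / k.
Proof.
move=> k0 c0 dec L L0 hW t t0; rewrite (e_x_int_pos PB closed t0).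
have B := @bounded_primitive R _ (int_pos W xd ex0 tr)
  (fun t : R => W *m posv xd tr t + velv tr t) ((L + 1) * c) k k0.
rewrite int_pos0 in B; apply: B; last exact: t0.
- by rewrite mulr_ge0 // addr_ge0.
- by move=> s s0; exact: (int_pos_continuous closed s0).
- by move=> s s0; exact: (int_pos_derive W closed s0).
- move=> s s0; apply: le_trans (norm2D _ _) _.
  have h := dec s (ltW s0).
  have h1 : norm2 (posv xd tr s) <= c * expR (- (k * s)).
    exact: le_trans (norm2_col_mx_l _ _) h.
  have h2 : norm2 (velv tr s) <= c * expR (- (k * s)).
    exact: le_trans (norm2_col_mx_r _ _) h.
  rewrite -mulrA mulrDl mul1r; apply: lerD => //.
  by apply: le_trans (hW _) _; rewrite ler_wpM2l.
Qed.

End ErrorBounds.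

Section Equilibrium.
Context {R : realType} (n : nat).
Variables (kz kI c2 : R) (P Q : 'M[R]_(dimx n + dimx n)).
Let gn := design_gains kz kI c2 P Q.

Lemma Kz_sat (ex : 'cV[R]_(dimx n)) :
  Kz gn *m satv (sigma gn) ex = kz *: satv 1 (topv ex).
Proof.
rewrite /Kz /= -{1}(mkvK (satv 1 ex)) gain_mx_mkv; congr (_ *: _).
by apply/matrixP => i j; rewrite !mxE.
Qed.

Lemma sat_small (y : R) : `|y| <= 1 -> sat 1 y = y.
Proof. by rewrite /sat ler_norml => /andP[y1 y2]; rewrite !ltNge y1 y2. Qed.

Lemma sat_inv (y : R) : `|sat 1 y| < 1 -> sat 1 y = y.
Proof.
rewrite /sat; case: (ltP 1 y) => [_|y1]; first by rewrite normr1 ltxx.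
by case: (ltP y (-1)) => [_|//]; rewrite normrN normr1 ltxx.
Qed.

Variable Dx : 'cV[R]_3.
Hypothesis Dkz : norm2 Dx < kz.

Let kz0 : 0 < kz. Proof. exact: le_lt_trans (norm2_ge0 _) Dkz. Qed.

Let small i : `|(kz^-1 *: Dx) i 0| < 1.
Proof.
apply: le_lt_trans (entry_le_norm2 _ _) _; rewrite norm2Z.
by rewrite gtr0_norm ?invr_gt0 // mulrC ltr_pdivrMr // mul1r.
Qed.

Lemma equilibrium_exists : exists ex, Kz gn *m satv (sigma gn) ex = Dx.
Proof.
exists (col_mx (kz^-1 *: Dx) 0); rewrite Kz_sat /topv col_mxKu.
rewrite (_ : satv 1 _ = kz^-1 *: Dx); first by rewrite scalerA divff ?gt_eqF // scale1r.
apply/matrixP => i j; rewrite ord1 [LHS]mxE sat_small //; exact: ltW.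
Qed.

(** The integral term of an equilibrium is not saturated, since each entry of
    Dx / kz is less than 1 in absolute value; this determines it. *)
Lemma equilibrium_topv ex : Kz gn *m satv (sigma gn) ex = Dx ->
  topv ex = kz^-1 *: Dx.
Proof.
rewrite Kz_sat => h.
have {}h : satv 1 (topv ex) = kz^-1 *: Dx.
  by rewrite -h scalerA mulVf ?gt_eqF // scale1r.
apply/matrixP => i j; rewrite ord1 -h [RHS]mxE sat_inv //.
by have := small i; rewrite -h [X in `|X|]mxE.
Qed.

End Equilibrium.

Theorem proposition3 (R : realType) (n : nat) (n_gt0 : (0 < n)%N)
    (pl : plant R n) (pl_ok : plant_ok pl)
    (pl_ctrl : controllable pl)
    (xd b1d : 'cV[R]_3) (b1d_unit : norm2 b1d = 1)
    (DR : 'cV[R]_3) (delta : R) (delta_gt0 : 0 < delta) :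
  exists gn : gains R n, gains_ok pl gn /\
    forall Dx : 'cV[R]_3, `|Dx| <= delta ->
    lyapunov_stable pl gn Dx DR xd b1d /\
    exists2 rho : R, 0 < rho &
      (forall tr : trajectory R n,
         closed_loop pl gn Dx DR xd b1d 0 0 tr ->
         starts_near pl gn xd b1d rho tr ->
         norm2 (tracking_error pl gn xd b1d tr t) @[t --> +oo] --> (0 : R)) /\
      (exists bnd : R, forall tr : trajectory R n,
         closed_loop pl gn Dx DR xd b1d 0 0 tr ->
         starts_near pl gn xd b1d rho tr ->
         forall t : R, 0 <= t ->
           norm2 (e_I tr t) <= bnd /\ norm2 (e_x tr t) <= bnd).
Proof.
have [kz [kI [c2 [P [Q [W [tp [ta [C [kap [ok [kz1 kzd kI1 C0 kap0] PB
  [zp za] decay]]]]]]]]]]] := closed_loop_decay pl_ok DR delta_gt0.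
pose gn := design_gains kz kI c2 P Q; exists gn; split=> // Dx hD.
have kz0 : 0 < kz := lt_le_trans ltr01 kz1.
have kI0 : 0 < kI := lt_le_trans ltr01 kI1.
have D3 := norm2_le_mxnorm3 hD.
have Dkz := le_lt_trans D3 kzd.
have zDx : (3 * delta) ^+ 2 / kz >= 0 by rewrite divr_ge0 ?sqr_ge0 // ltW.
have zDR : dotv DR DR / kI >= 0 by rewrite divr_ge0 ?dotvv_ge0 // ltW.
have tp0 : 0 < tp := le_lt_trans zDx zp.
have ta0 : 0 < ta := le_lt_trans zDR za.
split.
  split; first exact: equilibrium_exists.
  move=> ex_eq /(equilibrium_topv Dkz) exE eps eps0.
  (* perturbations of size eta contribute at most b eta^2 to the two parts *)
  pose b := 2 + kz + kI; have b0 : 0 < b by rewrite !addr_gt0.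
  pose m := Num.min (Num.min tp ta) (eps ^+ 2 / (4 * C)).
  have m0 : 0 < m by rewrite !lt_min tp0 ta0 divr_gt0 ?exprn_gt0 // mulr_gt0.
  pose eta := Num.min 1 (m / b).
  have eta0 : 0 < eta by rewrite lt_min ltr01 divr_gt0.
  have beta : b * eta ^+ 2 <= m.
    apply: (@le_trans _ _ (b * eta)).
      rewrite ler_pM2l // expr2 ler_piMl ?(ltW eta0) //.
      by rewrite ge_min lexx.
    by rewrite mulrC -ler_pdivlMr // ge_min lexx orbT.
  exists eta => // eI0 ex0 tr closed hI hx [r1 he] t t0.
  have sq k (y : 'cV[R]_k) : norm2 y < eta -> dotv y y <= eta ^+ 2.
    by move=> h; rewrite -norm2_le_sqr ltW.
  have te0 : norm2 (tracking_error pl gn xd b1d tr 0) ^+ 2 <= eta ^+ 2.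
    by rewrite norm2_sqr sq.
  have p0 := initial_pos_err W closed; have a0 := initial_att_err closed r1.
  set p := pos_err _ _ _ _ _ _ in p0; set a := att_err _ _ _ _ _ _ _ _ _ _ _ in a0.
  have e1 : dotv (topv ex0 - kz^-1 *: Dx) (topv ex0 - kz^-1 *: Dx) <= eta ^+ 2.
    rewrite -exE /topv -linearB; apply: sq; apply: le_lt_trans hx.
    exact: norm2_topv.
  have e2 := sq _ _ hI.
  have {}p0 : p 0 <= (1 + kz) * eta ^+ 2.
    rewrite mulrDl mul1r; apply: le_trans p0 _; apply: lerD => //.
    by rewrite ler_pM2l.
  have {}a0 : a 0 <= eta ^+ 2 + kI * eta ^+ 2.
    by apply: le_trans a0 _; apply: lerD => //; rewrite ler_pM2l.
  have {}sum0 : p 0 + a 0 <= m.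
    apply: le_trans beta; apply: le_trans (lerD p0 a0) _.
    by rewrite /b; move: (eta ^+ 2) => y; lra.
  have q0 : 0 <= p 0 by exact: pos_err_ge0.
  have q1 : 0 <= a 0 by exact: (att_err_nonneg closed).
  have tpm : m <= tp by rewrite !ge_min lexx.
  have tam : m <= ta by rewrite !ge_min lexx orbT.
  have pm : p 0 <= tp by apply: le_trans tpm; apply: le_trans sum0; rewrite lerDl.
  have am : a 0 <= ta by apply: le_trans tam; apply: le_trans sum0; rewrite lerDr.
  have dec := decay _ _ _ _ _ _ hD closed r1 pm am t t0.
  have te2 := tracking_error_le W closed kz1 kI1 t0.
  rewrite -ltr_sqr ?nnegrE ?norm2_ge0 ?(ltW eps0) //.
  apply: le_lt_trans te2 _; rewrite -/p -/a.
  have e4 : expR (- (kap * t)) <= 1.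
    by rewrite -expR0 ler_expR oppr_le0 mulr_ge0 // ltW.
  have h1 : p t + a t <= C * m.
    apply: le_trans dec _; rewrite -[leRHS]mulr1; apply: ler_pM => //.
    - by apply: mulr_ge0; [exact: ltW|exact: addr_ge0 q0 q1].
    - by rewrite ler_pM2l.
  have h2 : C * m <= eps ^+ 2 / 4.
    rewrite mulrC -ler_pdivlMr // -mulrA -invfM ge_min lexx orbT //.
  rewrite mulrC -ltr_pdivlMr //; apply: le_lt_trans (le_trans h1 h2) _.
  by rewrite ltr_pM2l ?exprn_gt0 // ltf_pV2 ?posrE // ltr_nat.
pose M := tp + ta; have M0 : 0 < M by rewrite addr_gt0.
(* the tracking error is at most c exp(- kap t / 2), because the Lyapunov
   functions bound its square *)
pose c := Num.sqrt (2 * (C * M)).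
have c0 : 0 <= c by exact: sqrtr_ge0.
have c2E : c ^+ 2 = 2 * (C * M).
  by rewrite sqr_sqrtr // mulr_ge0 // mulr_ge0 // ltW.
pose rho := Num.min 1 (Num.min (tp - (3 * delta) ^+ 2 / kz) (ta - dotv DR DR / kI)).
have rho0 : 0 < rho by rewrite !lt_min ltr01 !subr_gt0 zp za.
have rho2 : rho ^+ 2 <= rho by rewrite expr2 ler_piMl ?(ltW rho0) // ge_min lexx.
have zero_init tr : closed_loop pl gn Dx DR xd b1d 0 0 tr ->
    starts_near pl gn xd b1d rho tr -> forall t : R, 0 <= t ->
    pos_err kz W Dx xd 0 tr t + att_err pl kz kI c2 P Q DR xd b1d 0 tr t
    <= C * M * expR (- (kap * t)).
  move=> closed [r1 he] t t0.
  have te0 : norm2 (tracking_error pl gn xd b1d tr 0) ^+ 2 <= rho.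
    apply: le_trans rho2; rewrite ler_sqr ?nnegrE ?norm2_ge0 ?(ltW rho0) //.
    exact: ltW.
  have p0 := initial_pos_err W closed; have a0 := initial_att_err closed r1.
  set p := pos_err _ _ _ _ _ _ in p0 *; set a := att_err _ _ _ _ _ _ _ _ _ _ _ in a0 *.
  have self k (y : 'cV[R]_3) : 0 < k ->
      k * dotv (0 - k^-1 *: y) (0 - k^-1 *: y) = dotv y y / k.
    move=> k0; rewrite sub0r dotvNl dotvNr opprK dotvZl dotvZr.
    by field; rewrite gt_eqF.
  have z0 : topv (0 : 'cV[R]_(dimx n)) = 0 by rewrite /topv linear0.
  rewrite z0 self // in p0; rewrite self // in a0.
  have pm : p 0 <= tp.
    apply: le_trans p0 _; rewrite -lerBrDr; apply: le_trans te0 _.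
    rewrite !ge_min; apply/orP; right; apply/orP; left.
    rewrite lerD2l lerN2 ler_pM2r ?invr_gt0 // -norm2_sqr.
    by rewrite ler_sqr ?nnegrE ?norm2_ge0 // mulr_ge0 // ltW.
  have am : a 0 <= ta.
    apply: le_trans a0 _; rewrite -lerBrDr; apply: le_trans te0 _.
    by rewrite !ge_min lexx !orbT.
  apply: le_trans (decay _ _ _ _ _ _ hD closed r1 pm am t t0) _.
  by rewrite ler_wpM2r ?expR_ge0 // ler_pM2l // lerD.
have half (t : R) : expR (- (kap / 2 * t)) ^+ 2 = expR (- (kap * t)).
  by rewrite -expRM_natl; congr expR; field.
have kap2 : 0 < kap / 2 by rewrite divr_gt0.
exists rho => //; split.
  move=> tr closed near; apply: (@exp_squeeze R _ c (kap / 2)) => // t t0.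
  rewrite norm2_ge0 /= -ler_sqr ?nnegrE ?norm2_ge0 ?mulr_ge0 ?expR_ge0 //.
  rewrite exprMn half c2E -mulrA; have te2 := tracking_error_le W closed kz1 kI1 t0.
  apply: le_trans te2 _; rewrite ler_pM2l //.
  exact: zero_init closed near t t0.
have [L L0 hW] := mulmx_norm2_bounded W.
exists (Num.max (1 + C * M + norm2 DR) ((L + 1) * c / (kap / 2))).
move=> tr closed near t t0; have hz := zero_init tr closed near.
split; rewrite le_max; apply/orP; [left|right].
  apply: le_trans (e_I_bounded closed kI1 t0) _; rewrite lerD2r lerD2l.
  apply: (@le_trans _ _ (C * M * expR (- (kap * t)))).
    by apply: le_trans (hz t t0); rewrite lerDr pos_err_ge0.
  rewrite ler_piMr ?mulr_ge0 ?(ltW C0) ?(ltW M0) //.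
  by rewrite -expR0 ler_expR oppr_le0 mulr_ge0 // ltW.
have B := e_x_bounded PB closed kap2 c0 _ L0 hW t0.
rewrite norm2_0 add0r in B; apply: B => s s0.
rewrite -ler_sqr ?nnegrE ?norm2_ge0 ?mulr_ge0 ?expR_ge0 //.
rewrite exprMn half c2E; apply: (@le_trans _ _ (C * M * expR (- (kap * s)))).
  apply: le_trans (hz s s0); rewrite /pos_err -addrA lerDl addr_ge0 //.
    by rewrite mulr_ge0 ?dotvv_ge0 // ltW.
  exact: (att_err_nonneg closed).
by rewrite ler_wpM2r ?expR_ge0 // mulr_natl mulr2n lerDl mulr_ge0 // ltW.
Qed.
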